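(* For every $T\ge 0$, every $m\ge 0$ and $0\le r\le 3$, $$\dim_K {\rm HH}^{4m+r}(A_T)=\begin{cases} 2T+4m+1 & \text{if } r=0,\\ 2T+8m+5 & \text{if } {\rm char}\,K\mid 2T+1 \text{ and } r=1,\\ 2T+4(2m+1) & \text{if } {\rm char}\,K\nmid 2T+1 \text{ and } r=1,\\ 2T+4(m+1) & \text{if } {\rm char}\,K\mid 2T+1 \text{ and } r=2,\\ 2T+4m+3 & \text{if } {\rm char}\,K\nmid 2T+1 \text{ and } r=2,\\ 2T & \text{if } r=3. \end{cases}$$
   Context: $K$ is an algebraically closed field (if ${\rm char}\,K=0$, then ${\rm char}\,K\nmid 2T+1$). $\Gamma$ is the quiver with four vertices $0,1,2,3$ and eight arrows $a_i,b_i$ ($0\le i\le 3$), where $a_i$ and $b_i$ both go from $i$ to $i+1$ (indices modulo $4$); paths are written from left to right. In the path algebra $K\Gamma$ put $x=\sum_{i=0}^3 a_i$ and $y=\sum_{i=0}^3 b_i$. For an integer $T\ge 0$, $A_T=K\Gamma/I_T$, where $I_T$ is the two-sided ideal $\langle xy,\ x^{4T+2}+y^{4T+2},\ yx\rangle$. With $A_T^{\rm e}=A_T^{\rm op}\otimes_K A_T$, the Hochschild cohomology groups are ${\rm HH}^n(A_T)={\rm Ext}^n_{A_T^{\rm e}}(A_T,A_T)$ for $n\ge 0$. *)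

(* Defs.v *)
From HB Require Import structures.
From mathcomp Require Import all_boot all_order all_algebra.
From mathcomp Require Import finmap.
From mathcomp Require Import boolp.
From mathcomp.multinomials Require Import monalg.

Set Implicit Arguments.
Unset Strict Implicit.
Unset Printing Implicit Defensive.

Import GRing.Theory.
Import Quotient.

Local Open Scope fset_scope.
Local Open Scope ring_scope.
Local Open Scope quotient_scope.

(* {malg K[B]} (finitely supported functions B -> K) is the K-vector space    *)
(* with basis B; lin_ext h is the linear map sending each basis vector << b >>*)
(* to h b.                                                                    *)
Section LinExt.
Variables (K : fieldType) (B : choiceType).

Definition lin_ext (V : lmodType K) (h : B -> V) (z : {malg K[B]}) : V :=
  \sum_(b <- msupp z) z@_b *: h b.

Section OneTarget.
Variables (V : lmodType K) (h : B -> V).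

Lemma lin_extE z : lin_ext h z = \sum_(b <- msupp z) z@_b *: h b.
Proof. by []. Qed.

Lemma lin_extEw (z : {malg K[B]}) (d : {fset B}) :
  (msupp z `<=` d)%fset -> lin_ext h z = \sum_(b <- d) z@_b *: h b.
Proof.
move=> le_d; rewrite /lin_ext (big_fset_incl _ le_d) //= => b _ /mcoeff_outdom ->.
by rewrite scale0r.
Qed.

Lemma lin_ext_is_linear : linear (lin_ext h).
Proof.
move=> c u v; pose d := (msupp u `|` msupp v)%fset.
have lu : (msupp u `<=` d)%fset by apply: fsubsetUl.
have lv : (msupp v `<=` d)%fset by apply: fsubsetUr.
have luv : (msupp (c *: u + v) `<=` d)%fset.
  apply: (fsubset_trans (msuppD_le _ _)); rewrite fsubUset lv andbT.
  exact: fsubset_trans (msuppZ_le _ _) lu.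
rewrite (lin_extEw lu) (lin_extEw lv) (lin_extEw luv) scaler_sumr -big_split /=.
by apply: eq_bigr => b _; rewrite mcoeffD mcoeffZ scalerDl scalerA.
Qed.

HB.instance Definition _ :=
  GRing.isLinear.Build K {malg K[B]} V _ (lin_ext h) lin_ext_is_linear.

Lemma lin_extU b : lin_ext h << b >> = h b.
Proof.
by rewrite (lin_extEw msuppU_le) big_seq_fset1 mcoeffUU scale1r.
Qed.

End OneTarget.

Lemma malg_linear_eq (V : lmodType K) (f g : {linear {malg K[B]} -> V}) :
  (forall b, f << b >> = g << b >>) -> f =1 g.
Proof.
move=> fg z; rewrite (monalgE z) !linear_sum; apply: eq_bigr => b _.
have -> : << z@_b *g b >> = z@_b *: << b >> :> {malg K[B]}.
  by apply/malgP => k; rewrite mcoeffZ !mcoeffU mulrnAr mulr1.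
by rewrite !linearZ /= fg.
Qed.

Lemma malgU_neq0 (b : B) : (<< b >> : {malg K[B]}) != 0.
Proof. by rewrite monalgU_eq0 oner_eq0. Qed.

End LinExt.

(* A small category with finitely many objects, given by its morphisms: comp  *)
(* is the partial composition, in diagrammatic order, and ids lists the       *)
(* identities. The category algebra has the morphisms as a basis, the product *)
(* of two non-composable morphisms is 0 and the unit is the sum of the        *)
(* identities. Path algebras and monoid algebras are both instances.          *)
Record fobCat := FobCat {
  mor :> choiceType;
  comp : mor -> mor -> option mor;
  ids : seq mor;
  compA : forall f g h,
    obind (comp f) (comp g h) = obind (fun fg => comp fg h) (comp f g);
  comp1m : forall f, pmap (fun e => comp e f) ids = [:: f];
  compm1 : forall f, pmap (comp f) ids = [:: f];
  ids_neq0 : ids != [::]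
}.

Section CatAlg.
Variables (K : fieldType) (C : fobCat).
Local Notation KC := {malg K[mor C]}.

Definition omor (o : option C) : KC := if o is Some f then << f >> else 0.

Definition catalg_mul (u v : KC) : KC :=
  lin_ext (fun f => lin_ext (fun g => omor (comp f g)) v) u.

Definition catalg_one : KC := \sum_(e <- ids C) << e >>.

Fact catalg_mulr_linear u : linear (catalg_mul u).
Proof.
move=> c v w; rewrite /catalg_mul !(lin_extE _ u) scaler_sumr -big_split /=.
by apply: eq_bigr => f _; rewrite linearP scalerDr !scalerA [_ * c]mulrC.
Qed.

Fact catalg_mull_linear v : linear (catalg_mul ^~ v).
Proof. by move=> c u w; rewrite /catalg_mul linearP. Qed.

HB.instance Definition _ u :=
  GRing.isLinear.Build K KC KC _ (catalg_mul u) (catalg_mulr_linear u).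

Definition catalg_rmul v u := catalg_mul u v.
HB.instance Definition _ v :=
  GRing.isLinear.Build K KC KC _ (catalg_rmul v) (catalg_mull_linear v).

Lemma catalg_mulUU f g : catalg_mul << f >> << g >> = omor (comp f g).
Proof. by rewrite /catalg_mul !lin_extU. Qed.

Lemma catalg_mulA : associative catalg_mul.
Proof.
move=> u v w.
suff H f g h : catalg_mul << f >> (catalg_mul << g >> << h >>) =
               catalg_mul (catalg_mul << f >> << g >>) << h >>.
  have H1 f g : catalg_mul << f >> (catalg_mul << g >> w) =
                catalg_mul (catalg_mul << f >> << g >>) w.
    exact: (malg_linear_eq (f := catalg_mul << f >> \o catalg_mul << g >>)
      (g := catalg_mul (catalg_mul << f >> << g >>)) (H f g) w).
  have H2 f : catalg_mul << f >> (catalg_mul v w) =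
              catalg_mul (catalg_mul << f >> v) w.
    exact: (malg_linear_eq (f := catalg_mul << f >> \o catalg_rmul w)
      (g := catalg_rmul w \o catalg_mul << f >>) (H1 f) v).
  exact: (malg_linear_eq (f := catalg_rmul (catalg_mul v w)) (g := catalg_rmul w \o catalg_rmul v)
    H2 u).
rewrite !catalg_mulUU; move: (compA f g h).
have m0 v' : catalg_mul 0 v' = 0 by exact: (linear0 (catalg_rmul v')).
case: (comp g h) => [gh|]; case: (comp f g) => [fg|] /= e;
  by rewrite ?m0 ?catalg_mulUU ?linear0 ?e // -e.
Qed.

Lemma sum_omor (h : mor C -> option (mor C)) (f : C) :
  pmap h (ids C) = [:: f] -> \sum_(e <- ids C) omor (h e) = << f >>.
Proof.
move=> hf; transitivity (\sum_(g <- pmap h (ids C)) (<< g >> : KC)).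
  by rewrite big_pmap; apply: eq_bigr => e _; case: (h e).
by rewrite hf big_seq1.
Qed.

Lemma catalg_mul1 : left_id catalg_one catalg_mul.
Proof.
apply: (malg_linear_eq (f := catalg_mul catalg_one) (g := idfun)) => f /=.
rewrite -[catalg_mul _ _]/(catalg_rmul _ _) linear_sum /= /catalg_rmul.
under eq_bigr do rewrite catalg_mulUU.
by rewrite (sum_omor (comp1m f)).
Qed.

Lemma catalg_mulr1 : right_id catalg_one catalg_mul.
Proof.
apply: (malg_linear_eq (f := catalg_rmul catalg_one) (g := idfun)) => f /=.
rewrite /catalg_rmul linear_sum /=.
under eq_bigr do rewrite catalg_mulUU.
by rewrite (sum_omor (compm1 f)).
Qed.

Lemma catalg_mulDl : left_distributive catalg_mul +%R.
Proof. by move=> u v w; exact: (linearD (catalg_rmul w)). Qed.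

Lemma catalg_mulDr : right_distributive catalg_mul +%R.
Proof. by move=> u v w; exact: linearD. Qed.

Lemma catalg_oner_neq0 : catalg_one != 0.
Proof.
have := ids_neq0 C; case: (ids C) => // e _ _; apply/eqP => one0.
have := malgU_neq0 K e; rewrite -(catalg_mul1 << e >>) one0 -/(catalg_rmul _ 0).
by rewrite linear0 eqxx.
Qed.

Lemma catalg_scaleAl (c : K) (u v : KC) :
  c *: catalg_mul u v = catalg_mul (c *: u) v.
Proof. exact/esym/(linearZ_LR (catalg_rmul v)). Qed.

Lemma catalg_scaleAr (c : K) (u v : KC) :
  c *: catalg_mul u v = catalg_mul u (c *: v).
Proof. by rewrite linearZ_LR. Qed.

End CatAlg.

Definition catalg (K : fieldType) (C : fobCat) := {malg K[mor C]}.

Section CatAlgInstances.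
Variables (K : fieldType) (C : fobCat).

HB.instance Definition _ := GRing.Lmodule.on (catalg K C).
HB.instance Definition _ := GRing.Zmodule_isNzRing.Build (catalg K C)
  (@catalg_mulA K C) (@catalg_mul1 K C) (@catalg_mulr1 K C) (@catalg_mulDl K C)
  (@catalg_mulDr K C) (@catalg_oner_neq0 K C).
HB.instance Definition _ :=
  GRing.Lmodule_isLalgebra.Build K (catalg K C) (@catalg_scaleAl K C).
HB.instance Definition _ :=
  GRing.Lalgebra_isAlgebra.Build K (catalg K C) (@catalg_scaleAr K C).

End CatAlgInstances.

Section Ideal.
Variable R : nzRingType.

Definition is_ideal (J : R -> Prop) : Prop :=
  [/\ J 0, forall x y, J x -> J y -> J (x - y),
      forall a x, J x -> J (a * x) & forall a x, J x -> J (x * a)].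

Definition ideal_gen (X : R -> Prop) (x : R) : Prop :=
  forall J, is_ideal J -> (forall y, X y -> J y) -> J x.

Lemma ideal_gen_is_ideal X : is_ideal (ideal_gen X).
Proof.
split=> [J [] //|x y Jx Jy J iJ XJ|a x Jx J iJ XJ|a x Jx J iJ XJ];
  case: (iJ) => [J0 JB JMl JMr].
- by apply: JB; [exact: Jx | exact: Jy].
- by apply: JMl; exact: Jx.
- by apply: JMr; exact: Jx.
Qed.

(* Relations generating a proper ideal: MathComp algebras satisfy 1 != 0. *)
Record relations := Relations {
  is_relation :> R -> Prop;
  relations_proper : ~ ideal_gen is_relation 1
}.

Variable X : relations.

Definition ideal_pred : {pred R} := fun x => `[< ideal_gen X x >].

Lemma ideal_predP x : reflect (ideal_gen X x) (x \in ideal_pred).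
Proof. exact: asboolP. Qed.

Fact ideal_pred_zmod_closed : zmod_closed ideal_pred.
Proof.
have [I0 IB _ _] := ideal_gen_is_ideal X; split; first exact/ideal_predP.
by move=> x y /ideal_predP Ix /ideal_predP Iy; apply/ideal_predP; exact: IB.
Qed.

HB.instance Definition _ :=
  GRing.isZmodClosed.Build R ideal_pred ideal_pred_zmod_closed.

End Ideal.

Definition quotalg (K : fieldType) (R : algType K) (X : relations R) :=
  {quot (ideal_pred X : zmodClosed R)}.

Section QuotAlg.
Variables (K : fieldType) (R : algType K) (X : relations R).
Local Notation Q := (quotalg X).
Local Notation I := (ideal_pred X : zmodClosed R).

HB.instance Definition _ := GRing.Zmodule.on Q.

Definition quotpi (x : R) : Q := \pi_({quot I}) x.

Lemma quotpi_surj (q : Q) : exists x, quotpi x = q.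
Proof. by exists (repr (q : {quot I})); rewrite /quotpi reprK. Qed.

Lemma quotpi_eq x y : quotpi x = quotpi y <-> ideal_gen X (x - y).
Proof.
have e := idealrBE I x y; split.
  by move=> /eqP exy; apply/ideal_predP; rewrite e.
by move=> /ideal_predP; rewrite e => /eqP.
Qed.

Lemma quotpi_is_zmod : zmod_morphism quotpi.
Proof. by move=> x y; exact: (raddfB \pi_({quot I})). Qed.

HB.instance Definition _ := GRing.isZmodMorphism.Build R Q quotpi quotpi_is_zmod.

Definition quotrepr (q : Q) : R := repr (q : {quot I}).
Local Notation rp := quotrepr.
Lemma quotreprK q : quotpi (rp q) = q. Proof. exact: reprK. Qed.
Let rpI x : ideal_gen X (x - rp (quotpi x)).
Proof. by apply/quotpi_eq; rewrite quotreprK. Qed.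

Definition quotalg_mul (p q : Q) : Q := quotpi (rp p * rp q).
Definition quotalg_scale (c : K) (q : Q) : Q := quotpi (c *: rp q).

Lemma quotpi_mul x y : quotalg_mul (quotpi x) (quotpi y) = quotpi (x * y).
Proof.
have [_ IB Il Ir] := ideal_gen_is_ideal X.
have IN z : ideal_gen X z -> ideal_gen X (- z).
  by move=> Iz; rewrite -sub0r; apply: IB => //; case: (ideal_gen_is_ideal X).
apply/esym/quotpi_eq; set x' := rp _; set y' := rp _.
have -> : x * y - x' * y' = (x - x') * y - (x' * - (y - y')).
  by rewrite mulrN mulrBl mulrBr opprK addrA subrK.
by apply: IB; [apply: Ir | apply: Il; apply: IN]; exact: rpI.
Qed.

Lemma quotpi_scale c x : quotalg_scale c (quotpi x) = quotpi (c *: x).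
Proof.
have [_ _ Il _] := ideal_gen_is_ideal X.
apply/esym/quotpi_eq; rewrite -scalerBr -[X in c *: X]mul1r scalerAl.
exact: Il (rpI x).
Qed.

Lemma quotpi_ind (P : Q -> Prop) : (forall x, P (quotpi x)) -> forall q, P q.
Proof. by move=> H q; rewrite -(quotreprK q). Qed.

Fact quotalg_mulA : associative quotalg_mul.
Proof.
elim/quotpi_ind => x; elim/quotpi_ind => y; elim/quotpi_ind => z.
by rewrite !quotpi_mul mulrA.
Qed.
Fact quotalg_mul1 : left_id (quotpi 1) quotalg_mul.
Proof. by elim/quotpi_ind => x; rewrite quotpi_mul mul1r. Qed.
Fact quotalg_mulr1 : right_id (quotpi 1) quotalg_mul.
Proof. by elim/quotpi_ind => x; rewrite quotpi_mul mulr1. Qed.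
Fact quotalg_mulDl : left_distributive quotalg_mul +%R.
Proof.
elim/quotpi_ind => x; elim/quotpi_ind => y; elim/quotpi_ind => z.
by rewrite -raddfD !quotpi_mul -raddfD mulrDl.
Qed.
Fact quotalg_mulDr : right_distributive quotalg_mul +%R.
Proof.
elim/quotpi_ind => x; elim/quotpi_ind => y; elim/quotpi_ind => z.
by rewrite -raddfD !quotpi_mul -raddfD mulrDr.
Qed.
Fact quotalg_oner_neq0 : quotpi 1 != 0.
Proof.
apply/eqP; rewrite -(raddf0 quotpi) => /quotpi_eq; rewrite subr0.
exact: relations_proper.
Qed.

HB.instance Definition _ := GRing.Zmodule_isNzRing.Build Q quotalg_mulA
  quotalg_mul1 quotalg_mulr1 quotalg_mulDl quotalg_mulDr quotalg_oner_neq0.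

Fact quotalg_scaleA c d q :
  quotalg_scale c (quotalg_scale d q) = quotalg_scale (c * d) q.
Proof. by elim/quotpi_ind: q => x; rewrite !quotpi_scale scalerA. Qed.
Fact quotalg_scale1 : left_id 1 quotalg_scale.
Proof. by elim/quotpi_ind => x; rewrite quotpi_scale scale1r. Qed.
Fact quotalg_scaleDr : right_distributive quotalg_scale +%R.
Proof.
move=> c; elim/quotpi_ind => x; elim/quotpi_ind => y.
by rewrite -raddfD !quotpi_scale -raddfD scalerDr.
Qed.
Fact quotalg_scaleDl q : {morph quotalg_scale^~ q : c d / c + d}.
Proof.
by move=> c d; elim/quotpi_ind: q => x; rewrite !quotpi_scale -raddfD scalerDl.
Qed.

HB.instance Definition _ := GRing.Zmodule_isLmodule.Build K Q quotalg_scaleA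
  quotalg_scale1 quotalg_scaleDr quotalg_scaleDl.

Fact quotalg_scaleAl (c : K) (p q : Q) : c *: (p * q) = (c *: p) * q.
Proof.
elim/quotpi_ind: p => x; elim/quotpi_ind: q => y.
rewrite -[_ * _]/(quotalg_mul _ _) -[_ * _ in RHS]/(quotalg_mul _ _).
rewrite quotpi_mul -[_ *: _]/(quotalg_scale _ _) -[_ *: _ in RHS]/(quotalg_scale _ _).
by rewrite !quotpi_scale quotpi_mul scalerAl.
Qed.

HB.instance Definition _ := GRing.Lmodule_isLalgebra.Build K Q quotalg_scaleAl.

Fact quotalg_scaleAr (c : K) (p q : Q) : c *: (p * q) = p * (c *: q).
Proof.
elim/quotpi_ind: p => x; elim/quotpi_ind: q => y.
rewrite -[_ * _]/(quotalg_mul _ _) -[_ * _ in RHS]/(quotalg_mul _ _).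
rewrite quotpi_mul -[_ *: _]/(quotalg_scale _ _) -[_ *: _ in RHS]/(quotalg_scale _ _).
by rewrite !quotpi_scale quotpi_mul scalerAr.
Qed.

HB.instance Definition _ := GRing.Lalgebra_isAlgebra.Build K Q quotalg_scaleAr.

Fact quotpi_is_monoid : monoid_morphism quotpi.
Proof. by split=> // x y; rewrite -[RHS]/(quotalg_mul _ _) quotpi_mul. Qed.
Fact quotpi_is_scalable : scalable quotpi.
Proof. by move=> c x; rewrite -[RHS]/(quotalg_scale _ _) quotpi_scale. Qed.

HB.instance Definition _ := GRing.isMonoidMorphism.Build R Q quotpi quotpi_is_monoid.
HB.instance Definition _ := GRing.isScalable.Build K R Q _ quotpi quotpi_is_scalable.

End QuotAlg.

Arguments quotpi {K R} X x.

Record quiver := Quiver {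
  vertex : finType;
  arrow : choiceType;
  src : arrow -> vertex;
  tgt : arrow -> vertex;
  vertex_neq0 : (0 < #|vertex|)%N
}.

(* A path is a start vertex together with a sequence of composable arrows;    *)
(* the empty sequences are the trivial paths. In pcomp p q the path p is      *)
(* followed first.                                                            *)
Section Paths.
Variable Q : quiver.

Fixpoint is_path (v : vertex Q) (s : seq (arrow Q)) : bool :=
  if s is a :: s' then (src a == v) && is_path (tgt a) s' else true.

Definition is_quiver_path (p : vertex Q * seq (arrow Q)) := is_path p.1 p.2.
Definition path_of := {p | is_quiver_path p}.
HB.instance Definition _ := Choice.on path_of.

Implicit Types p q r : path_of.

Definition pstart p : vertex Q := (val p).1.
Definition parrows p : seq (arrow Q) := (val p).2.
Definition pend p : vertex Q := last (pstart p) [seq tgt a | a <- parrows p].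

Definition ptriv (v : vertex Q) : path_of :=
  exist is_quiver_path (v, [::]) isT.

Fact parrow_subproof (a : arrow Q) : is_path (src a) [:: a].
Proof. by rewrite /= eqxx. Qed.
Definition parrow (a : arrow Q) : path_of :=
  exist is_quiver_path (src a, [:: a]) (parrow_subproof a).

Fact pcat_subproof p q :
  pend p == pstart q -> is_path (pstart p) (parrows p ++ parrows q).
Proof.
move: p q => [[v s] /= vs] [[w t] /= wt]; rewrite /pend /pstart /parrows /=.
elim: s v vs => [|a s IHs] v /=; first by move=> _ /eqP->.
by case/andP=> -> sP e; exact: IHs.
Qed.
Definition pcat p q (pq : pend p == pstart q) : path_of :=
  exist is_quiver_path (pstart p, parrows p ++ parrows q)
    (pcat_subproof pq).

Definition pcomp p q : option path_of :=
  if @idP (pend p == pstart q) is ReflectT pq then Some (pcat pq) else None.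

Lemma pcompE p q :
  omap val (pcomp p q) = if pend p == pstart q
    then Some (pstart p, parrows p ++ parrows q) else None.
Proof.
by rewrite /pcomp; case: {-}_ / idP => [pq|/negP/negPf->] //=; rewrite pq.
Qed.

Variant pcomp_spec p q : option path_of -> Type :=
  | PcompSome r of pend p = pstart q & pstart r = pstart p & pend r = pend q
      & parrows r = parrows p ++ parrows q : pcomp_spec p q (Some r)
  | PcompNone of pend p != pstart q : pcomp_spec p q None.

Lemma pcompP p q : pcomp_spec p q (pcomp p q).
Proof.
rewrite /pcomp; case: {-}_ / idP => [pq|/negP npq]; last exact: PcompNone.
apply: PcompSome => //; first exact/eqP.
by rewrite {1}/pend /= map_cat last_cat -/(pend p) (eqP pq).
Qed.

Lemma path_inj p q : pstart p = pstart q -> parrows p = parrows q -> p = q.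
Proof.
by move: p q => [[v s] vs] [[w t] wt] /= e1 e2; apply/val_inj; congr pair.
Qed.

Fact pcompA p q r :
  obind (pcomp p) (pcomp q r) = obind (fun pq => pcomp pq r) (pcomp p q).
Proof.
case: (pcompP q r) => [qr e1 s1 t1 a1|n1];
  case: (pcompP p q) => [pq e2 s2 t2 a2|n2] //=.
- case: (pcompP p qr) => [x ex sx tx ax|]; last by rewrite s1 e2 eqxx.
  case: (pcompP pq r) => [y ey sy ty ay|]; last by rewrite t2 e1 eqxx.
  by congr Some; apply: path_inj; rewrite ?sx ?sy // ax ay a1 a2 catA.
- by case: (pcompP p qr) => // x; rewrite s1 => e; rewrite e eqxx in n2.
- by case: (pcompP pq r) => // x; rewrite t2 => e; rewrite e eqxx in n1.
Qed.

Let pmap_if (v : vertex Q) p :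
  pmap (fun w => if w == v then Some p else None) (enum (vertex Q)) = [:: p].
Proof.
have : count (pred1 v) (enum (vertex Q)) = 1%N.
  by rewrite count_uniq_mem ?enum_uniq // mem_enum.
elim: (enum _) => //= w s IHs; case: eqP => /= [_ [c0]|_]; last exact: IHs.
congr cons; elim: s c0 {IHs} => //= x s IHs; case: eqP => //= _; exact: IHs.
Qed.

Fact pcomp1m p : pmap (fun e => pcomp e p) [seq ptriv v | v <- enum (vertex Q)] = [:: p].
Proof.
have pm (f : path_of -> option path_of) s :
  pmap f (map ptriv s) = pmap (f \o ptriv) s by elim: s => //= ? ? ->.
rewrite pm -[RHS](pmap_if (pstart p)); apply: eq_pmap => v /=.
case: (pcompP (ptriv v) p) => [r e sr _ ar|]; last by move/negPf->.
rewrite -e eqxx; congr Some; apply: path_inj => //.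
by rewrite sr -e.
Qed.

Fact pcompm1 p : pmap (pcomp p) [seq ptriv v | v <- enum (vertex Q)] = [:: p].
Proof.
have pm (f : path_of -> option path_of) s :
  pmap f (map ptriv s) = pmap (f \o ptriv) s by elim: s => //= ? ? ->.
rewrite pm -[RHS](pmap_if (pend p)); apply: eq_pmap => v /=.
case: (pcompP p (ptriv v)) => [r e sr _ ar|]; last by rewrite eq_sym => /negPf->.
rewrite e eqxx; congr Some; apply: path_inj => //.
by rewrite ar cats0.
Qed.

Fact ptriv_neq0 : [seq ptriv v | v <- enum (vertex Q)] != [::].
Proof.
by rewrite -size_eq0 size_map -cardE -lt0n vertex_neq0.
Qed.

Definition path_cat : fobCat :=
  FobCat pcompA pcomp1m pcompm1 ptriv_neq0.

End Paths.

Definition pathalg (K : fieldType) (Q : quiver) := catalg K (path_cat Q).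
HB.instance Definition _ K Q := GRing.Algebra.on (pathalg K Q).

Definition path_vec (K : fieldType) (Q : quiver) (p : path_of Q) : pathalg K Q :=
  << p >>.

(* In Gamma, (false, i) is the arrow a_i and (true, i) is b_i.        *)
Fact Gamma_neq0 : (0 < #|'I_4|)%N. Proof. by rewrite card_ord. Qed.

Definition Gamma : quiver :=
  @Quiver 'I_4 (bool * 'I_4)%type (fun a => a.2) (fun a => ordS a.2) Gamma_neq0.

Section AlgebraAT.
Variables (K : fieldType) (T : nat).
Local Notation KG := (pathalg K Gamma).

Definition aG (i : 'I_4) : KG := path_vec K (parrow (Q := Gamma) (false, i)).
Definition bG (i : 'I_4) : KG := path_vec K (parrow (Q := Gamma) (true, i)).
Definition xG : KG := \sum_(i < 4) aG i.
Definition yG : KG := \sum_(i < 4) bG i.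

Definition IT_gen (z : KG) : Prop :=
  [\/ z = xG * yG, z = xG ^+ (4 * T + 2) + yG ^+ (4 * T + 2) | z = yG * xG].

Let e0 : path_of Gamma := ptriv (Q := Gamma) (ord0 : 'I_4).
Let pcomp_e0 p q :
  oapp (fun r => r == e0) false (pcomp p q) = (q == e0) && (p == e0).
Proof.
case: (pcompP p q) => [r e sr tr ar|npq] /=.
  apply/eqP/andP.
    move=> re0; rewrite re0 in sr tr ar.
    have /eqP : size (parrows p ++ parrows q) = 0%N by rewrite -ar.
    rewrite size_cat addn_eq0 !size_eq0 => /andP[/eqP p0 /eqP q0].
    have sp : pstart p = ord0 by rewrite -sr.
    split; apply/eqP/path_inj => //.
    by move: e; rewrite /pend p0 /= sp.
  case=> /eqP qe /eqP pe; apply: path_inj; first by rewrite sr pe.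
  by rewrite ar pe qe.
apply/esym/negP => /andP[/eqP qe /eqP pe].
by rewrite pe qe eqxx in npq.
Qed.

Section Augmentation.
Variable eps : {linear {malg K[path_of Gamma]} -> K^o}.
Hypothesis epsU : forall p, eps << p >> = (p == e0)%:R.

Let eps_omor (o : option (path_of Gamma)) :
  eps (if o is Some r then << r >> else 0) =
  (oapp (fun r => r == e0) false o)%:R.
Proof. by case: o => [r|]; [exact: epsU | exact: linear0]. Qed.

Fact eps_mul (u v : KG) : eps (u * v) = eps v *: eps u.
Proof.
have HUU (p q : path_of Gamma) :
    eps (catalg_mul (C := path_cat Gamma) << p >> << q >>) =
    (q == e0)%:R * (p == e0)%:R.
  rewrite catalg_mulUU; apply: (etrans (eps_omor (pcomp p q))).
  by rewrite pcomp_e0 -natrM mulnb.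
have HU (p : path_of Gamma) w :
    eps (catalg_mul (C := path_cat Gamma) << p >> w) = (p == e0)%:R *: eps w.
  apply: (malg_linear_eq (f := eps \o catalg_mul (C := path_cat Gamma) << p >>)
    (g := (p == e0)%:R \*: eps)) => q.
  by apply: (etrans (HUU p q)); rewrite /= epsU [RHS]mulrC.
apply: (malg_linear_eq (f := eps \o catalg_rmul (C := path_cat Gamma) v)
  (g := eps v \*: eps)) => p.
by apply: (etrans (HU p v)); rewrite /= epsU [RHS]mulrC.
Qed.

Fact eps_arrows c : eps (\sum_(i < 4) path_vec K (parrow (Q := Gamma) (c, i))) = 0.
Proof.
rewrite linear_sum big1 // => i _; apply: (etrans (epsU _)).
by case: eqP => // /(congr1 (@parrows Gamma)).
Qed.

Fact IT_proper_aux : ~ ideal_gen IT_gen 1.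
Proof.
move=> I1.
have exp0 (u : KG) n : eps u = 0 -> eps (u ^+ n.+1) = 0.
  by move=> u0; rewrite exprS eps_mul u0 scaler0.
have : eps (1 : KG) = 0.
  apply: (I1 (fun z : KG => eps z = 0)) => [|z]; first split=> [|u v u0 v0|a u u0|a u u0].
  - exact: (linear0 eps).
  - by apply: etrans (linearB eps u v) _; rewrite u0 v0 subr0.
  - by rewrite eps_mul u0 scale0r.
  - by rewrite eps_mul u0 scaler0.
  have ex : eps xG = 0 := eps_arrows false.
  have ey : eps yG = 0 := eps_arrows true.
  have mul0 (u v : KG) : eps v = 0 -> eps (u * v) = 0.
    by move=> v0; rewrite eps_mul v0 scale0r.
  case=> ->; [exact: mul0 | rewrite addn2 | exact: mul0].
  apply: etrans (linearD eps _ _) _.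
  exact: etrans (congr2 +%R (exp0 _ _ ex) (exp0 _ _ ey)) (addr0 0).
move=> e1; have e2 := eps_mul 1 (path_vec K e0).
have e3 : eps (path_vec K e0) = 0.
  by rewrite -[path_vec K e0]mul1r e2 e1 scaler0.
have := etrans (esym e3) (epsU e0); rewrite eqxx => /esym/eqP.
by rewrite oner_eq0.
Qed.
End Augmentation.

Fact IT_proper : ~ ideal_gen IT_gen 1.
Proof.
apply: (IT_proper_aux (eps := lin_ext (fun p => (p == e0)%:R : K^o))) => p.
exact: lin_extU.
Qed.

Definition A_T : algType K := quotalg (Relations IT_proper).

End AlgebraAT.

(* A^op (x)_K A is the quotient of the monoid algebra of the multiplicative   *)
(* monoid A^op x A by the bilinearity relations: these span a subspace that   *)
(* is already stable under products with pairs, so the two-sided ideal they   *)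
(* generate is the subspace defining the tensor product of vector spaces.     *)
Section Enveloping.
Variables (K : fieldType) (A : algType K).

Definition opA_mul (p q : A * A) : option (A * A) :=
  Some (q.1 * p.1, p.2 * q.2).

Fact opA_mulA p q r :
  obind (opA_mul p) (opA_mul q r) = obind (fun pq => opA_mul pq r) (opA_mul p q).
Proof. by rewrite /opA_mul /= !mulrA. Qed.
Fact opA_mul1 p : pmap (fun e => opA_mul e p) [:: (1, 1)] = [:: p].
Proof. by case: p => a b; rewrite /= mulr1 mul1r. Qed.
Fact opA_mulr1 p : pmap (opA_mul p) [:: (1, 1)] = [:: p].
Proof. by case: p => a b; rewrite /= mulr1 mul1r. Qed.

Definition opA_cat : fobCat := FobCat opA_mulA opA_mul1 opA_mulr1 isT.

Local Notation KAA := (catalg K opA_cat).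
Definition pure (a b : A) : KAA := << (a, b) : opA_cat >>.

Definition bilinear_rel (z : KAA) : Prop :=
  exists (c : K) (a a' b : A),
    z = pure (c *: a + a') b - (c *: pure a b + pure a' b) \/
    z = pure b (c *: a + a') - (c *: pure b a + pure b a').

Definition pre_act (z : KAA) (m : A) : A :=
  lin_ext (fun p : opA_cat => p.2 * m * p.1) z.

Lemma pre_act_pure a b m : pre_act (pure a b) m = b * m * a.
Proof. exact: lin_extU. Qed.

Lemma pre_act_linearl m : linear (pre_act^~ m).
Proof. by move=> c z w; exact: linearP. Qed.

Lemma pre_actB z w m : pre_act (z - w) m = pre_act z m - pre_act w m.
Proof. exact: raddfB. Qed.

Lemma pre_act0 m : pre_act 0 m = 0.
Proof. exact: raddf0. Qed.

Lemma pre_act_linearr z : linear (pre_act z).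
Proof.
move=> c m n; rewrite /pre_act /lin_ext scaler_sumr -big_split /=.
apply: eq_bigr => p _.
by rewrite mulrDr mulrDl scalerDr -scalerAr -scalerAl !scalerA [_ * c]mulrC.
Qed.

HB.instance Definition _ z :=
  GRing.isLinear.Build K A A _ (pre_act z) (pre_act_linearr z).

Definition pre_actl m : KAA -> A := pre_act^~ m.
HB.instance Definition _ m :=
  GRing.isLinear.Build K {malg K[mor opA_cat]} A _ (pre_actl m)
    (pre_act_linearl m).

Lemma pre_act1 m : pre_act 1 m = m.
Proof.
rewrite -[pre_act _ _]/(lin_ext _ (catalg_one K opA_cat)) /catalg_one /=.
by rewrite big_seq1 lin_extU /= mul1r mulr1.
Qed.

Lemma pre_actM z w m : pre_act (z * w) m = pre_act z (pre_act w m).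
Proof.
have HUU p q : pre_act (catalg_mul (C := opA_cat) << p >> << q >>) m =
    pre_act << p >> (pre_act << q >> m).
  rewrite catalg_mulUU /= /pre_act !lin_extU /= !mulrA.
  by rewrite -!mulrA.
have HU p : pre_act (catalg_mul (C := opA_cat) << p >> w) m =
    pre_act << p >> (pre_act w m).
  exact: (malg_linear_eq
    (f := pre_actl m \o catalg_mul (C := opA_cat) << p >>)
    (g := pre_act << p >> \o pre_actl m) (HUU p) w).
exact: (malg_linear_eq (f := pre_actl m \o catalg_rmul (C := opA_cat) w)
    (g := pre_actl (pre_act w m)) HU z).
Qed.

Lemma pre_act_rel z : ideal_gen bilinear_rel z -> forall m, pre_act z m = 0.
Proof.
move=> Iz; apply: (Iz (fun y => forall m, pre_act y m = 0)).
  split=> [m|u v u0 v0 m|u v v0 m|u v v0 m].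
  - exact: pre_act0.
  - by rewrite pre_actB u0 v0 subr0.
  - by rewrite pre_actM v0 linear0.
  - by rewrite pre_actM v0.
move=> y [c [a [a' [b [->|->]]]]] m; rewrite pre_actB pre_act_linearl !pre_act_pure.
  by rewrite mulrDr -scalerAr subrr.
by rewrite !mulrDl -!scalerAl subrr.
Qed.

Fact bilinear_rel_proper : ~ ideal_gen bilinear_rel 1.
Proof.
move/pre_act_rel/(_ 1); rewrite pre_act1 => /eqP; exact/negP/oner_neq0.
Qed.

Definition env : algType K := quotalg (Relations bilinear_rel_proper).

Definition tens (a b : A) : env := quotpi (Relations bilinear_rel_proper) (pure a b).

End Enveloping.

(* A as a left module over A^e = A^op (x) A: (a (x) b) . m = b m a. Left      *)
(* A^e-modules are the A-bimodules on which K acts centrally.                 *)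
Definition bimod (K : fieldType) (A : algType K) : Type := A.

Section Bimod.
Variables (K : fieldType) (A : algType K).

HB.instance Definition _ := GRing.Zmodule.on (bimod A).

Definition env_act (e : env A) (m : bimod A) : bimod A :=
  pre_act (quotrepr e) m.

Lemma env_act_pi z m :
  env_act (quotpi (Relations (@bilinear_rel_proper K A)) z) m = pre_act z m.
Proof.
apply/esym/eqP; rewrite -subr_eq0; apply/eqP.
rewrite -[LHS]pre_actB; apply: pre_act_rel.
by apply/(quotpi_eq (Relations (@bilinear_rel_proper K A))); rewrite quotreprK.
Qed.

Lemma env_act_tens a b m : env_act (tens a b) m = b * (m : A) * a.
Proof. by rewrite env_act_pi pre_act_pure. Qed.

Fact env_actA (e f : env A) m : env_act e (env_act f m) = env_act (e * f) m.
Proof.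
rewrite -(quotreprK e) -(quotreprK f) -rmorphM !env_act_pi.
exact/esym/pre_actM.
Qed.
Fact env_act1 : left_id 1 env_act.
Proof. by move=> m; rewrite -(rmorph1 (quotpi _)) env_act_pi pre_act1. Qed.
Fact env_actDr : right_distributive env_act +%R.
Proof. by move=> e m n; exact: (linearD (pre_act (quotrepr e))). Qed.
Fact env_actDl m : {morph env_act^~ m : e f / e + f}.
Proof.
move=> e f; rewrite -(quotreprK e) -(quotreprK f) -raddfD !env_act_pi.
exact: (linearD (pre_actl m)).
Qed.

HB.instance Definition _ := GRing.Zmodule_isLmodule.Build (env A) (bimod A)
  env_actA env_act1 env_actDr env_actDl.

End Bimod.

Section Ext.
Variables (K : fieldType) (E : algType K).

Definition projective (P : lmodType E) : Prop :=
  forall (M N : lmodType E) (f : {linear M -> N}) (g : {linear P -> N}),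
    (forall y, exists x, f x = y) ->
    exists h : {linear P -> M}, forall p, f (h p) = g p.

Record proj_resolution (M : lmodType E) := ProjResolution {
  res_obj :> nat -> lmodType E;
  res_diff : forall n, {linear res_obj n.+1 -> res_obj n};
  res_aug : {linear res_obj 0 -> M};
  res_projective : forall n, projective (res_obj n);
  res_aug_surj : forall y, exists x, res_aug x = y;
  res_exact0 : forall x, res_aug x = 0 <-> exists y, res_diff 0 y = x;
  res_exact : forall n x,
    res_diff n x = 0 <-> exists y, res_diff n.+1 y = x
}.

Section Cohomology.
Variables (M : lmodType E) (P : proj_resolution M) (N : lmodType E).

Definition cocycle n (f : P n -> N) : Prop :=
  forall x, f (res_diff P n x) = 0.

Definition coboundary n : (P n -> N) -> Prop :=
  match n with
  | 0 => fun f => forall x, f x = 0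
  | n'.+1 => fun f =>
      exists g : {linear P n' -> N}, forall x, f x = g (res_diff P n' x)
  end.

(* The n-th cohomology of Hom_E(P, N) has dimension d over K: the classes of  *)
(* some cocycles v_0, ..., v_(d-1) form a basis of cocycles modulo            *)
(* coboundaries. K acts on Hom_E(P, N) through the K-algebra structure of E.  *)
Definition cohomology_dim n d : Prop :=
  exists v : 'I_d -> {linear P n -> N},
    (forall i, cocycle (v i)) /\
    forall f : {linear P n -> N}, cocycle f ->
      exists! c : 'rV[K]_d,
        coboundary (fun x => f x - \sum_i (c 0 i)%:A *: v i x).

End Cohomology.

(* dim_K Ext^n_E(M, N) = d, computed from any projective resolution of M; the *)
(* first conjunct only rules out a vacuous second one.                        *)
Definition Ext_dim (M N : lmodType E) n d : Prop :=
  inhabited (proj_resolution M) /\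
  forall P : proj_resolution M, cohomology_dim P N n d.

End Ext.

Definition HH_dim (K : fieldType) (A : algType K) n d : Prop :=
  Ext_dim (bimod A : lmodType (env A)) (bimod A : lmodType (env A)) n d.

(* [pchar K] is empty in characteristic 0, so this is then false for every n. *)
Definition char_dvd (K : nzRingType) (n : nat) : Prop :=
  exists2 p, p \in [pchar K] & (p %| n)%N.

(* Main.v *)
Require Import Defs.
From mathcomp Require Import all_boot all_algebra.
From HB Require Import structures.
From mathcomp Require Import finmap boolp ring zify.
From mathcomp.multinomials Require Import monalg.

(* Put N = 4T + 2. The algebra KGamma/(xy, yx) is quadratic monomial, hence
   Koszul: its minimal bimodule resolution has one generator for each alternating
   word in x and y. To pass to A_T one adds to the Koszul differential a homotopy
   for the relation x^N + y^N: x^(N-1) or y^(N-1) in place of a letter, lengthening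
   the word, and the divided differences sum_a x^a (x) x^(N-1-a) at the trivial
   word. This gives a projective resolution of A_T whose generators in degree n
   are the alternating words of length m <= n, m = n modulo 2. Exactness follows
   by reducing every element modulo boundaries to one whose coefficients are left
   powers below a bound, on which the differential is injective. Applying Hom, a
   cochain is a family of scalars, the coefficients at the paths x^k and y^k from
   each vertex, and the differential is a sparse linear system whose rank depends
   on the residue of n modulo 4 and is affine in n, except that for n = 1 modulo 4
   the divided differences contribute the equation (2T + 1) (eta 0 + eta 1) = 0,
   whence the dependence on the characteristic. *)

Set Implicit Arguments.
Unset Strict Implicit.
Unset Printing Implicit Defensive.
Import GRing.Theory.
Local Open Scope ring_scope.

(** * Projective resolutions and independence of cohomology *)

(** Put $S=K\Gamma/(xy,yx)$ and $W=x^N+y^N$, so that $A_T=S/(W)$ is a hypersurface in a Koszul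
    algebra. The resolution has the shape known from matrix factorizations: in degree $n$ a word of
    length $m$ stands for a Koszul generator of degree $m$ times a divided power of exponent
    $(n-m)/2$. No higher homotopies occur because the chosen homotopy already squares to zero, as
    $x^{N-1}y^{N-1}=0$. The quiver is reduced to a grading modulo 4. Since $N-1=4T+1$ is 1 modulo 4,
    every term of the differential lengthens paths by 1 modulo 4, so all generators of degree $n$
    share one idempotent of the enveloping algebra. The two letters meet only at exponent $0$
    (common idempotents) and at exponent $N$ ($y^N=-x^N$). The second meeting forces the asymmetric
    normal forms in the exactness proof. Each of them also couples the cocycle equations of the two
    letters into closed cycles over the four vertices, which are not independent; counting the
    redundant equations is the real content of the rank computations. *)

Section Image.
Variables (E : nzRingType) (M N : lmodType E) (f : {linear M -> N}).

Definition image_pred : {pred N} := fun y => `[< exists x, f x = y >].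

Lemma image_predP y : reflect (exists x, f x = y) (y \in image_pred).
Proof. exact: asboolP. Qed.

Fact image_submod_closed : submod_closed image_pred.
Proof.
split; first by apply/image_predP; exists 0; rewrite linear0.
move=> a y1 y2 /image_predP[x1 <-] /image_predP[x2 <-].
by apply/image_predP; exists (a *: x1 + x2); rewrite linearP.
Qed.

HB.instance Definition _ :=
  GRing.isSubmodClosed.Build E N image_pred image_submod_closed.

Record image_mod := ImageMod { image_val : N; _ : image_val \in image_pred }.

HB.instance Definition _ := [isSub for image_val].
HB.instance Definition _ := [Choice of image_mod by <:].
HB.instance Definition _ := [SubChoice_isSubLmodule of image_mod by <:].

End Image.

Section Lifting.
Variables (K : fieldType) (E : algType K).

(** Since [projective] speaks of surjective maps only, [f] is corestricted to its image, a submodule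
    that contains the values of [g] by hypothesis. *)
Lemma projective_lift (P M N : lmodType E) (f : {linear M -> N})
    (g : {linear P -> N}) :
  projective P -> (forall p, exists x, f x = g p) ->
  exists h : {linear P -> M}, forall p, f (h p) = g p.
Proof.
move=> projP gf.
have fP x : f x \in image_pred f by apply/image_predP; exists x.
have gP p : g p \in image_pred f by exact/image_predP.
pose f' x : image_mod f := ImageMod (fP x).
pose g' p : image_mod f := ImageMod (gP p).
have f'l : linear f' by move=> a x y; apply: val_inj; rewrite /= linearP.
have g'l : linear g' by move=> a x y; apply: val_inj; rewrite /= linearP.
pose F : {linear M -> image_mod f} :=
  HB.pack f' (GRing.isLinear.Build E M (image_mod f) _ f' f'l).
pose G : {linear P -> image_mod f} :=
  HB.pack g' (GRing.isLinear.Build E P (image_mod f) _ g' g'l).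
have [|h hP] := projP _ _ F G.
  by case=> y yP; have /image_predP[x fx] := yP; exists x; apply: val_inj.
by exists h => p; have /(congr1 val) := hP p.
Qed.

Variables (M : lmodType E).
Implicit Types P Q : proj_resolution M.

Lemma res_diff_comp0 P n x : res_diff P n (res_diff P n.+1 x) = 0.
Proof. by apply/res_exact; exists x. Qed.

Lemma res_aug_diff0 P x : res_aug P (res_diff P 0 x) = 0.
Proof. by apply/res_exact0; exists x. Qed.

Record chain_map P Q := ChainMap {
  chain_fun :> forall n, {linear P n -> Q n};
  chain_aug : forall x, res_aug Q (chain_fun 0 x) = res_aug P x;
  chain_diff : forall n x,
    res_diff Q n (chain_fun n.+1 x) = chain_fun n (res_diff P n x)
}.

Lemma chain_map_exists P Q : inhabited (chain_map P Q).
Proof.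
have [f0 f0P] := projective_lift (f := res_aug Q) (g := res_aug P)
  (@res_projective _ _ _ P 0) (fun p => res_aug_surj Q (res_aug P p)).
have [f1 f1P] : exists f1 : {linear P 1 -> Q 1},
    forall x, res_diff Q 0 (f1 x) = f0 (res_diff P 0 x).
  apply: (projective_lift (f := res_diff Q 0) (g := f0 \o res_diff P 0)
    (@res_projective _ _ _ P 1)) => p /=.
  by apply/res_exact0; rewrite f0P res_aug_diff0.
(* The recursion carries two consecutive components together with their commuting square, because
   lifting to the next degree needs that square. *)
pose T n := {f : {linear P n -> Q n} * {linear P n.+1 -> Q n.+1} |
  forall x, res_diff Q n (f.2 x) = f.1 (res_diff P n x)}.
have stepP n (t : T n) : exists g : {linear P n.+2 -> Q n.+2},
    forall x, res_diff Q n.+1 (g x) = (sval t).2 (res_diff P n.+1 x).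
  apply: (projective_lift (f := res_diff Q n.+1)
    (g := (sval t).2 \o res_diff P n.+1) (@res_projective _ _ _ P n.+2)) => p /=.
  by apply/res_exact; rewrite (svalP t) res_diff_comp0 linear0.
pose step n (t : T n) : T n.+1 :=
  exist (fun f : {linear P n.+1 -> Q n.+1} * {linear P n.+2 -> Q n.+2} =>
      forall x, res_diff Q n.+1 (f.2 x) = f.1 (res_diff P n.+1 x))
    ((sval t).2, sval (cid (stepP n t))) (svalP (cid (stepP n t))).
pose F := fix F n : T n :=
  if n is n'.+1 then step n' (F n') else exist _ (f0, f1) f1P.
have FP n x : res_diff Q n ((sval (F n.+1)).1 x) = (sval (F n)).1 (res_diff P n x).
  exact: (svalP (F n)).
by constructor; exact: (@ChainMap P Q (fun n => (sval (F n)).1) f0P FP).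
Qed.

(** The homotopies are asserted one degree at a time, without recording that [s'] is the [s] of the
    previous degree: comparing classes in a fixed degree needs nothing more, and the induction then
    makes no dependent choices. *)
Lemma chain_map_homotopic P Q (f g : chain_map P Q) :
  (exists s : {linear P 0 -> Q 1}, forall x, f 0 x - g 0 x = res_diff Q 0 (s x)) /\
  forall n, exists (s : {linear P n.+1 -> Q n.+2}) (s' : {linear P n -> Q n.+1}),
    forall x, f n.+1 x - g n.+1 x = res_diff Q n.+1 (s x) + s' (res_diff P n x).
Proof.
have [s0 s0P] : exists s : {linear P 0 -> Q 1},
    forall x, res_diff Q 0 (s x) = f 0 x - g 0 x.
  apply: (projective_lift (g := f 0 \- g 0) (@res_projective _ _ _ P 0)) => p /=.
  by apply/res_exact0; rewrite linearB !chain_aug subrr.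
split; first by exists s0.
have next n (s : {linear P n -> Q n.+1}) :
    (forall x, res_diff Q n (s (res_diff P n x)) =
       f n (res_diff P n x) - g n (res_diff P n x)) ->
    exists s1 : {linear P n.+1 -> Q n.+2}, forall x,
      res_diff Q n.+1 (s1 x) = f n.+1 x - g n.+1 x - s (res_diff P n x).
  move=> sP; apply: (projective_lift
    (g := (f n.+1 \- g n.+1) \- (s \o res_diff P n)) (@res_projective _ _ _ P n.+1)).
  move=> p /=; apply/res_exact.
  by rewrite !linearB /= !chain_diff sP subrr.
elim=> [|n [s [s' sP]]].
  have [|s1 s1P] := next 0 s0; first by move=> x; rewrite s0P.
  by exists s1, s0 => x; rewrite s1P subrK.
have [|s1 s1P] := next n.+1 s.
  (* On boundaries the term in [s'] drops out, since two consecutive differentials compose to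
     zero. *)
  by move=> x; have := sP (res_diff P n.+1 x);
     rewrite res_diff_comp0 linear0 addr0 => <-.
by exists s1, s => x; rewrite s1P subrK.
Qed.

Definition chain_id P : chain_map P P :=
  @ChainMap P P (fun n => idfun) (fun => erefl) (fun _ _ => erefl).

Fact chain_comp_aug P Q P' (g : chain_map Q P') (f : chain_map P Q) x :
  res_aug P' ((g 0 \o f 0) x) = res_aug P x.
Proof. by rewrite /= !chain_aug. Qed.

Fact chain_comp_diff P Q P' (g : chain_map Q P') (f : chain_map P Q) n x :
  res_diff P' n ((g n.+1 \o f n.+1) x) = (g n \o f n) (res_diff P n x).
Proof. by rewrite /= !chain_diff. Qed.

Definition chain_comp P Q P' (g : chain_map Q P') (f : chain_map P Q) :
    chain_map P P' :=
  @ChainMap P P' (fun n => g n \o f n) (chain_comp_aug g f) (chain_comp_diff g f).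

Variable N : lmodType E.

Lemma coboundary_ext P n (f g : P n -> N) :
  f =1 g -> coboundary f -> coboundary g.
Proof.
by case: n f g => [|n] f g fg /=; [move=> f0 x; rewrite -fg |
  case=> h hP; exists h => x; rewrite -fg].
Qed.

Lemma coboundaryD P n (f g : P n -> N) :
  coboundary f -> coboundary g -> coboundary (fun x => f x + g x).
Proof.
case: n f g => [|n] f g /=; first by move=> f0 g0 x; rewrite f0 g0 addr0.
by move=> [h hP] [k kP]; exists (h \+ k) => x; rewrite hP kP.
Qed.

Lemma coboundary_comp P Q (u : chain_map P Q) n (f : Q n -> N) :
  coboundary f -> coboundary (fun x => f (u n x)).
Proof.
case: n f => [|n] f /=; first by move=> f0 x; rewrite f0.
by case=> g gP; exists (g \o u n) => x; rewrite gP chain_diff.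
Qed.

Lemma coboundary_homotopic P Q (u w : chain_map P Q) n (f : {linear Q n -> N}) :
  cocycle f -> coboundary (fun x => f (u n x) - f (w n x)).
Proof.
have [[s0 s0P] H] := chain_map_homotopic u w.
case: n f => [|n] f fZ /=.
  by move=> x; rewrite -linearB s0P fZ.
have [s [s' sP]] := H n; exists (f \o s') => x.
by rewrite -linearB sP linearD fZ add0r.
Qed.

(** Representatives on [Q] are pulled back along [u]. Existence of coordinates for [f] comes from
    those of [f \o w n], as [w] after [u] is homotopic to the identity of [P]; uniqueness pulls back
    along [w] and uses the homotopy on [Q]. *)
Lemma cohomology_dim_indep P Q n d :
  cohomology_dim Q N n d -> cohomology_dim P N n d.
Proof.
have [u] := chain_map_exists P Q; have [w] := chain_map_exists Q P.
case=> v [vZ vB].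
have comb_homotopic (c : 'rV[K]_d) :
    coboundary (fun x => (\sum_i (c 0 i)%:A *: v i (u n (w n x))) -
                         \sum_i (c 0 i)%:A *: v i x : N).
  (* The scalars [(c 0 i)%:A] are central in [E], which is what keeps the combination [E]-linear. *)
  have comb_lin : linear (fun x => \sum_i (c 0 i)%:A *: v i x).
    move=> a x y; rewrite scaler_sumr -big_split /=; apply: eq_bigr => i _.
    rewrite linearP scalerDr !scalerA; congr (_ *: _ + _).
    by rewrite -scalerAr -scalerAl mulr1 mul1r.
  pose h : {linear Q n -> N} := HB.pack (fun x => \sum_i (c 0 i)%:A *: v i x)
    (GRing.isLinear.Build E (Q n) N _ _ comb_lin).
  apply: (coboundary_homotopic (chain_comp u w) (chain_id Q) (f := h)) => x.
  by rewrite /= big1 // => i _; rewrite vZ scaler0.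
exists (fun i => v i \o u n); split.
  by move=> i x /=; rewrite -chain_diff vZ.
move=> f fZ; have fwZ : cocycle (f \o w n).
  by move=> x /=; rewrite -chain_diff fZ.
have fwu : coboundary (fun x => f x - f (w n (u n x))).
  exact: (coboundary_homotopic (chain_id P) (chain_comp w u)).
have [c [cB cU]] := vB (f \o w n) fwZ; exists c; split.
  apply: coboundary_ext (coboundaryD fwu (coboundary_comp u cB)) => x /=.
  by rewrite addrA subrK.
move=> c' c'B; apply: cU.
apply: coboundary_ext (coboundaryD (coboundary_comp w c'B) (comb_homotopic c')).
by move=> x /=; rewrite addrA subrK.
Qed.

End Lifting.

(** * Projective modules cut out of free modules by an idempotent *)

Section IdempotentFree.
Variables (E : nzRingType) (u : E) (k : nat).

(** For idempotent [u] this is the left module $(Eu)^k$: an element lies in $Eu$ exactly when right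
    multiplication by [u] fixes it. *)
Definition idem_pred : {pred 'rV[E]_k} := fun v => [forall j, v 0 j * u == v 0 j].

Fact idem_submod_closed : submod_closed idem_pred.
Proof.
split; first by apply/forallP => j; rewrite mxE mul0r.
move=> a v w /forallP vP /forallP wP; apply/forallP => j.
by rewrite !mxE mulrDl -mulrA (eqP (vP j)) (eqP (wP j)).
Qed.

HB.instance Definition _ :=
  GRing.isSubmodClosed.Build E 'rV[E]_k idem_pred idem_submod_closed.

Record idem_free := IdemFree { idem_row :> 'rV[E]_k; _ : idem_row \in idem_pred }.

HB.instance Definition _ := [isSub for idem_row].
HB.instance Definition _ := [Choice of idem_free by <:].
HB.instance Definition _ := [SubChoice_isSubLmodule of idem_free by <:].

Lemma idem_rowP (v : idem_free) j : (v : 'rV_k) 0 j * u = (v : 'rV_k) 0 j.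
Proof. by case: v => v /= /forallP/(_ j)/eqP. Qed.

(** The values [f r] are arbitrary. As the coordinates absorb [u] on the right, the map depends only
    on the elements [u *: f r], which are its values on the generators; this is the isomorphism of
    $\mathrm{Hom}(Eu,M)$ with $uM$. *)
Definition idem_hom (M : lmodType E) (f : 'I_k -> M) (v : idem_free) : M :=
  \sum_r (v : 'rV_k) 0 r *: f r.

Fact idem_hom_linear (M : lmodType E) (f : 'I_k -> M) : linear (idem_hom f).
Proof.
move=> a v w; rewrite /idem_hom scaler_sumr -big_split /=.
by apply: eq_bigr => r _; rewrite !mxE scalerDl scalerA.
Qed.

HB.instance Definition _ (M : lmodType E) (f : 'I_k -> M) :=
  GRing.isLinear.Build E idem_free M _ (idem_hom f) (idem_hom_linear f).

Hypothesis uu : u * u = u.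

Fact idem_basis_subproof r : (u *: delta_mx 0 r : 'rV_k) \in idem_pred.
Proof.
by apply/forallP => j; rewrite !mxE -mulrA; case: (j == r);
  rewrite ?andbF /= ?mul1r ?mul0r ?mulr1 ?mulr0 ?uu.
Qed.

Definition idem_basis r : idem_free := IdemFree (idem_basis_subproof r).

Lemma idem_basisE r j : (idem_basis r : 'rV_k) 0 j = if j == r then u else 0.
Proof. by rewrite !mxE /=; case: eqP; rewrite ?mulr1 ?mulr0. Qed.

Lemma idem_basis_idem r : u *: idem_basis r = idem_basis r.
Proof.
apply/val_inj/rowP => j; rewrite mxE !idem_basisE.
by case: eqP; rewrite ?uu ?mulr0.
Qed.

Lemma idem_expand (v : idem_free) : v = \sum_r (v : 'rV_k) 0 r *: idem_basis r.
Proof.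
have sumE (F : 'I_k -> idem_free) j :
    (\sum_r F r : idem_free) 0 j = \sum_r (F r : 'rV_k) 0 j.
  by elim/big_rec2: _ => [|i x y _ <-]; rewrite !mxE.
apply/val_inj/rowP => j; rewrite sumE (bigD1 j) //= big1 ?addr0 => [|i ij].
  by rewrite mxE idem_basisE eqxx idem_rowP.
by rewrite mxE idem_basisE eq_sym (negPf ij) mulr0.
Qed.

Lemma idem_lin_expand (M : lmodType E) (f : {linear idem_free -> M}) v :
  f v = \sum_r (v : 'rV_k) 0 r *: f (idem_basis r).
Proof.
by rewrite [in LHS](idem_expand v) linear_sum; apply: eq_bigr => r _; rewrite linearZ.
Qed.

Lemma idem_hom_basis (M : lmodType E) (f : 'I_k -> M) r :
  idem_hom f (idem_basis r) = u *: f r.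
Proof.
rewrite /idem_hom (bigD1 r) //= big1 ?addr0 => [|i ir].
  by rewrite idem_basisE eqxx.
by rewrite idem_basisE (negPf ir) scale0r.
Qed.

End IdempotentFree.

(** Any preimages of the values of [g] on the generators serve: coordinates satisfy
    [v 0 r * u = v 0 r], so the preimages need not be corrected by [u]. *)
Lemma idem_free_projective (K : fieldType) (E : algType K) (u : E) k :
  u * u = u -> projective (idem_free u k : lmodType E).
Proof.
move=> uu M N f g fS.
exists (idem_hom (fun r => sval (cid (fS (g (idem_basis uu r)))))) => p.
rewrite linear_sum [RHS](idem_lin_expand uu); apply: eq_bigr => r _.
by rewrite linearZ; congr (_ *: _); exact: (svalP (cid (fS _))).
Qed.

Definition last_letter (c : bool) (m : nat) : bool := if odd m then c else ~~ c.

(** * A twisted Koszul differential *)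

(* [phi c m] is the value of a cochain on the generator indexed by the
   alternating word of length m starting with the letter c; the word of length 0
   does not depend on c. In [delta], the terms in L c and R c come from the
   bimodule resolution of the monomial algebra K<x, y>/(xy, yx), those in the
   q-th powers from the homotopy for multiplication by x^(q+1) + y^(q+1). *)
Section Delta.
Variables (E : nzRingType) (L R : bool -> E) (q : nat).

Definition delta (M : lmodType E) (phi : bool -> nat -> M) (c : bool) (m : nat) : M :=
  if m is m'.+1 then
    L c *: phi (~~ c) m' + (-1) ^+ m *: (R (last_letter c m) *: phi c m') +
    (L (~~ c) ^+ q *: phi (~~ c) m.+1 +
     (-1) ^+ m *: (R (last_letter c m.+1) ^+ q *: phi c m.+1))
  else \sum_(b : bool) \sum_(a < q.+1) (L b ^+ a * R b ^+ (q - a)) *: phi b 1%N.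

Lemma delta_linear (M M' : lmodType E) (g : {linear M -> M'}) phi c m :
  g (delta phi c m) = delta (fun c m => g (phi c m)) c m.
Proof.
case: m => [|m] /=; last by rewrite !(linearD, linearZ).
rewrite linear_sum; apply: eq_bigr => b _; rewrite linear_sum.
by apply: eq_bigr => a _; rewrite linearZ.
Qed.

Lemma eq_delta (M : lmodType E) (phi psi : bool -> nat -> M) c m :
  (forall c m, phi c m = psi c m) -> delta phi c m = delta psi c m.
Proof.
move=> e; case: m => [|m] /=; first by do 2!apply: eq_bigr => ? _; rewrite e.
by rewrite !e.
Qed.

Hypothesis LR : forall c c', L c * R c' = R c' * L c.
Hypothesis LL : forall c, L c * L (~~ c) = 0.
Hypothesis RR : forall c, R c * R (~~ c) = 0.
Hypothesis LN : forall c, L (~~ c) ^+ q.+1 = - L c ^+ q.+1.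
Hypothesis RN : forall c, R (~~ c) ^+ q.+1 = - R c ^+ q.+1.
Hypothesis q_gt0 : (0 < q)%N.

Let LRX c c' i j : GRing.comm (L c ^+ i) (R c' ^+ j).
Proof. by apply: commrX; apply: commr_sym; apply: commrX; apply: commr_sym; exact: LR. Qed.

Let LL0 c i j : (0 < i)%N -> (0 < j)%N -> L c ^+ i * L (~~ c) ^+ j = 0.
Proof.
by case: i j => [|i] [|j] // _ _; rewrite exprSr exprS -mulrA [L c * _]mulrA LL mul0r mulr0.
Qed.
Let RR0 c i j : (0 < i)%N -> (0 < j)%N -> R c ^+ i * R (~~ c) ^+ j = 0.
Proof.
by case: i j => [|i] [|j] // _ _; rewrite exprSr exprS -mulrA [R c * _]mulrA RR mul0r mulr0.
Qed.

Variable M : lmodType E.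
Implicit Types phi : bool -> nat -> M.

Let dpart phi c m : M := if m is m'.+1 then
  L c *: phi (~~ c) m' + (-1) ^+ m *: (R (last_letter c m) *: phi c m') else 0.
Let hpart phi c m : M := if m is m'.+1 then
  L (~~ c) ^+ q *: phi (~~ c) m.+1 +
     (-1) ^+ m *: (R (last_letter c m.+1) ^+ q *: phi c m.+1)
  else \sum_(b : bool) \sum_(a < q.+1) (L b ^+ a * R b ^+ (q - a)) *: phi b 1%N.

Let deltaE phi c m : delta phi c m = dpart phi c m + hpart phi c m.
Proof. by case: m => [|m] //; rewrite add0r. Qed.

Let lastN b k : last_letter b k.+1 = ~~ last_letter b k.
Proof. by rewrite /last_letter /=; case: (odd k); rewrite ?negbK. Qed.

Let last_negb b k : last_letter (~~ b) k = ~~ last_letter b k.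
Proof. by rewrite /last_letter; case: (odd k). Qed.

Let sgnC (X : E) k (v : M) : X *: ((-1) ^+ k *: v) = (-1) ^+ k *: (X *: v).
Proof. by rewrite !scalerA (commr_sign X k). Qed.

Let LNv b (v : M) : L (~~ b) ^+ q *: (L (~~ b) *: v) = - (L b *: (L b ^+ q *: v)).
Proof. by rewrite !scalerA -exprSr -exprS LN scaleNr. Qed.

Let RNv b (v : M) : R (~~ b) ^+ q *: (R (~~ b) *: v) = - (R b *: (R b ^+ q *: v)).
Proof. by rewrite !scalerA -exprSr -exprS RN scaleNr. Qed.

Let LRv c c' (v : M) : L c *: (R c' *: v) = R c' *: (L c *: v).
Proof. by rewrite !scalerA LR. Qed.

Let LRXv c c' i j (v : M) : L c ^+ i *: (R c' ^+ j *: v) = R c' ^+ j *: (L c ^+ i *: v).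
Proof. by rewrite !scalerA LRX. Qed.

Let LLv c i j (v : M) : L c ^+ i.+1 *: (L (~~ c) ^+ j.+1 *: v) = 0.
Proof. by rewrite scalerA LL0 ?scale0r. Qed.

Let RRv c i j (v : M) : R c ^+ i.+1 *: (R (~~ c) ^+ j.+1 *: v) = 0.
Proof. by rewrite scalerA RR0 ?scale0r. Qed.

Let sgnS k (v : M) : (-1) ^+ k.+1 *: v = - ((-1) ^+ k *: v).
Proof. by rewrite exprS mulN1r scaleNr. Qed.

Let sgnK k (v : M) : (-1) ^+ k *: ((-1) ^+ k *: v) = v.
Proof. by rewrite scalerA -expr2 sqrr_sign scale1r. Qed.

(** Two letters removed at the same end are distinct and multiply to zero; removing one letter at
    each end gives the same product in both orders, with opposite signs. *)
Let dd phi c m : dpart (dpart phi) c m = 0.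
Proof.
case: m => [|[|m]] //=; first by rewrite !scaler0 addr0.
rewrite !(lastN, last_negb, negbK) !scalerDr !(sgnC, sgnS, scalerN, sgnK).
have L0 := LLv c 0 0; have R0 := RRv (last_letter c m) 0 0; rewrite !expr1 in L0 R0.
rewrite L0 R0.
by rewrite !opprK subr0 add0r LRv addNr.
Qed.

Let hh phi c m : hpart (hpart phi) c m = 0.
Proof.
have LLq b (v : M) : L b ^+ q *: (L (~~ b) ^+ q *: v) = 0.
  by rewrite scalerA LL0 ?scale0r.
have RRq b (v : M) : R b ^+ q *: (R (~~ b) ^+ q *: v) = 0.
  by rewrite scalerA RR0 ?scale0r.
case: m => [|m] /=; last first.
  rewrite !(lastN, last_negb, negbK) !scalerDr !(sgnC, sgnS, scalerN, sgnK).
  have L0 (v : M) : L (~~ c) ^+ q *: (L c ^+ q *: v) = 0.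
    by have := LLq (~~ c) v; rewrite negbK.
  by rewrite L0 RRq !opprK subr0 add0r LRXv addrN.
(* Only one end of the divided difference survives in each summand: [a = 0] against the left power
   of the other letter, [a = q] against the right power. The two remaining terms change sign when
   [b] is exchanged with [~~ b]. *)
have bP b : \sum_(a < q.+1) (L b ^+ a * R b ^+ (q - a)) *:
    (L (~~ b) ^+ q *: phi (~~ b) 2 + (-1) ^+ 1 *: (R (last_letter b 2) ^+ q *: phi b 2))
    = R b ^+ q *: (L (~~ b) ^+ q *: phi (~~ b) 2) -
      R (~~ b) ^+ q *: (L b ^+ q *: phi b 2).
  under eq_bigr do rewrite scalerDr.
  rewrite big_split /= expr1; congr (_ + _).
    rewrite big_ord_recl /= big1 ?addr0 => [|a _].
      by rewrite expr0 mul1r subn0.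
    by rewrite LRX -scalerA [L b ^+ _ *: _]scalerA LL0 ?scale0r ?scaler0.
  rewrite big_ord_recr /= big1 ?add0r => [|a _].
    by rewrite subnn expr0 mulr1 scaleN1r scalerN LRXv.
  by rewrite scaleN1r scalerN -scalerA [R b ^+ _ *: _]scalerA RR0 ?subn_gt0 // scale0r scaler0 oppr0.
by rewrite big_bool /= !bP /= addrA subrK addrN.
Qed.

Let tele b (v : M) : \sum_(a < q.+1) (L b ^+ a * R b ^+ (q - a)) *: (L b *: v - R b *: v) =
  L b ^+ q.+1 *: v - R b ^+ q.+1 *: v.
Proof.
pose f a := (L b ^+ a * R b ^+ (q.+1 - a)) *: v.
have -> : L b ^+ q.+1 *: v - R b ^+ q.+1 *: v = f q.+1 - f 0.
  by rewrite /f subnn subn0 !expr0 mulr1 mul1r.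
rewrite -(telescope_sumr (n := 0)) // big_mkord; apply: eq_bigr => a _.
have aq : (a <= q)%N by rewrite -ltnS.
rewrite scalerBr !scalerA /f subSS subSn //; congr (_ *: _ - _ *: _).
  by rewrite exprSr -!mulrA; congr (_ * _); exact/esym/commrX/LR.
by rewrite exprSr mulrA.
Qed.

Let sumC b (v : M) (X : E) : GRing.comm X (L b) -> GRing.comm X (R b) ->
  \sum_(a < q.+1) (L b ^+ a * R b ^+ (q - a)) *: (X *: v) =
  X *: \sum_(a < q.+1) (L b ^+ a * R b ^+ (q - a)) *: v.
Proof.
move=> XL XR; rewrite scaler_sumr; apply: eq_bigr => a _; rewrite !scalerA.
by congr (_ *: _); apply/esym/commrM; exact: commrX.
Qed.

Let sumL b (v : M) : L (~~ b) *: (\sum_(a < q.+1) (L b ^+ a * R b ^+ (q - a)) *: v) =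
  L (~~ b) *: (R b ^+ q *: v).
Proof.
rewrite big_ord_recl /= expr0 mul1r subn0 scalerDr scaler_sumr big1 ?addr0 // => a _.
have := LL0 (~~ b) (i := 1) (j := a.+1); rewrite negbK expr1 => L0.
by rewrite scalerA mulrA L0 ?mul0r ?scale0r.
Qed.

Let sumR b (v : M) : R (~~ b) *: (\sum_(a < q.+1) (L b ^+ a * R b ^+ (q - a)) *: v) =
  R (~~ b) *: (L b ^+ q *: v).
Proof.
rewrite big_ord_recr /= subnn expr0 mulr1 scalerDr scaler_sumr big1 ?add0r // => a _.
have := RR0 (~~ b) (i := 1) (j := q - a); rewrite negbK expr1 => R0.
by rewrite LRX scalerA mulrA R0 ?mul0r ?scale0r // subn_gt0.
Qed.

(** The mixed terms regroup into the actions of $x^{q+1}+y^{q+1}$ from the left and from the right,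
    which vanish by [LN] and [RN]. At the empty word the regrouping is the telescoping [tele]; at
    words of length 1 it is [tele] for one letter, while the divided difference of the other letter
    is reduced to an end term by [sumL] and [sumR]. *)
Let dh phi c m : phi true 0 = phi false 0 ->
  dpart (hpart phi) c m + hpart (dpart phi) c m = 0.
Proof.
move=> phi0; case: m => [|[|m]] /=.
- rewrite add0r.
  have bP b : \sum_(a < q.+1) (L b ^+ a * R b ^+ (q - a)) *:
    (L b *: phi (~~ b) 0 + (-1) ^+ 1 *: (R (last_letter b 1) *: phi b 0)) =
    L b ^+ q.+1 *: phi false 0 - R b ^+ q.+1 *: phi false 0.
    rewrite expr1 /last_letter /= -tele; apply: eq_bigr => a _.
    by rewrite scaleN1r; case: b; rewrite /= ?phi0.
  by rewrite big_bool !bP /= (LN false) (RN false) !scaleNr opprK addrACA addNr addrN addr0.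
- have sumb (F : bool -> M) : \sum_b F b = F c + F (~~ c).
    by rewrite big_bool; case: c => //=; rewrite addrC.
  rewrite !sumb /last_letter /= !expr1 !scaleN1r !scalerDr negbK.
  have := sumL (~~ c) (phi (~~ c) 1%N); have := sumR (~~ c) (phi (~~ c) 1%N).
  rewrite !negbK => -> ->.
  have tl := tele c (phi c 1%N).
  rewrite (eq_bigr _ (fun a _ => scalerBr _ _ _)) in tl.
  move: tl; rewrite sumrB (sumC _ (X := L c)) ?(sumC _ (X := R c)) //;
    try exact: LR; try exact/esym/LR; move=> tl.
  have L1 := LRXv c (~~ c) 1 q; have R1 := LRXv (~~ c) c q 1.
  rewrite expr1 in L1; rewrite expr1 in R1.
  rewrite sqrrN expr1n !scale1r LNv RNv L1 R1 !opprD !opprK [X in X + _ = _]addrACA tl.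
  rewrite !exprS -!scalerA [X in _ + (_ + X) = _]addrC [X in _ + X = _]addrACA [LHS]addrACA.
  rewrite [X in X + _ = _]addrACA subrr addNr addr0 add0r.
  by rewrite addrA subrK subrr.
rewrite !(lastN, last_negb, negbK) !scalerDr !(sgnC, sgnS, scalerN, sgnK).
have L1 := LRXv c (~~ last_letter c m) 1 q; have R1 := LRXv (~~ c) (last_letter c m) q 1.
rewrite expr1 in L1; rewrite expr1 in R1.
rewrite LNv RNv L1 R1 !opprK.
rewrite addrACA [X in X + _ = _]addrACA subrr add0r [X in _ + X = _]addrACA addNr addr0.
by rewrite addrA subrK addNr.
Qed.

Let dpartD (f g : bool -> nat -> M) c m :
  dpart (fun c m => f c m + g c m) c m = dpart f c m + dpart g c m.
Proof. by case: m => [|m] /=; rewrite ?addr0 // !scalerDr addrACA. Qed.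

Let hpartD (f g : bool -> nat -> M) c m :
  hpart (fun c m => f c m + g c m) c m = hpart f c m + hpart g c m.
Proof.
case: m => [|m] /=; last by rewrite !scalerDr addrACA.
rewrite -big_split; apply: eq_bigr => b _; rewrite -big_split.
by apply: eq_bigr => a _; rewrite scalerDr.
Qed.

Lemma delta_delta phi c m : phi true 0 = phi false 0 -> delta (delta phi) c m = 0.
Proof.
move=> phi0; rewrite (eq_delta _ _ (psi := fun c m => dpart phi c m + hpart phi c m) (deltaE phi)).
by rewrite deltaE dpartD hpartD dd hh add0r addr0 dh.
Qed.
End Delta.

(** * Alternating words as indices of the generators *)

Section Families.
Variable (M : zmodType).

(* The generators of degree n are the alternating words of length m <= n with
   m = n modulo 2, placed on a line with x-words to the left and y-words to the
   right. *)
Definition gen_index n (c : bool) m := if c then (n + m)./2 else (n - m)./2.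
Definition gen_letter n r := (n < r.*2)%N.
Definition gen_length n r := if (n < r.*2)%N then (r.*2 - n)%N else (n - r.*2)%N.

(** Extending by zero to the words that are not generators of degree [n] allows [delta] to be used
    without case distinctions at the longest words. *)
Definition index_family n (f : 'I_n.+1 -> M) (c : bool) (m : nat) : M :=
  if (m <= n)%N && ~~ odd (n + m) then f (inord (gen_index n c m)) else 0.

Lemma index_family0 n (f : 'I_n.+1 -> M) : index_family f true 0 = index_family f false 0.
Proof. by rewrite /index_family /gen_index addn0 subn0. Qed.

Lemma gen_lengthP n r : (r <= n)%N -> (gen_length n r <= n)%N && ~~ odd (n + gen_length n r).
Proof. by rewrite /gen_length; case: ltnP; lia. Qed.

Lemma gen_indexK n r : (r <= n)%N -> gen_index n (gen_letter n r) (gen_length n r) = r.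
Proof. by rewrite /gen_length /gen_index /gen_letter; case: ltnP; lia. Qed.

Lemma gen_index_bound n c m : (m <= n)%N -> (gen_index n c m <= n)%N.
Proof. rewrite /gen_index; case: c; lia. Qed.

Lemma gen_letterK n c m : (0 < m <= n)%N && ~~ odd (n + m) ->
  gen_letter n (gen_index n c m) = c.
Proof. rewrite /gen_letter /gen_index; case: c; lia. Qed.

Lemma gen_lengthK n c m : (m <= n)%N && ~~ odd (n + m) ->
  gen_length n (gen_index n c m) = m.
Proof. by rewrite /gen_length /gen_index; case: c; case: ltnP; lia. Qed.

Lemma index_family_gen n (f : 'I_n.+1 -> M) (r : 'I_n.+1) :
  index_family f (gen_letter n r) (gen_length n r) = f r.
Proof.
have rn : (r <= n)%N by rewrite -ltnS.
by rewrite /index_family gen_lengthP // gen_indexK // inord_val.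
Qed.

End Families.

Lemma index_family_out (M : zmodType) n (f : 'I_n.+1 -> M) c m :
  ~~ ((m <= n)%N && ~~ odd (n + m)) -> index_family f c m = 0.
Proof. by rewrite /index_family => /negPf->. Qed.

Section FamilyDelta.
Variables (E : nzRingType) (L R : bool -> E) (q : nat).

Lemma index_family_morph (M M' : zmodType) (g : {additive M -> M'}) n (f : 'I_n.+1 -> M) c m :
  g (index_family f c m) = index_family (fun r => g (f r)) c m.
Proof. by rewrite /index_family; case: ifP => // _; rewrite raddf0. Qed.

(** If a word is not a generator of degree [n.+1], by length or by parity, then the words one letter
    shorter or longer are not generators of degree [n]. Hence [delta] of an extension by zero is
    again one. *)
Lemma index_family_delta (M : lmodType E) n (f : 'I_n.+1 -> M) c m :
  index_family (fun r : 'I_n.+2 =>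
    delta L R q (index_family f) (gen_letter n.+1 r) (gen_length n.+1 r)) c m =
  delta L R q (index_family f) c m.
Proof.
case V : ((m <= n.+1)%N && ~~ odd (n.+1 + m)).
  rewrite {1}/index_family V inordK ?ltnS ?gen_index_bound ?gen_lengthK //; last by case/andP: V.
  case: m V => [|m] V; last by rewrite gen_letterK.
  by rewrite /=; under eq_bigr do under eq_bigr do [].
rewrite index_family_out ?V //; case: m V => [|m] V /=.
  rewrite big1 // => b _; rewrite big1 // => a _; rewrite index_family_out ?scaler0 //.
  by apply/negP; move: V; lia.
by rewrite !index_family_out ?scaler0 ?addr0 //; apply/negP; move: V; lia.
Qed.

End FamilyDelta.

(** * Exactness *)

Section Resolution.
Variables (K : fieldType) (E : algType K) (L R : bool -> E) (q : nat) (eps : nat -> E).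
Hypothesis LR : forall c c', L c * R c' = R c' * L c.
Hypothesis LL : forall c, L c * L (~~ c) = 0.
Hypothesis RR : forall c, R c * R (~~ c) = 0.
Hypothesis LN : forall c, L (~~ c) ^+ q.+1 = - L c ^+ q.+1.
Hypothesis RN : forall c, R (~~ c) ^+ q.+1 = - R c ^+ q.+1.
Hypothesis q_gt0 : (0 < q)%N.
Hypothesis eps_idem : forall n, eps n * eps n = eps n.
Hypothesis epsL : forall n c, eps n.+1 * L c = L c * eps n.
Hypothesis epsR : forall n c, eps n.+1 * R c = R c * eps n.
Hypothesis eps_per : forall n, eps (n + q) = eps n.+1.

Let LRX c c' i j : GRing.comm (L c ^+ i) (R c' ^+ j).
Proof. by apply: commrX; apply: commr_sym; apply: commrX; apply: commr_sym; exact: LR. Qed.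

Let LL0 c i j : (0 < i)%N -> (0 < j)%N -> L c ^+ i * L (~~ c) ^+ j = 0.
Proof.
by case: i j => [|i] [|j] // _ _; rewrite exprSr exprS -mulrA [L c * _]mulrA LL mul0r mulr0.
Qed.

Let epsLX n c k : eps (n + k) * L c ^+ k = L c ^+ k * eps n.
Proof.
elim: k => [|k IHk]; first by rewrite addn0 mulr1 mul1r.
by rewrite addnS exprS mulrA epsL -mulrA IHk mulrA.
Qed.

Let epsRX n c k : eps (n + k) * R c ^+ k = R c ^+ k * eps n.
Proof.
elim: k => [|k IHk]; first by rewrite addn0 mulr1 mul1r.
by rewrite addnS exprS mulrA epsR -mulrA IHk mulrA.
Qed.

(** [L] and [R] both move [eps n] to [eps n.+1]. A term of total degree [q] moves it to
    [eps (n + q)], which is the same idempotent by [eps_per]; so all terms of [delta] are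
    homogeneous of degree 1. *)
Lemma eps_delta (M : lmodType E) n (phi : bool -> nat -> M) c m :
  (forall c m, eps n *: phi c m = phi c m) ->
  eps n.+1 *: delta L R q phi c m = delta L R q phi c m.
Proof.
move=> phiP.
have invP (X : E) : eps n.+1 * X = X * eps n ->
    forall c m, eps n.+1 *: (X *: phi c m) = X *: phi c m.
  by move=> e b k; rewrite scalerA e -scalerA phiP.
have sgn k (v : M) : eps n.+1 *: ((-1) ^+ k *: v) = (-1) ^+ k *: (eps n.+1 *: v).
  by rewrite !scalerA (commr_sign (eps n.+1) k).
have LX b : eps n.+1 * L b ^+ q = L b ^+ q * eps n by rewrite -epsLX eps_per.
have RX b : eps n.+1 * R b ^+ q = R b ^+ q * eps n by rewrite -epsRX eps_per.
case: m => [|m] /=; last first.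
  by rewrite !(scalerDr, sgn) !invP.
rewrite scaler_sumr; apply: eq_bigr => b _; rewrite scaler_sumr.
apply: eq_bigr => a _; apply: invP.
have aq : (a <= q)%N by rewrite -ltnS.
by rewrite -eps_per -{1}(subnK aq) addnA mulrA epsLX -!mulrA epsRX.
Qed.

Definition res_term n := idem_free (eps n) n.+1.

Definition res_gen n c m : res_term n := index_family (idem_basis (eps_idem n)) c m.

Lemma res_gen_eps n c m : eps n *: res_gen n c m = res_gen n c m.
Proof.
rewrite /res_gen /index_family; case: ifP => _; last exact: scaler0.
exact: idem_basis_idem.
Qed.

(** The differential is [delta] applied to the tautological cochain [res_gen], so identities for
    [delta] transfer to the complex and to every map out of it. *)
Definition res_d n : res_term n.+1 -> res_term n :=
  idem_hom (fun r => delta L R q (res_gen n) (gen_letter n.+1 r) (gen_length n.+1 r)).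

HB.instance Definition _ n := GRing.Linear.on (@res_d n).

Lemma res_d_basis n r : res_d (idem_basis (eps_idem n.+1) r) =
  delta L R q (res_gen n) (gen_letter n.+1 r) (gen_length n.+1 r).
Proof. by rewrite /res_d idem_hom_basis eps_delta // => *; exact: res_gen_eps. Qed.

Lemma res_d_gen n c m : res_d (res_gen n.+1 c m) = delta L R q (res_gen n) c m.
Proof.
rewrite -index_family_delta /res_gen index_family_morph.
by rewrite /index_family; case: ifP => // _; exact: res_d_basis.
Qed.

Lemma lin_res_d (M : lmodType E) n (g : {linear res_term n -> M}) v :
  g (res_d v) = \sum_r (v : 'rV_n.+2) 0 r *:
    delta L R q (fun c m => g (res_gen n c m)) (gen_letter n.+1 r) (gen_length n.+1 r).
Proof.
rewrite /res_d /idem_hom linear_sum; apply: eq_bigr => r _.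
by rewrite linearZ delta_linear.
Qed.

Lemma res_d_d n (v : res_term n.+2) : res_d (res_d v) = 0.
Proof.
rewrite lin_res_d big1 // => r _; rewrite -[RHS](scaler0 _ ((v : 'rV__) 0 r)); congr (_ *: _).
rewrite (eq_delta _ _ _ _ _ (@res_d_gen n)).
by apply: delta_delta => //; exact: index_family0.
Qed.

(* S plays the role of the right factor A^op of the enveloping algebra. *)
Variable S : E -> Prop.
Hypothesis SL : forall s c, S s -> s * L c = L c * s.
Hypothesis S0 : S 0.
Hypothesis S1 : S 1.
Hypothesis SN : forall s, S s -> S (- s).
Hypothesis SD : forall s t, S s -> S t -> S (s + t).
Hypothesis SM : forall s t, S s -> S t -> S (s * t).
Hypothesis SR : forall c, S (R c).
Hypothesis E_span : forall n (U : E -> Prop),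
  (forall u v, U u -> U v -> U (u + v)) ->
  (forall s u, S s -> U u -> U (s * u)) ->
  (forall c k, (k <= q.+1)%N -> U (L c ^+ k * eps n)) ->
  forall u, U (u * eps n).

Let SX s k : S s -> S (s ^+ k).
Proof. by move=> Ss; elim: k => [|k IHk]; rewrite ?expr0 // exprS; exact: SM. Qed.

Let Ssgn k : S ((-1) ^+ k).
Proof. by apply: SX; exact: SN. Qed.

Let SLX s c k : S s -> s * L c ^+ k = L c ^+ k * s.
Proof. by move=> Ss; apply: commrX; exact: SL. Qed.

(** Exponents below this bound survive reduction modulo boundaries. At the empty word a left letter
    can be traded for a right one, so only exponent 0 remains. On longer words the other letter is
    eliminated, and exponent [q.+1] with it. The divided difference removes one further generator,
    chosen to be exponent [q] of [true] at its one-letter word. *)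
Definition src_bound (c : bool) (m : nat) :=
  match m with 0 => 1%N | 1 => if c then q else q.+1 | _ => q.+1 end.

Definition src_coord n c m (u : E) := exists2 a : nat -> E, (forall k, S (a k)) &
  u = \sum_(k < src_bound c m) a k * L c ^+ k * eps n.

Definition is_src n (v : res_term n) :=
  forall r : 'I_n.+1, src_coord n (gen_letter n r) (gen_length n r) ((v : 'rV_n.+1) 0 r).

Lemma src_coord0 n c m : src_coord n c m 0.
Proof. by exists (fun=> 0) => //; rewrite big1 // => k _; rewrite !mul0r. Qed.

Lemma src_coord_eps n c m k : (k < src_bound c m)%N -> src_coord n c m (L c ^+ k * eps n).
Proof.
move=> kb; exists (fun j => if j == k then 1 else 0); first by move=> j; case: ifP.
rewrite (bigD1 (Ordinal kb)) //= eqxx mul1r big1 ?addr0 // => i.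
by rewrite -val_eqE /= => /negPf->; rewrite !mul0r.
Qed.

Lemma is_srcD n (v w : res_term n) : is_src v -> is_src w -> is_src (v + w).
Proof.
move=> vP wP r; have [a Sa va] := vP r; have [b Sb wb] := wP r.
exists (fun k => a k + b k); first by move=> k; exact: SD.
rewrite mxE va wb -big_split; apply: eq_bigr => k _ /=.
by rewrite !mulrDl.
Qed.

Lemma is_srcZ n s (v : res_term n) : S s -> is_src v -> is_src (s *: v).
Proof.
move=> Ss vP r; have [a Sa va] := vP r.
exists (fun k => s * a k); first by move=> k; exact: SM.
by rewrite mxE va mulr_sumr; apply: eq_bigr => k _; rewrite !mulrA.
Qed.

Lemma is_src_gen n c m k : (k < src_bound c m)%N ->
  is_src (L c ^+ k *: res_gen n c m).
Proof.
move=> kb r; rewrite /res_gen /index_family; case: ifP => [V|_]; last first.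
  by rewrite scaler0 mxE; exact: src_coord0.
rewrite mxE idem_basisE; case: eqP => [->|_]; last by rewrite mulr0; exact: src_coord0.
have mn : (m <= n)%N by case/andP: V.
rewrite inordK ?ltnS ?gen_index_bound // gen_lengthK //.
case: m kb V mn => [|m] kb V mn; last by rewrite gen_letterK //; exact: src_coord_eps.
move: kb; rewrite ltnS leqn0 => /eqP->.
by have := @src_coord_eps n (gen_letter n (gen_index n c 0)) 0 0 isT; rewrite !expr0.
Qed.

Definition im_src n (v : res_term n) :=
  exists w s, is_src s /\ v = res_d w + s :> res_term n.

Lemma im_srcD n (v w : res_term n) : im_src v -> im_src w -> im_src (v + w).
Proof.
move=> [v' [s [sP ->]]] [w' [t [tP ->]]]; exists (v' + w'), (s + t).
by split; [exact: is_srcD | rewrite linearD addrACA].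
Qed.

Lemma im_srcZ n s (v : res_term n) : S s -> im_src v -> im_src (s *: v).
Proof.
move=> Ss [v' [t [tP ->]]]; exists (s *: v'), (s *: t).
by split; [exact: is_srcZ | rewrite linearZ scalerDr].
Qed.

Lemma im_srcB n (v w : res_term n) : im_src v -> im_src w -> im_src (v - w).
Proof.
move=> vP wP; apply: im_srcD => //; rewrite -scaleN1r.
by apply: im_srcZ => //; exact: SN.
Qed.

Lemma is_src0 n : is_src (0 : res_term n).
Proof. by move=> r; rewrite mxE; exact: src_coord0. Qed.

Lemma im_src_src n (v : res_term n) : is_src v -> im_src v.
Proof. by exists 0, v; rewrite linear0 add0r. Qed.

Lemma im_src0 n : im_src (0 : res_term n).
Proof. by apply: im_src_src; exact: is_src0. Qed.

Lemma im_src_d n (v : res_term n.+1) : im_src (res_d v).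
Proof. by exists v, 0; split; [exact: is_src0 | rewrite addr0]. Qed.

Let im_src_gen_lt n c m k : (k < src_bound c m)%N -> im_src (L c ^+ k *: res_gen n c m).
Proof. by move=> kb; apply: im_src_src; exact: is_src_gen. Qed.

Let im_src_delta n u c m : im_src (u *: delta L R q (res_gen n) c m).
Proof. by rewrite -res_d_gen -linearZ; exact: im_src_d. Qed.

Let scaleLS n c k s (v : res_term n) : S s ->
  L c ^+ k *: (s *: v) = s *: (L c ^+ k *: v).
Proof. by move=> Ss; rewrite !scalerA SLX. Qed.

(** The boundary of the generator at the empty word contains this element with coefficient 1 (the
    end [a = q] of the divided difference); all its other terms lie below the bound. *)
Let im_src_1 n : im_src (L true ^+ q *: res_gen n true 1).
Proof.
have P b a : (a < src_bound b 1)%N ->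
    im_src ((L b ^+ a * R b ^+ (q - a)) *: res_gen n b 1).
  move=> ab; rewrite LRX -scalerA; apply: im_srcZ; first exact: SX.
  exact: im_src_gen_lt.
have := im_src_delta n 1 true 0; rewrite scale1r /= big_bool /=.
rewrite big_ord_recr /= subnn mulr1 => D.
have -> : L true ^+ q *: res_gen n true 1 =
  \sum_(a < q) (L true ^+ a * R true ^+ (q - a)) *: res_gen n true 1 +
   L true ^+ q *: res_gen n true 1 +
   \sum_(a < q.+1) (L false ^+ a * R false ^+ (q - a)) *: res_gen n false 1
   - (\sum_(a < q) (L true ^+ a * R true ^+ (q - a)) *: res_gen n true 1
   + \sum_(a < q.+1) (L false ^+ a * R false ^+ (q - a)) *: res_gen n false 1).
  by rewrite [X in X - _]addrAC [X in X - _]addrC addrK.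
apply: im_srcB => //; apply: im_srcD;
  (elim/big_ind: _ => [|v w|a _]; [exact: im_src0|exact: im_srcD|exact: P]).
Qed.

Let im_src_lt n c m k : (0 < m)%N -> (k <= q)%N -> im_src (L c ^+ k *: res_gen n c m).
Proof.
case: m => [|[|m]] // _ kq; last exact: im_src_gen_lt.
case: c; last exact: im_src_gen_lt.
by move: kq; rewrite leq_eqVlt => /orP[/eqP->|kq]; [exact: im_src_1 | exact: im_src_gen_lt].
Qed.

Let im_src_hpart n c m k : (k <= q)%N -> (0 < m)%N ->
  im_src (L c ^+ k *: (L (~~ c) ^+ q *: res_gen n (~~ c) m)).
Proof.
move=> kq m0; rewrite scalerA; case: k kq => [|k] kq.
  by rewrite mul1r; exact: im_src_lt.
by rewrite LL0 // scale0r; exact: im_src0.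
Qed.

(** Left multiplication by [c] on a word starting with [~~ c] is the leading term of the boundary of
    the word with [c] prepended. The remaining terms have powers of the first letter only, with
    exponent at most [q]. *)
Let im_src_other n c m k : (0 < m)%N -> (0 < k <= q.+1)%N ->
  im_src (L c ^+ k *: res_gen n (~~ c) m).
Proof.
case: m k => // m [|k] // _; rewrite /= ltnS => kq.
have := im_src_delta n (L c ^+ k) c m.+2.
rewrite /delta -addrA [L c ^+ k *: (_ + _)]scalerDr; set rest := _ + (_ + _) => D.
rewrite exprSr -scalerA -[_ *: (_ *: _)](addrK (L c ^+ k *: rest)); apply: im_srcB => //.
rewrite /rest !scalerDr; apply: im_srcD; last apply: im_srcD.
- by rewrite !scaleLS //; do 2!apply: im_srcZ => //; exact: im_src_lt.
- exact: im_src_hpart.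
- rewrite !scaleLS //; try exact: SX.
  by do 2!apply: im_srcZ => //; [exact: SX|exact: im_src_lt].
Qed.

(** The boundary of the one-letter word turns one left factor [c] into a right factor, which [S]
    absorbs; hence the induction on the exponent. The homotopy terms lead to words of length 2,
    treated before. *)
Let im_src_zero n c k : (k <= q.+1)%N -> im_src (L c ^+ k *: res_gen n c 0).
Proof.
elim: k => [|k IHk] kq; first exact: im_src_gen_lt.
have := im_src_delta n (L c ^+ k) c 1.
rewrite /delta -addrA [L c ^+ k *: (_ + _)]scalerDr; set rest := _ + (_ + _) => D.
have -> : res_gen n c 0 = res_gen n (~~ c) 0 by case: c {D rest IHk}; rewrite /res_gen /= index_family0.
rewrite exprSr -scalerA -[_ *: (_ *: _)](addrK (L c ^+ k *: rest)); apply: im_srcB => //.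
rewrite /rest !scalerDr; apply: im_srcD; last apply: im_srcD.
- by rewrite !scaleLS //; do 2!apply: im_srcZ => //; apply: IHk; exact: ltnW.
- exact: im_src_hpart.
- rewrite !scaleLS //; try exact: SX.
  by do 2!apply: im_srcZ => //; [exact: SX|exact: im_src_lt].
Qed.

Lemma im_src_gen n c m k : (k <= q.+1)%N -> im_src (L c ^+ k *: res_gen n c m).
Proof.
case: m => [|m] kq; first exact: im_src_zero.
move: kq; rewrite leq_eqVlt => /orP[/eqP->|]; last by rewrite ltnS => kq; exact: im_src_lt.
(* The top power is minus the top power of the other letter, and powers of the other letter have
   just been reduced. *)
rewrite -[L c ^+ _]opprK -LN -[X in res_gen _ X]negbK scaleNr -sub0r.
by apply: im_srcB; [exact: im_src0 | apply: im_src_other => //=].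
Qed.

Lemma im_src_all n (v : res_term n) : im_src v.
Proof.
rewrite (idem_expand (eps_idem n) v).
elim/big_ind: _ => [|u w|r _]; [exact: im_src0|exact: im_srcD|].
have -> : idem_basis (eps_idem n) r = res_gen n (gen_letter n r) (gen_length n r).
  by rewrite /res_gen index_family_gen.
set c := gen_letter _ _; set m := gen_length _ _.
rewrite -res_gen_eps scalerA.
move: ((v : 'rV_n.+1) 0 r); apply: (E_span (U := fun u => im_src (u *: res_gen n c m))) => [u w|s u Ss|c' k kq].
- by rewrite scalerDl; exact: im_srcD.
- by rewrite -scalerA; exact: im_srcZ.
rewrite -scalerA res_gen_eps.
have [->|cc] := eqVneq c' c; first exact: im_src_gen.
have -> : c = ~~ c' by case: c c' cc => [] [].
have [m0|] := posnP m; last first.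
  case: k kq => [|k] kq m_gt0; last by apply: im_src_other.
  by have := im_src_lt n (~~ c') m_gt0 (leq0n q); rewrite !expr0 !scale1r.
rewrite m0; have -> : res_gen n (~~ c') 0 = res_gen n c' 0.
  by case: c' {cc kq}; rewrite /res_gen /= index_family0.
exact: im_src_gen.
Qed.

(* kappa c k reads off the coefficient of c^k in the left tensor factor. *)
Variable kappa : bool -> nat -> {additive E -> E}.
Hypothesis kappaS : forall c k s u, S s -> kappa c k (s * u) = s * kappa c k u.
Hypothesis kappa_same : forall n c k j, (j <= q.+1)%N -> (0 < k <= q.+1)%N ->
  kappa c k (L c ^+ j * eps n) = if j == k then eps n else 0.
Hypothesis kappa_other : forall n c k j, (j <= q)%N -> (0 < k <= q.+1)%N ->
  kappa c k (L (~~ c) ^+ j * eps n) = 0.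
Hypothesis S_inj : forall n s, S s -> s * eps n = 0 -> s = 0.

Let coord n (s : 'I_n.+1) (v : res_term n) : E^o := (v : 'rV_n.+1) 0 s.

Let regularZE (a : E) (b : E^o) : a *: b = a * b :> E. Proof. by []. Qed.

Fact coord_linear n s : linear (@coord n s).
Proof. by move=> a v w; rewrite /coord !mxE. Qed.

HB.instance Definition _ n s :=
  GRing.isLinear.Build E (res_term n) E^o _ (@coord n s) (@coord_linear n s).

Lemma coord_gen n c m d j : (j <= n)%N && ~~ odd (n + j) ->
  coord (inord (gen_index n d j)) (res_gen n c m) =
  if (m == j) && ((c == d) || (j == 0)%N) then eps n else 0.
Proof.
move=> V; rewrite /coord /res_gen /index_family.
case W: ((m <= n)%N && ~~ odd (n + m)); last first.
  by rewrite mxE; case: (m =P j) => // mj; move: V; rewrite -mj W.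
rewrite idem_basisE -(inj_eq val_inj) /= !inordK ?ltnS ?gen_index_bound //;
  try by [case/andP: V | case/andP: W].
suff -> : (gen_index n d j == gen_index n c m) = (m == j) && ((c == d) || (j == 0)%N) by [].
by move: V W; rewrite /gen_index; case: c; case: d; lia.
Qed.

Lemma res_d_coord n (v : res_term n.+1) s :
  coord s (res_d v) = \sum_r (v : 'rV_n.+2) 0 r *
    delta L R q (fun c m => coord s (res_gen n c m)) (gen_letter n.+1 r) (gen_length n.+1 r).
Proof. exact: (lin_res_d (coord s)). Qed.

Let kappaLR c k u c' j n : S u -> (0 < k <= q.+1)%N -> (j <= q)%N -> c' = ~~ c ->
  kappa c k (u * (L c' ^+ j * eps n)) = 0.
Proof. by move=> Su kq jq ->; rewrite kappaS // kappa_other // mulr0. Qed.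

Let kappaLS c k c' j s u : S s ->
  kappa c k (L c' ^+ j * (s * u)) = s * kappa c k (L c' ^+ j * u).
Proof. by move=> Ss; rewrite mulrA -SLX // -mulrA kappaS. Qed.

(** The coordinate of [res_d v] at the word with its first letter [d] deleted determines this
    coordinate of [v]: the coefficient of the left power [d ^ k.+1] there is exactly [a k]. Every
    other contribution carries a left power of [~~ d] with exponent at most [q], or a vanishing
    mixed product. *)
Lemma src_long_eq0 n (v : res_term n.+1) (r : 'I_n.+2) :
  is_src v -> res_d v = 0 -> (1 < gen_length n.+1 r)%N -> (v : 'rV_n.+2) 0 r = 0.
Proof.
move=> vS dv0 r1; have rn : (r <= n.+1)%N by rewrite -ltnS.
have := gen_lengthP rn; case E1: (gen_length n.+1 r) r1 => [|[|m']] // _ V.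
set d := gen_letter n.+1 r.
have V' : (m'.+1 <= n)%N && ~~ odd (n + m'.+1) by move: V; lia.
pose s : 'I_n.+1 := inord (gen_index n (~~ d) m'.+1).
pose ind c m := coord s (res_gen n c m).
have indE c m : ind c m = if (m == m'.+1) && (c == ~~ d) then eps n else 0.
  by rewrite /ind /s coord_gen // orbF.
have ind_eps c m : eps n *: ind c m = ind c m.
  by rewrite indE; case: ifP; rewrite ?scaler0 // => _; exact: eps_idem.
have claim c m j k : (k <= q)%N -> (j < src_bound c m)%N ->
    kappa d k.+1 (L c ^+ j * delta L R q ind c m) =
    if (c == d) && (m == m'.+2) && (j == k) then eps n else 0.
  move=> kq; case: m => [|m] jb.
    have -> : j = 0%N by case: j jb.
    rewrite andbF mul1r /=.
    rewrite raddf_sum big1 // => b _; rewrite raddf_sum big1 // => a _.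
    rewrite indE; case: ifP => [/andP[_ /eqP->]|_]; last by rewrite scaler0 raddf0.
    by rewrite regularZE LRX -mulrA; apply: kappaLR => //; [exact: SX | rewrite -ltnS].
  have jq : (j <= q)%N by move: jb; rewrite /src_bound; case: m (c) => [|m] [] /=; lia.
  rewrite /delta !regularZE !mulrDr !(raddfD (kappa _ _)) /=.
  rewrite !(kappaLS _ _ _ _ _ (Ssgn _)) !(kappaLS _ _ _ _ _ (SX _ (SR _))).
  rewrite !(kappaLS _ _ _ _ _ (SR _)).
  have -> : kappa d k.+1 (L c ^+ j * ind c m) = 0.
    rewrite indE; case: ifP => [/andP[_ /eqP->]|_]; last by rewrite mulr0 raddf0.
    exact: kappa_other.
  have -> : kappa d k.+1 (L c ^+ j * ind c m.+2) = 0.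
    rewrite indE; case: ifP => [/andP[_ /eqP->]|_]; last by rewrite mulr0 raddf0.
    exact: kappa_other.
  have -> : kappa d k.+1 (L c ^+ j * (L (~~ c) ^+ q * ind (~~ c) m.+2)) = 0.
    rewrite indE; case: ifP => [/andP[_ /eqP e]|_]; last by rewrite !mulr0 raddf0.
    rewrite mulrA; case: j {jb jq} => [|j]; last by rewrite LL0 // mul0r raddf0.
    by rewrite mul1r e; apply: kappa_other.
  rewrite !mulr0 !addr0 indE eqSS (inj_eq negb_inj) [X in if X then _ else _]andbC.
  case: eqP => [->|_] /=; last by rewrite !mulr0 raddf0.
  case: eqP => [_|_] /=; last by rewrite !mulr0 raddf0.
  by rewrite mulrA -exprSr kappa_same.
have epsX c m : eps n.+1 * delta L R q ind c m = delta L R q ind c m.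
  exact: (eps_delta (M := E^o)).
have sumE c m (b : nat -> E) k : (k <= q)%N -> (forall k, S (b k)) ->
    kappa d k.+1 ((\sum_(j < src_bound c m) b j * L c ^+ j * eps n.+1) *
      delta L R q ind c m) =
    \sum_(j < src_bound c m) b j *
      (if (c == d) && (m == m'.+2) && (j == k :> nat) then eps n else 0).
  move=> kq Sb; rewrite mulr_suml raddf_sum; apply: eq_bigr => j _.
  by rewrite -!mulrA epsX kappaS // claim.
have bq c : src_bound c m'.+2 = q.+1 by [].
have [a Sa va] := vS r.
have a0 k : (k <= q)%N -> a k = 0.
  move=> kq; apply: (@S_inj n); first exact: Sa.
  have := congr1 (kappa d k.+1) (congr1 (coord s) dv0).
  rewrite linear0 raddf0 res_d_coord raddf_sum (bigD1 r) //= big1 ?addr0 => [|r' r'r].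
    rewrite va E1 -/d -/ind sumE // !eqxx /= (bigD1 (Ordinal (kq : (k < q.+1)%N))) //= eqxx.
    by rewrite big1 ?addr0 // => i; rewrite -val_eqE /= => /negPf->; rewrite mulr0.
  have [b Sb ->] := vS r'; rewrite -/ind sumE // big1 // => i _.
  case: ifP => [/andP[/andP[/eqP e1 /eqP e2] _]|_]; last by rewrite mulr0.
  case/eqP: r'r; apply: val_inj => /=.
  rewrite -(gen_indexK rn) E1 -/d -e1 -e2 gen_indexK // -ltnS //.
by rewrite va E1 big1 // => k _; rewrite a0 ?mul0r // -ltnS.
Qed.

(** The only new case is [j = q.+1], where the power of the other letter is minus the top power of
    [c], invisible to [kappa c k] for [k <= q]. *)
Let kappa_other_lt n c k j : (j <= q.+1)%N -> (0 < k <= q)%N ->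
  kappa c k (L (~~ c) ^+ j * eps n) = 0.
Proof.
move=> jq kq; have [/eqP->|] := boolP (j == q.+1); last first.
  by move=> jq'; apply: kappa_other; move: jq jq' kq; lia.
rewrite LN mulNr raddfN /= kappa_same //; last by move: kq; lia.
by case: eqP => [e|_]; rewrite ?oppr0 //; move: kq; lia.
Qed.

(** Read at the empty word, where a one-letter generator has boundary [L c - R c]. The letters could
    interfere only when both reach exponent [q.+1], and the smaller bound for [true] excludes this:
    [kappa_other_lt] covers [d = true] and [kappa_other] covers [d = false]. *)
Lemma src_length1_eq0 n (v : res_term n.+1) (r : 'I_n.+2) :
  is_src v -> res_d v = 0 -> gen_length n.+1 r = 1%N -> (v : 'rV_n.+2) 0 r = 0.
Proof.
move=> vS dv0 E1; have rn : (r <= n.+1)%N by rewrite -ltnS.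
have := gen_lengthP rn; rewrite E1 => V.
set d := gen_letter n.+1 r.
pose s : 'I_n.+1 := inord (gen_index n false 0).
pose ind c m := coord s (res_gen n c m).
have indE c m : ind c m = if m == 0%N then eps n else 0.
  by rewrite /ind /s coord_gen ?orbT ?andbT //; move: V; lia.
have ind_eps c m : eps n *: ind c m = ind c m.
  by rewrite indE; case: ifP; rewrite ?scaler0 // => _; exact: eps_idem.
have epsX c m : eps n.+1 * delta L R q ind c m = delta L R q ind c m.
  exact: (eps_delta (M := E^o)).
have [a Sa va] := vS r.
have claim c j k : (j < src_bound c 1)%N -> (k < src_bound d 1)%N ->
    kappa d k.+1 (L c ^+ j * delta L R q ind c 1) =
    if c == d then (if j == k then eps n else 0) - R d * (if j == k.+1 then eps n else 0)
    else 0.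
  move=> jb kb; rewrite /delta !indE !regularZE !mulr0 !addr0 mulrDr raddfD /=.
  rewrite (kappaLS _ _ _ _ _ (Ssgn 1)) (kappaLS _ _ _ _ _ (SR _)) expr1 mulN1r.
  rewrite mulrA -exprSr /last_letter /=.
  have kq : (k < q.+1)%N by move: kb; rewrite /src_bound; case: (d); lia.
  have jq : (j < q.+1)%N by move: jb; rewrite /src_bound; case: (c); lia.
  case: eqP => [->|/eqP cd]; first by rewrite !kappa_same // ltnW.
  have -> : c = ~~ d by case: c (d) cd {jb} => [] [].
  rewrite (@kappa_other n d k.+1 j) // mulr0 subr0.
  move: jb kb cd; rewrite /src_bound; case: c (d) => [] [] //= jb kb _.
    by apply: (@kappa_other n false).
  by apply: (@kappa_other_lt n true).
have a0 k : (k < src_bound d 1)%N -> a k = 0.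
  (* Descending induction on [k]: the coefficient of the left power [d ^ k.+1] is [a k] minus a
     multiple of [a k.+1], and nothing lies above the bound. *)
  move: {2}(src_bound d 1 - k)%N (leqnn (src_bound d 1 - k)) => w.
  elim: w k => [|w IHw] k kw kb; first by move: kw kb; lia.
  apply: (@S_inj n); first exact: Sa.
  have := congr1 (kappa d k.+1) (congr1 (coord s) dv0).
  rewrite linear0 raddf0 res_d_coord raddf_sum (bigD1 r) //= big1 ?addr0 => [|r' r'r].
    rewrite va E1 -/d -/ind mulr_suml raddf_sum (bigD1 (Ordinal kb)) // big1 ?addr0.
      rewrite -!mulrA epsX kappaS // claim // !eqxx.
      by rewrite (ltn_eqF (ltnSn k)) mulr0 subr0 /= addr0.
    move=> i; rewrite andTb -val_eqE => /negPf ik'.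
    have ik : (i == k :> nat) = false by exact: ik'.
    rewrite -!mulrA epsX kappaS // claim // eqxx ik sub0r.
    case: eqP => [ik1|_]; last by rewrite mulr0 oppr0 mulr0.
    by rewrite ik1 IHw ?mul0r //; move: (ltn_ord i) kw; rewrite ik1; lia.
  have r'n : (r' <= n.+1)%N by rewrite -ltnS.
  have [/(src_long_eq0 vS dv0)->|l1] := boolP (1 < gen_length n.+1 r')%N.
    by rewrite mul0r raddf0.
  have l1' : gen_length n.+1 r' = 1%N by have := gen_lengthP r'n; move: V l1; lia.
  have [b Sb ->] := vS r'; rewrite l1' mulr_suml raddf_sum big1 // => j _.
  rewrite -!mulrA -/ind epsX kappaS // claim //.
  case: eqP => [e|_]; last by rewrite mulr0.
  case/eqP: r'r; apply: val_inj => /=.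
  by rewrite -(gen_indexK rn) E1 -/d -e -l1' gen_indexK.
by rewrite va E1 big1 // => k _; rewrite a0 ?mul0r.
Qed.

(** In this parity all other words have length at least 2 and are already excluded. At the word
    [true] of length 1 the divided difference has the left power [true ^ q] with coefficient 1, so
    [kappa true q] isolates [a 0]. *)
Lemma src_length0_eq0 n (v : res_term n.+1) (r : 'I_n.+2) :
  is_src v -> res_d v = 0 -> gen_length n.+1 r = 0%N -> (v : 'rV_n.+2) 0 r = 0.
Proof.
move=> vS dv0 E1; have rn : (r <= n.+1)%N by rewrite -ltnS.
have := gen_lengthP rn; rewrite E1 => V.
pose s : 'I_n.+1 := inord (gen_index n true 1).
pose ind c m := coord s (res_gen n c m).
have indE c m : ind c m = if (m == 1%N) && c then eps n else 0.
  by rewrite /ind /s coord_gen ?orbF ?eqb_id //; move: V; lia.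
have ind_eps c m : eps n *: ind c m = ind c m.
  by rewrite indE; case: ifP; rewrite ?scaler0 // => _; exact: eps_idem.
have epsX c m : eps n.+1 * delta L R q ind c m = delta L R q ind c m.
  exact: (eps_delta (M := E^o)).
have [a Sa va] := vS r.
have X0 c : kappa true q (delta L R q ind c 0) = eps n.
  rewrite /= big_bool /= [X in _ + X]big1 ?addr0 => [|i _]; last by rewrite indE scaler0.
  rewrite raddf_sum big_ord_recr /= big1 ?add0r => [|i _]; last first.
    rewrite regularZE indE /= LRX -mulrA kappaS; last exact: SX.
    have iq := ltn_ord i; rewrite kappa_same; [by rewrite (ltn_eqF iq) mulr0 | |];
      by move: iq q_gt0 => /=; lia.
  by rewrite subnn mulr1 regularZE indE kappa_same ?eqxx ?q_gt0 ?leqnSn.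
have a0 : a 0%N = 0.
  apply: (@S_inj n); first exact: Sa.
  have := congr1 (kappa true q) (congr1 (coord s) dv0).
  rewrite linear0 raddf0 res_d_coord raddf_sum (bigD1 r) //= big1 ?addr0 => [|r' r'r].
    by rewrite va E1 big_ord1 expr0 mulr1 -/ind -mulrA epsX kappaS // X0.
  rewrite (src_long_eq0 vS dv0) ?mul0r ?raddf0 //.
  have r'n : (r' <= n.+1)%N by rewrite -ltnS.
  have := gen_lengthP r'n; move: V r'r E1; rewrite -val_eqE /= /gen_length.
  by case: ltnP; case: ltnP; lia.
by rewrite va E1 big_ord1 a0 !mul0r.
Qed.

Lemma res_d_src_inj n (v : res_term n.+1) : is_src v -> res_d v = 0 -> v = 0.
Proof.
move=> vS dv0; apply/val_inj/rowP => r; rewrite [RHS]mxE.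
case E1 : (gen_length n.+1 r) => [|[|m]].
- exact: src_length0_eq0 dv0 E1.
- exact: src_length1_eq0 dv0 E1.
- by apply: src_long_eq0 => //; rewrite E1.
Qed.

Variables (X : lmodType E) (x0 : X).
Hypothesis S_aug : forall s, S s -> s *: x0 = 0 -> s = 0.
Hypothesis x0_LR : forall c, L c *: x0 = R c *: x0.
Hypothesis x0_eps : eps 0 *: x0 = x0.
Hypothesis x0_gen : forall y, exists u : E, u *: x0 = y.

Definition res_aug0 : res_term 0 -> X := idem_hom (fun=> x0).

HB.instance Definition _ := GRing.Linear.on res_aug0.

Lemma res_aug0E v : res_aug0 v = (v : 'rV_1) 0 0 *: x0.
Proof. by rewrite /res_aug0 /idem_hom big_ord1. Qed.

Lemma res_aug0_surj y : exists v, res_aug0 v = y.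
Proof.
have [u <-] := x0_gen y; exists (u *: idem_basis (eps_idem 0) ord0).
by rewrite linearZ /= /res_aug0 idem_hom_basis x0_eps.
Qed.

Lemma res_aug0_d v : res_aug0 (res_d v) = 0.
Proof.
rewrite (lin_res_d res_aug0) big1 // => r _.
have gE c m : res_aug0 (res_gen 0 c m) = if m == 0%N then x0 else 0.
  rewrite /res_gen index_family_morph /index_family.
  by case: m => [|m] //=; rewrite /res_aug0 idem_hom_basis.
have -> : gen_length 1 r = 1%N by case: r => [] [|[|]].
rewrite (eq_delta _ _ _ _ _ gE) /delta /= /last_letter /= !scaler0 !addr0 expr1 scaleN1r x0_LR subrr.
exact: scaler0.
Qed.

Lemma res_exact_at0 v : res_aug0 v = 0 <-> exists w, res_d w = v.
Proof.
split=> [v0|[w <-]]; last exact: res_aug0_d.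
have [w [s [sS vE]]] := im_src_all v; exists w.
suff s0 : s = 0 by rewrite vE s0 addr0.
have {v0} : res_aug0 s = 0 by move: v0; rewrite vE linearD /= res_aug0_d add0r.
have [a Sa sa] := sS ord0.
rewrite res_aug0E sa big_ord1 expr0 mulr1 -scalerA x0_eps => /(S_aug (Sa 0%N)) a0.
by apply/val_inj/rowP => i; rewrite ord1 mxE sa big_ord1 a0 !mul0r.
Qed.

Lemma res_exact_atS n (v : res_term n.+1) : res_d v = 0 <-> exists w, res_d w = v.
Proof.
split=> [v0|[w <-]]; last exact: res_d_d.
have [w [s [sS vE]]] := im_src_all v; exists w.
suff s0 : s = 0 by rewrite vE s0 addr0.
by apply: res_d_src_inj => //; move: v0; rewrite vE linearD /= res_d_d add0r.
Qed.

Definition truncated_resolution : proj_resolution X :=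
  @ProjResolution K E X (fun n => res_term n : lmodType E)
    (fun n => @res_d n) res_aug0 (fun n => idem_free_projective (k := n.+1) (eps_idem n))
    res_aug0_surj res_exact_at0 res_exact_atS.

End Resolution.

(** * Functionals on quotient algebras and the universal property of the enveloping algebra *)

Section IdealVanish.
Variables (R : nzRingType) (V : zmodType) (f : {additive R -> V}).

Lemma ideal_gen_vanish (X : R -> Prop) :
  (forall g, X g -> forall u v, f (u * g * v) = 0) ->
  forall z, ideal_gen X z -> f z = 0.
Proof.
move=> fX z Iz.
(* Vanishing on all two-sided multiples, unlike vanishing at [z] alone, is a condition that defines
   an ideal. *)
suff : forall u v, f (u * z * v) = 0 by move=> /(_ 1 1); rewrite mul1r mulr1.
apply: (Iz (fun z => forall u v, f (u * z * v) = 0)) => //; split.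
- by move=> u v; rewrite mulr0 mul0r raddf0.
- by move=> x y x0 y0 u v; rewrite mulrBr mulrBl raddfB x0 y0 subr0.
- by move=> a x x0 u v; rewrite [u * _]mulrA.
- by move=> a x x0 u v; rewrite mulrA -[_ * v]mulrA.
Qed.

End IdealVanish.

Section CatAlgLinear.
Variables (K : fieldType) (C : fobCat) (V : lmodType K).

(* Linearity in the two outer factors reduces to morphisms of C. *)
Lemma catalg_sandwich0 (f : {linear catalg K C -> V}) (g : catalg K C) :
  (forall p r : C, f ((<< p >> : catalg K C) * g * (<< r >> : catalg K C)) = 0) ->
  forall u v, f (u * g * v) = 0.
Proof.
move=> fP u v.
have f1 p w : f ((<< p >> : catalg K C) * g * w) = 0.
  pose F : {linear {malg K[mor C]} -> V} := f \o catalg_mul ((<< p >> : catalg K C) * g).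
  have F0 : forall r : C, F << r >> = (\0 : {linear {malg K[mor C]} -> V}) << r >>.
    exact: fP.
  exact: (malg_linear_eq F0 w).
pose F : {linear {malg K[mor C]} -> V} := f \o (catalg_rmul v \o catalg_rmul g).
have F0 : forall r : C, F << r >> = (\0 : {linear {malg K[mor C]} -> V}) << r >>.
  by move=> p; exact: f1.
exact: (malg_linear_eq F0 u).
Qed.

End CatAlgLinear.

Section Tensor.
Variables (K : fieldType) (A : algType K).

Lemma tensM (a b a' b' : A) : tens a b * tens a' b' = tens (a' * a) (b * b').
Proof. by rewrite /tens -rmorphM; congr (quotpi _ _); exact: catalg_mulUU. Qed.

Lemma tens_linl (b : A) (c : K) (a a' : A) :
  tens (c *: a + a') b = c *: tens a b + tens a' b.
Proof.
rewrite /tens -linearP; apply/quotpi_eq => J _; apply.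
by exists c, a, a', b; left.
Qed.

Lemma tens_linr (a : A) (c : K) (b b' : A) :
  tens a (c *: b + b') = c *: tens a b + tens a b'.
Proof.
rewrite /tens -linearP; apply/quotpi_eq => J _; apply.
by exists c, b, b', a; right.
Qed.

Definition tensl (b a : A) : env A := tens a b.
HB.instance Definition _ b :=
  GRing.isLinear.Build K A (env A) _ (tensl b) (tens_linl b).
HB.instance Definition _ a :=
  GRing.isLinear.Build K A (env A) _ (@tens K A a) (tens_linr a).

Lemma tens11 : tens 1 1 = 1 :> env A.
Proof. by rewrite -[RHS](rmorph1 (quotpi _)); congr (quotpi _ _);
  rewrite -[RHS]/(catalg_one K (opA_cat A)) /catalg_one /= big_seq1. Qed.

(** Sums of pure tensors suffice, since a scalar can be absorbed into a tensor factor. *)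
Lemma env_ind (U : env A -> Prop) :
  (forall u v, U u -> U v -> U (u + v)) -> (forall a b, U (tens a b)) ->
  forall u, U u.
Proof.
move=> UD Ut; elim/quotpi_ind => z; rewrite (monalgE z) linear_sum /=.
elim/big_ind: _ => // [|[a b] _].
  by have <- : tens 0 0 = 0 :> env A := linear0 _.
have -> : << z@_(a, b) *g (a, b) >> = z@_(a, b) *: pure a b :> {malg K[opA_cat A]}.
  by apply/malgP => k; rewrite mcoeffZ !mcoeffU mulrnAr mulr1.
rewrite linearZ /= -[quotpi _ _]/(tens a b).
set k := z@_(a, b); suff <- : tens (k *: a) b = k *: tens a b by [].
by rewrite -!/(tensl b _) linearZ.
Qed.

Variables (V : lmodType K) (f : A -> A -> V).
Hypothesis f_linl : forall b, linear (f^~ b).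
Hypothesis f_linr : forall a, linear (f a).

Let pre : {linear catalg K (opA_cat A) -> V} := lin_ext (fun p : opA_cat A => f p.1 p.2).

Let pre_pure a b : pre (pure a b) = f a b.
Proof. exact: lin_extU. Qed.

Let pre_rel z : ideal_gen (@bilinear_rel K A) z -> pre z = 0.
Proof.
apply: ideal_gen_vanish => g [c [a [a' [b gE]]]]; apply: catalg_sandwich0 => p r.
have pureM (u v w x : A) : pure u v * pure w x = pure (w * u) (v * x).
  exact: catalg_mulUU.
case: gE => ->; rewrite -/(pure _ _); case: p r => [p1 p2] [r1 r2];
rewrite -!/(pure _ _) mulrBr mulrBl mulrDr mulrDl -!scalerAr -!scalerAl !pureM;
rewrite linearB linearP !pre_pure.
  by rewrite mulrDl mulrDr -scalerAl -scalerAr f_linl subrr.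
by rewrite mulrDr mulrDl -scalerAr -scalerAl f_linr subrr.
Qed.

(** The linear map induced by a bilinear [f]. The ideal of bilinear relations is two-sided, so
    independence of the representative has to be checked on relations multiplied by pairs on both
    sides. *)
Definition env_lift (u : env A) : V := pre (quotrepr u).

Let env_lift_pi z : env_lift (quotpi _ z) = pre z.
Proof.
apply/esym/eqP; rewrite -subr_eq0 -linearB; apply/eqP/pre_rel.
by apply/(quotpi_eq (Relations (@bilinear_rel_proper K A))); rewrite quotreprK.
Qed.

Lemma env_lift_tens a b : env_lift (tens a b) = f a b.
Proof. by rewrite env_lift_pi pre_pure. Qed.

Fact env_lift_linear : linear env_lift.
Proof.
move=> c; elim/quotpi_ind => x; elim/quotpi_ind => y.
by rewrite -linearP !env_lift_pi linearP.
Qed.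

End Tensor.

(* The structure of A_T used below, with q = 4T + 1: vertex idempotents e i,
   i modulo 4, letters z false = x and z true = y, and coefficient functionals
   cf c k i of the monomial e i * z c ^+ k. *)
Record covering_basis (K : fieldType) (A : algType K) (q : nat) := CoveringBasis {
  cb_z : bool -> A;
  cb_e : nat -> A;
  cb_cf : bool -> nat -> nat -> {linear A -> K^o};
  cb_e_sum : \sum_(i < 4) cb_e i = 1;
  cb_e_per : forall i, cb_e (i + 4) = cb_e i;
  cb_e_mul : forall i j, cb_e i * cb_e j = if i == j %[mod 4] then cb_e i else 0;
  cb_ez : forall i c, cb_e i * cb_z c = cb_z c * cb_e i.+1;
  cb_zz : forall c, cb_z c * cb_z (~~ c) = 0;
  cb_zN : forall c, cb_z (~~ c) ^+ q.+1 = - cb_z c ^+ q.+1;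
  cb_span : forall U : A -> Prop,
    (forall a b, U a -> U b -> U (a + b)) -> (forall c a, U a -> U (c *: a)) ->
    (forall i c k, (k <= q.+1)%N -> U (cb_e i * cb_z c ^+ k)) -> forall a, U a;
  cb_cf_same : forall c k i j l, (k <= q.+1)%N -> (l <= q.+1)%N ->
    cb_cf c k i (cb_e j * cb_z c ^+ l) = ((l == k) && (i == j %[mod 4]))%:R;
  cb_cf_other : forall c k i j l, (k <= q.+1)%N -> (l <= q)%N -> (0 < k + l)%N ->
    cb_cf c k i (cb_e j * cb_z (~~ c) ^+ l) = 0;
  cb_q : (q %% 4 = 1)%N
}.

(* The enveloping algebra enters only through these properties: over an abstract
   E the ring operations cannot be unfolded to those of a quotient. *)
Section TensorResolution.
Variables (K : fieldType) (A : algType K) (q : nat) (B : covering_basis A q).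
Variables (E : algType K) (tens : A -> A -> E).
Hypothesis tensM : forall a b a' b', tens a b * tens a' b' = tens (a' * a) (b * b').
Hypothesis tens_linl : forall b, linear (tens^~ b).
Hypothesis tens_linr : forall a, linear (tens a).
Hypothesis tens11 : tens 1 1 = 1.
Hypothesis tens_ind : forall U : E -> Prop,
  (forall u v, U u -> U v -> U (u + v)) -> (forall a b, U (tens a b)) -> forall u, U u.
Hypothesis tens_lift : forall (V : lmodType K) (f : A -> A -> V),
  (forall b, linear (f^~ b)) -> (forall a, linear (f a)) ->
  exists F : {linear E -> V}, forall a b, F (tens a b) = f a b.
Local Notation z := (cb_z B).
Local Notation e := (cb_e B).
Local Notation cf := (cb_cf B).

Let q_gt0 : (0 < q)%N. Proof. by have := cb_q B; lia. Qed.

Lemma cb_e_mod i j : i = j %[mod 4] -> e i = e j.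
Proof.
have per k n : e (n + k * 4) = e n.
  by elim: k => [|k IHk]; rewrite ?addn0 // mulSn [(4 + _)%N]addnC addnA cb_e_per.
by move=> ij; rewrite (divn_eq i 4) (divn_eq j 4) addnC per addnC per ij.
Qed.

Lemma cb_ezX i c k : e i * z c ^+ k = z c ^+ k * e (i + k).
Proof.
elim: k => [|k IHk]; first by rewrite mulr1 mul1r addn0.
by rewrite exprSr mulrA IHk -mulrA cb_ez mulrA addnS.
Qed.

Lemma cb_zeX i c k : z c ^+ k * e i = e (i + 3 * k) * z c ^+ k.
Proof. by rewrite cb_ezX; congr (_ * _); apply: cb_e_mod; lia. Qed.

Lemma cb_e_idem i : e i * e i = e i.
Proof. by rewrite cb_e_mul eqxx. Qed.

Lemma sum_e_shift (V : zmodType) (F : nat -> V) : F 4 = F 0%N ->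
  \sum_(i < 4) F i.+1 = \sum_(i < 4) F i.
Proof.
move=> F4; rewrite big_ord_recr [RHS]big_ord_recl /= F4 addrC.
by congr (_ + _); apply: eq_bigr => i _.
Qed.

Definition envL c : E := tens 1 (z c).
Definition envR c : E := tens (z c) 1.
(** As [tens a b] acts by $m\mapsto bma$, this projects a bimodule onto the sum of the pieces $e_i M
    e_{i+n}$; on $A$ it keeps the paths of length $n$ modulo 4. *)
Definition env_eps n : E := \sum_(i < 4) tens (e (i + n)) (e i).
Definition env_right (s : E) := exists a, s = tens a 1.

Let tensl b a := tens a b.
HB.instance Definition _ b := GRing.isLinear.Build K A E _ (tensl b) (tens_linl b).
HB.instance Definition _ a := GRing.isLinear.Build K A E _ (tens a) (tens_linr a).

Let tensZ c a b : tens a (c *: b) = tens (c *: a) b.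
Proof. by rewrite linearZ -[RHS]/(tensl b _) linearZ. Qed.

Lemma tens0r (a : A) : tens a 0 = 0 :> E. Proof. exact: linear0. Qed.
Lemma tens0l (a : A) : tens 0 a = 0 :> E. Proof. exact: (linear0 (tensl a)). Qed.

Lemma envLX c k : envL c ^+ k = tens 1 (z c ^+ k).
Proof.
elim: k => [|k IHk]; first by rewrite !expr0 tens11.
by rewrite !exprS IHk tensM mulr1.
Qed.

Lemma envRX c k : envR c ^+ k = tens (z c ^+ k) 1.
Proof.
elim: k => [|k IHk]; first by rewrite !expr0 tens11.
by rewrite exprS IHk tensM mulr1 exprSr.
Qed.

Lemma envLR c c' : envL c * envR c' = envR c' * envL c.
Proof. by rewrite !tensM !mulr1 !mul1r. Qed.

Lemma envLL c : envL c * envL (~~ c) = 0.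
Proof. by rewrite tensM cb_zz tens0r. Qed.

Lemma envRR c : envR c * envR (~~ c) = 0.
Proof. by rewrite tensM -{2}[c]negbK cb_zz tens0l. Qed.

Lemma envLN c : envL (~~ c) ^+ q.+1 = - envL c ^+ q.+1.
Proof. by rewrite !envLX cb_zN linearN. Qed.

Lemma envRN c : envR (~~ c) ^+ q.+1 = - envR c ^+ q.+1.
Proof. by rewrite !envRX cb_zN -!/(tensl 1 _) linearN. Qed.

Lemma env_eps_l n j : tens 1 (e j) * env_eps n = tens (e (j + n)) (e j).
Proof.
rewrite mulr_sumr (bigD1 (inord (j %% 4))) //= big1 ?addr0.
  rewrite tensM inordK ?ltn_mod // cb_e_mul modn_mod eqxx mulr1.
  by congr tens; apply: cb_e_mod; rewrite modnDml.
move=> i; rewrite -val_eqE /= inordK ?ltn_mod // => ij.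
rewrite tensM cb_e_mul; case: eqP => [Eij|_]; last by rewrite tens0r.
by move: ij; rewrite Eij modn_small ?eqxx.
Qed.

Lemma env_eps_r n j : tens (e (j + n)) 1 * env_eps n = tens (e (j + n)) (e j).
Proof.
rewrite mulr_sumr (bigD1 (inord (j %% 4))) //= big1 ?addr0.
  rewrite tensM inordK ?ltn_mod // cb_e_mul modnDml eqxx mul1r.
  by congr tens; apply: cb_e_mod; rewrite ?modnDml ?modn_mod.
move=> i; rewrite -val_eqE /= inordK ?ltn_mod // => ij.
rewrite tensM cb_e_mul; case: eqP => [Eij|_]; last by rewrite tens0l.
by move: ij Eij; have := ltn_ord i; move: (i : nat) => i' *; lia.
Qed.

Lemma env_eps_idem n : env_eps n * env_eps n = env_eps n.
Proof.
rewrite {1}/env_eps mulr_suml; apply: eq_bigr => i _.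
rewrite -{1}[e (i + n)]mul1r -[e i in LHS]mulr1.
have -> : tens (1 * e (i + n)) (e i * 1) = tens (e (i + n)) 1 * tens 1 (e i) :> E.
  by rewrite tensM !mul1r mulr1.
by rewrite -mulrA env_eps_l tensM mul1r cb_e_idem.
Qed.

Lemma env_epsL n c : env_eps n.+1 * envL c = envL c * env_eps n.
Proof.
rewrite /env_eps mulr_suml mulr_sumr.
pose F i := tens (e (i + n)) (z c * e i) : E.
transitivity (\sum_(i < 4) F i.+1).
  by apply: eq_bigr => i _; rewrite tensM mul1r cb_ez /F addnS.
rewrite sum_e_shift; first by apply: eq_bigr => i _; rewrite tensM mulr1.
by rewrite /F; congr (tens _ (_ * _)); apply: cb_e_mod; lia.
Qed.

Lemma env_epsR n c : env_eps n.+1 * envR c = envR c * env_eps n.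
Proof.
rewrite /env_eps mulr_suml mulr_sumr; apply: eq_bigr => i _.
by rewrite !tensM mul1r mulr1 addnS cb_ez.
Qed.

Lemma env_eps_per n : env_eps (n + q) = env_eps n.+1.
Proof.
apply: eq_bigr => i _; congr tens; apply: cb_e_mod.
by have := cb_q B; lia.
Qed.

Lemma env_span n (U : E -> Prop) :
  (forall u v, U u -> U v -> U (u + v)) ->
  (forall s u, env_right s -> U u -> U (s * u)) ->
  (forall c k, (k <= q.+1)%N -> U (envL c ^+ k * env_eps n)) ->
  forall u, U (u * env_eps n).
Proof.
move=> UD US UL; apply: tens_ind => [u v|a b]; first by rewrite mulrDl; exact: UD.
elim/(@cb_span _ _ _ B): b a => [b b' bP b'P|c b bP|i c k kq] a.
- by rewrite linearD mulrDl; apply: UD; [exact: bP | exact: b'P].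
- by rewrite tensZ; exact: bP.
(* Against [env_eps n] the idempotent [e (i + k)] of the left factor can be replaced by
   [e (i + k + n)] in the right factor, where [env_right] takes it up. *)
have -> : tens a (e i * z c ^+ k) * env_eps n =
    tens (e (i + k + n) * a) 1 * (envL c ^+ k * env_eps n).
  rewrite cb_ezX envLX [RHS]mulrA tensM !mul1r.
  have -> : tens a (z c ^+ k * e (i + k)) = tens a (z c ^+ k) * tens 1 (e (i + k)) :> E.
    by rewrite tensM mul1r.
  have -> : tens (e (i + k + n) * a) (z c ^+ k) =
      tens a (z c ^+ k) * tens (e (i + k + n)) 1 :> E by rewrite tensM mulr1.
  by rewrite -[LHS]mulrA -[RHS]mulrA env_eps_l env_eps_r.
by apply: US; [exists (e (i + k + n) * a) | exact: UL].
Qed.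

(** Extracts the part of [b] that is a multiple of [z c ^+ k] and cancels this power on the left: as
    [e i * z c ^+ k = z c ^+ k * e (i + k)], what remains is [e (i + k)]. *)
Definition coef_proj c k (b : A) : A := \sum_(i < 4) (cf c k i b : K) *: e (i + k).

Fact coef_proj_linear c k : linear (coef_proj c k).
Proof.
move=> a b b'; rewrite /coef_proj scaler_sumr -big_split; apply: eq_bigr => i _ /=.
by rewrite linearP scalerDl scalerA.
Qed.

HB.instance Definition _ c k := GRing.isLinear.Build K A A _ (coef_proj c k)
  (@coef_proj_linear c k).

Lemma coef_proj_linl c k b : linear (fun a => tens a (coef_proj c k b) : E).
Proof. exact: tens_linl. Qed.

Lemma coef_proj_linr c k a : linear (fun b => tens a (coef_proj c k b) : E).
Proof. by move=> x b b'; rewrite [coef_proj c k _]linearP tens_linr. Qed.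

Definition env_kappa c k : {linear E -> E} :=
  sval (cid (tens_lift (coef_proj_linl c k) (coef_proj_linr c k))).

Lemma env_kappaE c k a b : env_kappa c k (tens a b) = tens a (coef_proj c k b).
Proof. exact: (svalP (cid (tens_lift (coef_proj_linl c k) (coef_proj_linr c k)))). Qed.

Lemma env_kappaS c k s u : env_right s -> env_kappa c k (s * u) = s * env_kappa c k u.
Proof.
case=> a ->; elim/tens_ind: u => [u v uP vP|a' b].
  by rewrite mulrDr !linearD mulrDr uP vP.
by rewrite tensM !env_kappaE tensM !mul1r.
Qed.

Lemma env_kappa_same n c k j : (j <= q.+1)%N -> (0 < k <= q.+1)%N ->
  env_kappa c k (envL c ^+ j * env_eps n) = if j == k then env_eps n else 0.
Proof.
move=> jq /andP[_ kq]; rewrite envLX mulr_sumr linear_sum.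
have termE (i : 'I_4) : env_kappa c k (tens 1 (z c ^+ j) * tens (e (i + n)) (e i)) =
    if j == k then tens (e (i + n)) (e i) else 0.
  rewrite tensM mulr1 env_kappaE cb_zeX /coef_proj.
  case: (j =P k) => [->|/eqP/negPf jk]; last first.
    by rewrite big1 ?tens0r // => l _; rewrite cb_cf_same // jk scale0r.
  rewrite (bigD1 (inord ((i + 3 * k) %% 4))) //= big1 ?addr0; last first.
    move=> l; rewrite -val_eqE /= inordK ?ltn_mod // => lik.
    rewrite cb_cf_same // eqxx /=; case: eqP => [Eij|_]; last by rewrite scale0r.
    by move: lik; rewrite -Eij modn_small ?eqxx.
  rewrite cb_cf_same // inordK ?ltn_mod // modn_mod !eqxx scale1r.
  by congr tens; apply: cb_e_mod; lia.
under eq_bigr do rewrite termE.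
by case: ifP => // _; rewrite big1.
Qed.

Lemma env_kappa_other n c k j : (j <= q)%N -> (0 < k <= q.+1)%N ->
  env_kappa c k (envL (~~ c) ^+ j * env_eps n) = 0.
Proof.
move=> jq kq; rewrite envLX mulr_sumr linear_sum big1 // => i _.
rewrite tensM mulr1 env_kappaE cb_zeX /coef_proj big1 ?tens0r // => l _.
by rewrite cb_cf_other ?scale0r //; move: kq; lia.
Qed.

(** Contracting the second factor with the sum of the idempotent coefficients sends
    [tens a 1 * env_eps n] to [a] multiplied by the sum of all vertex idempotents, that is, to
    [a]. *)
Lemma env_right_inj n s : env_right s -> s * env_eps n = 0 -> s = 0.
Proof.
case=> a ->; pose f (a b : A) : A := (\sum_(i < 4) (cf false 0 i b : K)) *: a.
have fl b : linear (f^~ b) by move=> x a1 a2; rewrite /f scalerDr !scalerA mulrC.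
have fr a1 : linear (f a1).
  move=> x b1 b2; rewrite /f scalerA -scalerDl mulr_sumr -big_split; congr (_ *: _).
  by apply: eq_bigr => i _; rewrite linearP.
have [F FE] := tens_lift fl fr.
move=> /(congr1 F); rewrite linear0 mulr_sumr linear_sum /=.
have fE (i : 'I_4) : F (tens a 1 * tens (e (i + n)) (e i)) = e (i + n) * a.
  rewrite tensM mul1r FE /f (bigD1 i) //= big1 ?addr0.
    by rewrite -[e i]mulr1 -(expr0 (z false)) cb_cf_same // !eqxx scale1r.
  move=> j; rewrite -val_eqE /= => ji; rewrite -[e i]mulr1 -(expr0 (z false)) cb_cf_same //=.
  by rewrite !modn_small // (negPf ji).
under eq_bigr do rewrite fE.
rewrite -mulr_suml.
have -> : \sum_(i < 4) e (i + n) = 1.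
  elim: (n) => [|m IHm]; first by rewrite -(cb_e_sum B); apply: eq_bigr => i _; rewrite addn0.
  rewrite -IHm; transitivity (\sum_(i < 4) (fun i => e (i + m)) i.+1).
    by apply: eq_bigr => i _; rewrite addnS.
  by apply: (sum_e_shift (F := fun i => e (i + m))); rewrite addnC cb_e_per.
by rewrite mul1r => ->; rewrite tens0l.
Qed.

Let right0 : env_right 0. Proof. by exists 0; rewrite tens0l. Qed.
Let right1 : env_right 1. Proof. by exists 1; rewrite tens11. Qed.
Let rightN s : env_right s -> env_right (- s).
Proof. by case=> a ->; exists (- a); rewrite -!/(tensl 1 _) linearN. Qed.
Let rightD s t : env_right s -> env_right t -> env_right (s + t).
Proof. by case=> a -> [b ->]; exists (a + b); rewrite -!/(tensl 1 _) linearD. Qed.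
Let rightM s t : env_right s -> env_right t -> env_right (s * t).
Proof. by case=> a -> [b ->]; exists (b * a); rewrite tensM mulr1. Qed.
Let rightR c : env_right (envR c). Proof. by exists (z c). Qed.
Let rightL s c : env_right s -> s * envL c = envL c * s.
Proof. by case=> a ->; rewrite !tensM !mulr1 !mul1r. Qed.

Variables (X : lmodType E) (x0 : X).
Hypothesis tens_aug : forall a, tens a 1 *: x0 = 0 -> a = 0.
Hypothesis tens_x0 : forall a, tens 1 a *: x0 = tens a 1 *: x0.
Hypothesis tens_gen : forall y, exists a, tens 1 a *: x0 = y.

Let aug s : env_right s -> s *: x0 = 0 -> s = 0.
Proof. by case=> a -> /tens_aug->; rewrite tens0l. Qed.

Let x0_LR c : envL c *: x0 = envR c *: x0. Proof. exact: tens_x0. Qed.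

Let x0_eps : env_eps 0 *: x0 = x0.
Proof.
transitivity (\sum_(i < 4) tens 1 (e i) *: x0); last first.
  by rewrite -scaler_suml -linear_sum cb_e_sum /= tens11 scale1r.
rewrite scaler_suml; apply: eq_bigr => i _.
have -> : tens (e (i + 0)) (e i) = tens (e i) 1 * tens 1 (e i).
  by rewrite tensM !mul1r addn0.
by rewrite -scalerA tens_x0 scalerA tensM cb_e_idem mul1r.
Qed.

Let x0_gen y : exists u, u *: x0 = y.
Proof. by have [a <-] := tens_gen y; exists (tens 1 a). Qed.

Definition tensor_resolution : proj_resolution X :=
  truncated_resolution envLR envLL envRR envLN envRN q_gt0 env_eps_idem env_epsL env_epsR
    env_eps_per rightL right0 right1 rightN rightD rightM rightR env_span
    env_kappaS env_kappa_same env_kappa_other env_right_inj aug x0_LR x0_eps x0_gen.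

End TensorResolution.

(** * Cochains with values in the algebra *)

Section Coefficients.
Variables (K : fieldType) (A : algType K) (q : nat) (B : covering_basis A q).
Local Notation z := (cb_z B).
Local Notation e := (cb_e B).
Local Notation cf := (cb_cf B).

Let q_gt0 : (0 < q)%N. Proof. by have := cb_q B; lia. Qed.

Lemma cb_lin_ext (V : lmodType K) (f g : {linear A -> V}) :
  (forall i c k, (k <= q.+1)%N -> f (e i * z c ^+ k) = g (e i * z c ^+ k)) -> f =1 g.
Proof.
move=> fg; apply: (@cb_span _ _ _ B (fun a => f a = g a)) => [a b fa fb|c a fa|//].
  by rewrite !linearD fa fb.
by rewrite !linearZ fa.
Qed.

Lemma cb_zN' c : z c ^+ q.+1 = - z (~~ c) ^+ q.+1.
Proof. by rewrite cb_zN opprK. Qed.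

Lemma cb_zXX c i j : (0 < i)%N -> (0 < j)%N -> z c ^+ i * z (~~ c) ^+ j = 0.
Proof.
by case: i j => [|i] [|j] // _ _; rewrite exprSr exprS -mulrA [z c * _]mulrA cb_zz mul0r mulr0.
Qed.

(** The top power is minus that of the other letter, and one more factor [z c] kills it. *)
Lemma cb_z_top c : z c ^+ q.+2 = 0.
Proof. by rewrite exprS cb_zN' mulrN -{1}[z c]expr1 cb_zXX // oppr0. Qed.

Lemma cf_off c k i j l : (k <= q)%N -> (0 < l <= q.+1)%N -> cf c k i (e j * z (~~ c) ^+ l) = 0.
Proof.
move=> kq /andP[l0]; rewrite leq_eqVlt => /orP[/eqP->|lq].
  rewrite cb_zN mulrN linearN /= cb_cf_same ?leqnn //; last exact: leqW.
  by rewrite eq_sym ltn_eqF ?oppr0.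
by rewrite cb_cf_other // ?(leqW kq) // addn_gt0 l0 orbT.
Qed.

Lemma cf_mod c k i j : (k <= q.+1)%N -> i = j %[mod 4] -> cf c k i =1 cf c k j.
Proof.
move=> kq ij; apply: cb_lin_ext => l c' p pq.
have [->|] := eqVneq c' c; first by rewrite !cb_cf_same // ij.
move=> cc; have -> : c' = ~~ c by case: c c' cc => [] [].
have [->|p0] := posnP p; first by rewrite !expr0 -(expr0 (z c)) !cb_cf_same // ij.
move: kq; rewrite leq_eqVlt => /orP[/eqP->|kq]; last by rewrite !cf_off // p0.
move: pq; rewrite leq_eqVlt => /orP[/eqP->|pq]; last by rewrite !cb_cf_other.
by rewrite cb_zN mulrN !linearN /= !cb_cf_same // ij.
Qed.

Lemma cf0 i a : cf true 0 i a = cf false 0 i a.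
Proof.
apply: cb_lin_ext => j c p pq; case: p pq => [|p] pq.
  by rewrite expr0 -{1}(expr0 (z true)) -(expr0 (z false)) !cb_cf_same.
by case: c; rewrite cb_cf_same // ?[RHS](@cf_off false) ?[LHS](@cf_off true) // cb_cf_same.
Qed.

Lemma cf_top c i a : cf (~~ c) q.+1 i a = - cf c q.+1 i a.
Proof.
have H b j p : (p <= q.+1)%N ->
    cf (~~ b) q.+1 i (e j * z b ^+ p) = - cf b q.+1 i (e j * z b ^+ p).
  rewrite leq_eqVlt => /orP[/eqP->|pq].
    by rewrite {1}cb_zN' mulrN linearN /= !cb_cf_same.
  rewrite [in RHS]cb_cf_same ?(ltn_eqF pq) //= ?oppr0; last exact: ltnW.
  by have := @cb_cf_other _ _ _ B (~~ b) q.+1 i j p; rewrite negbK; apply.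
pose g : {linear A -> K^o} := -%R \o cf c q.+1 i.
apply: (cb_lin_ext (g := g)) => j c' p pq; rewrite /g /=.
have [->|cc] := eqVneq c' c; first exact: H.
have -> : c' = ~~ c by case: c c' cc {g} => [] [].
by have := H (~~ c) j p pq; rewrite negbK => ->; rewrite opprK.
Qed.

Let mull (x a : A) := x * a.
Let mulr (x a : A) := a * x.
Let mull_linear x : linear (mull x).
Proof. by move=> c a b; rewrite /mull mulrDr scalerAr. Qed.
Let mulr_linear x : linear (mulr x).
Proof. by move=> c a b; rewrite /mulr mulrDl scalerAl. Qed.
HB.instance Definition _ x := GRing.isLinear.Build K A A _ (mull x) (mull_linear x).
HB.instance Definition _ x := GRing.isLinear.Build K A A _ (mulr x) (mulr_linear x).

(** A letter on the left moves the start of a path back by one vertex, hence [i.+1] on the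
    right-hand side; a letter on the right leaves the start alone, so [cf_zr] has no shift. *)
Lemma cf_zl c k i a : (k <= q)%N -> cf c k.+1 i (z c * a) = cf c k i.+1 a.
Proof.
move=> kq; pose g : {linear A -> K^o} := cf c k.+1 i \o mull (z c).
have ze j : z c * e j = e (j + 3) * z c by have := cb_zeX B j c 1; rewrite expr1.
apply: (cb_lin_ext (f := g)) => j c' p pq; rewrite /g /= /mull mulrA ze -mulrA.
have kq1 : (k <= q.+1)%N by exact: leqW.
have ij : (i == j + 3 %[mod 4]) = (i.+1 == j %[mod 4]) by apply/eqP/eqP; lia.
have same l : (l <= q.+1)%N -> cf c k.+1 i (e (j + 3) * (z c * z c ^+ l)) =
    cf c k i.+1 (e j * z c ^+ l).
  rewrite -exprS leq_eqVlt => /orP[/eqP->|lq].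
    by rewrite cb_z_top mulr0 linear0 cb_cf_same // eq_sym (ltn_eqF (kq : (k < q.+1)%N)).
  by rewrite !cb_cf_same // ?(ltnW lq) // eqSS ij.
have [->|cc] := eqVneq c' c; first exact: same.
have -> : c' = ~~ c by case: c c' cc {g ze same} => [] [].
case: p pq => [|p] pq; first by rewrite expr0 -(expr0 (z c)) same.
by rewrite -{1}[z c]expr1 cb_zXX // mulr0 linear0 cf_off.
Qed.

Lemma cf_zr c k i a : (k <= q)%N -> cf c k.+1 i (a * z c) = cf c k i a.
Proof.
move=> kq; pose g : {linear A -> K^o} := cf c k.+1 i \o mulr (z c).
apply: (cb_lin_ext (f := g)) => j c' p pq; rewrite /g /= /mulr -mulrA.
have kq1 : (k <= q.+1)%N by exact: leqW.
have same l : (l <= q.+1)%N -> cf c k.+1 i (e j * (z c ^+ l * z c)) =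
    cf c k i (e j * z c ^+ l).
  rewrite -exprSr leq_eqVlt => /orP[/eqP->|lq].
    by rewrite cb_z_top mulr0 linear0 cb_cf_same // eq_sym (ltn_eqF (kq : (k < q.+1)%N)).
  by rewrite !cb_cf_same // ?(ltnW lq) // eqSS.
have [->|cc] := eqVneq c' c; first exact: same.
have -> : c' = ~~ c by case: c c' cc {g same} => [] [].
case: p pq => [|p] pq; first by rewrite expr0 -(expr0 (z c)) same.
have := cb_zXX (~~ c) (ltn0Sn p) (ltn0Sn 0); rewrite negbK expr1 => ->.
by rewrite mulr0 linear0 cf_off.
Qed.

Lemma cf_zl_off c k i a : (k <= q)%N -> cf c k i (z (~~ c) * a) = 0.
Proof.
move=> kq; pose g : {linear A -> K^o} := cf c k i \o mull (z (~~ c)).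
have ze j : z (~~ c) * e j = e (j + 3) * z (~~ c) by have := cb_zeX B j (~~ c) 1; rewrite expr1.
apply: (cb_lin_ext (f := g) (g := \0)) => j c' p pq; rewrite /g /= /mull mulrA ze -mulrA.
have same l : (l <= q.+1)%N -> cf c k i (e (j + 3) * (z (~~ c) * z (~~ c) ^+ l)) = 0.
  rewrite -exprS leq_eqVlt => /orP[/eqP->|lq]; last by rewrite cf_off.
  by rewrite cb_z_top mulr0 linear0.
have [cc|cc] := eqVneq c' c; last first.
  have -> : c' = ~~ c by case: c c' cc {g ze same} => [] [].
  exact: same.
rewrite cc; case: p pq => [|p] pq; first by rewrite expr0 -(expr0 (z (~~ c))) same.
have := cb_zXX (~~ c) (ltn0Sn 0) (ltn0Sn p); rewrite negbK expr1 => ->.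
by rewrite mulr0 linear0.
Qed.

Lemma cf_zr_off c k i a : (k <= q)%N -> cf c k i (a * z (~~ c)) = 0.
Proof.
move=> kq; pose g : {linear A -> K^o} := cf c k i \o mulr (z (~~ c)).
apply: (cb_lin_ext (f := g) (g := \0)) => j c' p pq; rewrite /g /= /mulr -mulrA.
have same l : (l <= q.+1)%N -> cf c k i (e j * (z (~~ c) ^+ l * z (~~ c))) = 0.
  rewrite -exprSr leq_eqVlt => /orP[/eqP->|lq]; last by rewrite cf_off.
  by rewrite cb_z_top mulr0 linear0.
have [cc|cc] := eqVneq c' c; last first.
  have -> : c' = ~~ c by case: c c' cc {g same} => [] [].
  exact: same.
rewrite cc; case: p pq => [|p] pq; first by rewrite expr0 -(expr0 (z (~~ c))) same.
have := cb_zXX c (ltn0Sn p) (ltn0Sn 0); rewrite expr1 => ->.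
by rewrite mulr0 linear0.
Qed.

Let cf0' c i a : cf (~~ c) 0 i a = cf c 0 i a.
Proof. by case: c; rewrite cf0. Qed.

Lemma cf_zl0 c c' i a : cf c 0 i (z c' * a) = 0.
Proof.
have [->|cc] := eqVneq c' c; first by rewrite -cf0' -{2}[c]negbK cf_zl_off.
have -> : c' = ~~ c by case: c c' cc => [] [].
exact: cf_zl_off.
Qed.

Lemma cf_zr0 c c' i a : cf c 0 i (a * z c') = 0.
Proof.
have [->|cc] := eqVneq c' c; first by rewrite -cf0' -{2}[c]negbK cf_zr_off.
have -> : c' = ~~ c by case: c c' cc => [] [].
exact: cf_zr_off.
Qed.

Lemma cf_zlX c p k i a : (k + p <= q.+1)%N -> cf c (k + p) i (z c ^+ p * a) = cf c k (i + p) a.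
Proof.
elim: p i => [|p IHp] i kp; first by rewrite !addn0 mul1r.
rewrite addnS exprS -mulrA cf_zl; last by move: kp; lia.
by rewrite IHp ?addSnnS //; move: kp; lia.
Qed.

Lemma cf_zrX c p k i a : (k + p <= q.+1)%N -> cf c (k + p) i (a * z c ^+ p) = cf c k i a.
Proof.
elim: p => [|p IHp] kp; first by rewrite !addn0 mulr1.
rewrite addnS exprSr mulrA cf_zr; last by move: kp; lia.
by rewrite IHp //; move: kp; lia.
Qed.

Lemma cf_zlX_lt c p k i a : (k < p)%N -> (k <= q)%N -> cf c k i (z c ^+ p * a) = 0.
Proof.
move=> kp kq; rewrite -(subnKC (ltnW kp)) exprD -mulrA -[k in cf c k]add0n cf_zlX ?add0n ?leqW //.
by move: (p - k)%N (subn_gt0 k p) => [|d]; rewrite ?kp // => _; rewrite exprS -mulrA cf_zl0.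
Qed.

Lemma cf_zrX_lt c p k i a : (k < p)%N -> (k <= q)%N -> cf c k i (a * z c ^+ p) = 0.
Proof.
move=> kp kq; rewrite -(subnKC (ltnW kp)) addnC exprD mulrA -[k in cf c k]add0n cf_zrX ?add0n ?leqW //.
by move: (p - k)%N (subn_gt0 k p) => [|d]; rewrite ?kp // => _; rewrite exprSr mulrA cf_zr0.
Qed.

Lemma cf_neq c k i j c' p : (k <= q.+1)%N -> (p <= q.+1)%N -> k != p ->
  cf c k i (e j * z c' ^+ p) = 0.
Proof.
move=> kq pq kp; have [->|cc] := eqVneq c' c.
  by rewrite cb_cf_same // eq_sym (negPf kp).
have -> : c' = ~~ c by case: c c' cc => [] [].
move: kq; rewrite leq_eqVlt => /orP[/eqP kq|kq].
  by rewrite cb_cf_other ?kq //; move: kp pq; rewrite kq; lia.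
move: pq; rewrite leq_eqVlt => /orP[/eqP->|pq].
  by rewrite cb_zN mulrN linearN /= cb_cf_same ?(ltnW kq) // eq_sym (ltn_eqF kq) oppr0.
by rewrite cb_cf_other ?(ltnW kq) //; move: kp; lia.
Qed.

(** The indices [k < q.+1.*2] number the basis at one vertex: $x^0,\dots,x^{q+1}$, then
    $y^1,\dots,y^q$. The powers $y^0$ and $y^{q+1}$ are left out because they repeat $x^0$ and
    $-x^{q+1}$. *)
Definition mono_letter (k : nat) := (q.+1 < k)%N.
Definition mono_length (k : nat) := if (q.+1 < k)%N then (k - q.+1)%N else k.
Definition mono i k : A := e i * z (mono_letter k) ^+ mono_length k.

Lemma mono_length_le k : (k < q.+1.*2)%N -> (mono_length k <= q.+1)%N.
Proof. by rewrite /mono_length; case: ifP; lia. Qed.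

Lemma cf_mono i k j l : (k < q.+1.*2)%N -> (l < q.+1.*2)%N ->
  cf (mono_letter k) (mono_length k) i (mono j l) = ((k == l) && (i == j %[mod 4]))%:R.
Proof.
move=> kq lq; have k1 := mono_length_le kq; have l1 := mono_length_le lq.
rewrite /mono; have [kl|kl] := eqVneq k l; first by rewrite kl cb_cf_same ?eqxx.
have [ll|ll] := eqVneq (mono_length k) (mono_length l); last first.
  by rewrite cf_neq.
have lN : mono_letter l = ~~ mono_letter k.
  by move: ll kl kq lq; rewrite /mono_letter /mono_length; case: (ltnP q.+1 k); case: (ltnP q.+1 l) => //=; lia.
rewrite lN cb_cf_other //; move: ll kl kq lq;
  by rewrite /mono_letter /mono_length; case: (ltnP q.+1 k); case: (ltnP q.+1 l) => //=; lia.
Qed.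

Lemma cb_expand a : a = \sum_(i < 4) \sum_(k < q.+1.*2)
  (cf (mono_letter k) (mono_length k) i a : K) *: mono i k.
Proof.
have base j l : (l < q.+1.*2)%N -> mono j l = \sum_(i < 4) \sum_(k < q.+1.*2)
    (cf (mono_letter k) (mono_length k) i (mono j l) : K) *: mono i k.
  move=> lq; rewrite (bigD1 (inord (j %% 4)%N)) //= [X in _ + X]big1 ?addr0; last first.
    move=> i; rewrite -val_eqE /= inordK ?ltn_mod // => ij.
    rewrite big1 // => k _; rewrite cf_mono //.
    by rewrite (modn_small (ltn_ord i)) (negPf ij) andbF scale0r.
  rewrite (bigD1 (Ordinal lq)) //= big1 ?addr0; last first.
    by move=> k; rewrite -val_eqE /= => kl; rewrite cf_mono // (negPf kl) scale0r.
  rewrite cf_mono // inordK ?ltn_mod // modn_mod !eqxx scale1r /mono.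
  by rewrite (cb_e_mod B (i := (j %% 4)%N) (j := j)) ?modn_mod.
apply: (@cb_span _ _ _ B (fun a => a = \sum_(i < 4) \sum_(k < q.+1.*2)
  (cf (mono_letter k) (mono_length k) i a : K) *: mono i k)).
- move=> b d bP dP; rewrite {1}bP {1}dP -big_split; apply: eq_bigr => i _.
  by rewrite -big_split; apply: eq_bigr => k _ /=; rewrite linearD scalerDl.
- move=> x b bP; rewrite {1}bP scaler_sumr; apply: eq_bigr => i _.
  by rewrite scaler_sumr; apply: eq_bigr => k _; rewrite scalerA linearZ.
move=> j c p pq.
have P0 : e j * z false ^+ p = mono j p.
  by rewrite /mono /mono_letter /mono_length ltnNge pq.
case: c; last by rewrite P0; apply: base; lia.
have [->|p0] := posnP p.
  have -> : e j * z true ^+ 0 = mono j 0 by rewrite /mono /mono_length !expr0.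
  exact: base.
move: pq; rewrite leq_eqVlt => /orP[/eqP p1|pq].
  have P1 : e j * z false ^+ q.+1 = mono j q.+1 by rewrite /mono /mono_letter /mono_length ltnn.
  rewrite p1 cb_zN' /= mulrN P1 {1}base; last by lia.
  rewrite -sumrN; apply: eq_bigr => i _; rewrite -sumrN; apply: eq_bigr => k _.
  by rewrite linearN scaleNr.
have -> : e j * z true ^+ p = mono j (q.+1 + p).
  rewrite /mono /mono_letter /mono_length.
  have -> : (q.+1 < q.+1 + p)%N by lia.
  by rewrite addKn.
by apply: base; lia.
Qed.

Lemma cf_eq0 a : (forall c k i, (k <= q.+1)%N -> cf c k i a = 0) -> a = 0.
Proof.
move=> a0; rewrite (cb_expand a) big1 // => i _; rewrite big1 // => k _.
by rewrite a0 ?scale0r // mono_length_le.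
Qed.

(* The component of a in the spaces e_i A e_(i + n). *)
Lemma cf_homogeneous c k i n a : (k <= q.+1)%N ->
  cf c k i (\sum_(j < 4) e j * a * e (j + n)) = if k == n %[mod 4] then cf c k i a else 0.
Proof.
move=> kq; pose h a := \sum_(j < 4) e j * a * e (j + n).
have h_lin : linear h.
  move=> x b d; rewrite /h scaler_sumr -big_split; apply: eq_bigr => j _ /=.
  by rewrite mulrDr mulrDl -scalerAr -scalerAl.
pose H : {linear A -> A} := HB.pack h (GRing.isLinear.Build K A A _ h h_lin).
have hE l c' p : h (e l * z c' ^+ p) = if p == n %[mod 4] then e l * z c' ^+ p else 0.
  have -> : h (e l * z c' ^+ p) = e l * z c' ^+ p * e (l + n).
    rewrite /h (bigD1 (inord (l %% 4)%N)) //= big1 ?addr0.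
      rewrite inordK ?ltn_mod // mulrA cb_e_mul modn_mod eqxx.
      rewrite (cb_e_mod B (i := (l %% 4)%N) (j := l)) ?modn_mod //; congr (_ * _).
      by apply: cb_e_mod; rewrite modnDml.
    move=> j; rewrite -val_eqE /= inordK ?ltn_mod // => jl.
    rewrite mulrA cb_e_mul; case: eqP => [jl'|_]; last by rewrite !mul0r.
    by move: jl; rewrite -jl' modn_small ?eqxx.
  rewrite -mulrA cb_zeX mulrA cb_e_mul.
  have -> : (l == l + n + 3 * p %[mod 4]) = (p == n %[mod 4]) by apply/eqP/eqP; lia.
  by case: eqP => // _; rewrite mul0r.
case: eqP => kn.
  apply: (cb_lin_ext (f := cf c k i \o H)) => l c' p pq; rewrite /= hE.
  case: eqP => // pn; rewrite linear0 cf_neq //.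
  by apply/eqP => kp; apply: pn; rewrite -kp.
apply: (cb_lin_ext (f := cf c k i \o H) (g := \0)) => l c' p pq; rewrite /= hE.
case: eqP => pn; last exact: linear0.
by rewrite cf_neq //; apply/eqP => kp; apply: kn; rewrite kp.
Qed.

Definition delta_alg (phi : bool -> nat -> A) (c : bool) (m : nat) : A :=
  if m is m'.+1 then
    z c * phi (~~ c) m' + (-1) ^+ m *: (phi c m' * z (last_letter c m)) +
    (z (~~ c) ^+ q * phi (~~ c) m.+1 +
     (-1) ^+ m *: (phi c m.+1 * z (last_letter c m.+1) ^+ q))
  else \sum_(b : bool) \sum_(a < q.+1) z b ^+ a * phi b 1%N * z b ^+ (q - a).

Lemma cf_zlX0 c c' p i a : (0 < p)%N -> cf c 0 i (z c' ^+ p * a) = 0.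
Proof. by case: p => // p _; rewrite exprS -mulrA cf_zl0. Qed.

Lemma cf_zrX0 c c' p i a : (0 < p)%N -> cf c 0 i (a * z c' ^+ p) = 0.
Proof. by case: p => // p _; rewrite exprSr mulrA cf_zr0. Qed.

Lemma cf_zl_ne c c' k i a : (k <= q)%N -> c' != c -> cf c' k i (z c * a) = 0.
Proof.
by move=> kq cc; have -> : c = ~~ c' by [case: c c' cc => [] []]; exact: cf_zl_off.
Qed.

Lemma cf_zr_ne c c' k i a : (k <= q)%N -> c' != c -> cf c' k i (a * z c) = 0.
Proof.
by move=> kq cc; have -> : c = ~~ c' by [case: c c' cc => [] []]; exact: cf_zr_off.
Qed.

Lemma cf_zlX_ne c c' p k i a : (k <= q)%N -> (0 < p)%N -> c' != c ->
  cf c' k i (z c ^+ p * a) = 0.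
Proof. by case: p => // p kq _ cc; rewrite exprS -mulrA cf_zl_ne. Qed.

Lemma cf_zrX_ne c c' p k i a : (k <= q)%N -> (0 < p)%N -> c' != c ->
  cf c' k i (a * z c ^+ p) = 0.
Proof. by case: p => // p kq _ cc; rewrite exprSr mulrA cf_zr_ne. Qed.

Lemma cf_shift c k i a : (k <= q.+1)%N -> cf c k (i + q) a = cf c k i.+1 a.
Proof. by move=> kq; apply: cf_mod => //; have := cb_q B; lia. Qed.

Lemma cf_zlq c i a : cf c q i (z c ^+ q * a) = cf c 0 i.+1 a.
Proof. by rewrite -cf_shift // -(@cf_zlX c q 0) ?add0n. Qed.

Lemma cf_zrq c i a : cf c q i (a * z c ^+ q) = cf c 0 i a.
Proof. by rewrite -(@cf_zrX c q 0) ?add0n. Qed.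

Lemma cf_zlq1 c i a : cf c q.+1 i (z c ^+ q * a) = cf c 1 i.+1 a.
Proof. by rewrite -cf_shift // -(@cf_zlX c q 1) ?add1n. Qed.

Lemma cf_zrq1 c i a : cf c q.+1 i (a * z c ^+ q) = cf c 1 i a.
Proof. by rewrite -(@cf_zrX c q 1) ?add1n. Qed.

Lemma cf_top' c i a : cf c q.+1 i a = - cf (~~ c) q.+1 i a.
Proof. by rewrite cf_top opprK. Qed.

Section DegreeN.
Variables (n : nat) (phi : bool -> nat -> A).
Hypothesis phi_parity : forall c m, odd (n + m) -> phi c m = 0.
Hypothesis phi_degree : forall c m c' k i, (k <= q.+1)%N -> k != n %[mod 4] ->
  cf c' k i (phi c m) = 0.

Let q_mod : (q %% 4 = 1)%N := cb_q B.

Let phi_odd c m : odd n = ~~ odd m -> phi c m = 0.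
Proof. by move=> nm; apply: phi_parity; rewrite oddD nm; case: (odd m). Qed.

Let phi_deg c m c' k i : (k <= q.+1)%N -> odd n = ~~ odd k -> cf c' k i (phi c m) = 0.
Proof. by move=> kq nk; apply: phi_degree => //; apply/eqP; lia. Qed.

Let q_odd : odd q. Proof. by lia. Qed.

(** Only words of even length and even exponents occur. On such words the Koszul part is a twisted
    commutator with one letter, and its coefficients are these equations. The [q]-th powers see only
    exponents 0 and 1: exponent 0 repeats the equation for [k = 0], exponent 1 is absent by
    parity. *)
Lemma delta_alg_even : ~~ odd n ->
  (forall c m, delta_alg phi c m = 0) <->
  (forall c m k i, (k < q)%N -> cf c k i.+1 (phi (~~ c) m) = cf c k i (phi c m)).
Proof.
move=> n_even; have nE : odd n = false by exact: negPf.
have cne c : ~~ c != c by case: c.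
have cne' c : c != ~~ c by case: c.
split=> [d0 c m k i kq|H c m].
  have kq' := ltnW kq.
  case m_odd: (odd m); first by rewrite !phi_odd ?linear0 // nE m_odd.
  have := congr1 (cf c k.+1 i) (d0 c m.+1).
  rewrite /delta_alg /last_letter /= m_odd /= linear0 !linearD !linearZ /=.
  rewrite cf_zl // cf_zr // cf_zlX_ne // cf_zrX_ne // scaler0 !addr0.
  by rewrite exprS -signr_odd m_odd mulr1 scaleN1r => /eqP; rewrite subr_eq0 => /eqP.
case: m => [|m] /=.
  rewrite big1 // => b _; rewrite big1 // => a _.
  by rewrite phi_odd ?mulr0 ?mul0r // nE.
case m_odd: (odd m).
  by rewrite !(@phi_odd _ m) ?(@phi_odd _ m.+2) ?(mulr0, mul0r, scaler0, addr0) //= nE m_odd.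
have sg : (-1) ^+ m.+1 = -1 :> K by rewrite exprS -signr_odd m_odd mulr1.
rewrite /last_letter /= m_odd /= sg !scaleN1r.
apply: cf_eq0 => c' k i; rewrite leq_eqVlt => /orP[/eqP->|]; last first.
  rewrite ltnS => kq; rewrite !(linearD, linearN) /=.
  case: k kq => [|k] kq.
    by rewrite cf_zl0 cf_zr0 cf_zlX0 // cf_zrX0 // !oppr0 !addr0.
  have [->|cc] := eqVneq c' c.
    by rewrite cf_zl ?(ltnW kq) // cf_zr ?(ltnW kq) // H // cf_zlX_ne // cf_zrX_ne // subr0 subrr addr0.
  have -> : c' = ~~ c by case: c c' cc {sg} => [] [].
  rewrite cf_zl_ne // cf_zr_ne // subr0 add0r.
  move: kq; rewrite leq_eqVlt => /orP[/eqP->|kq].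
    by rewrite cf_zlq cf_zrq !cf0' H // subrr.
  by rewrite cf_zlX_lt // ?cf_zrX_lt ?subr0 // ltnW.
suff top i' : cf c q.+1 i' (z c * phi (~~ c) m - phi c m * z c +
    (z (~~ c) ^+ q * phi (~~ c) m.+2 - phi c m.+2 * z (~~ c) ^+ q)) = 0.
  have [->|cc] := eqVneq c' c; first exact: top.
  have -> : c' = ~~ c by case: c c' cc {sg top} => [] [].
  by rewrite cf_top top oppr0.
rewrite !(linearD, linearN) /= cf_zl // cf_zr // ![cf c q.+1 _ _]cf_top'.
by rewrite cf_zlq1 cf_zrq1 !phi_deg ?nE ?q_odd // !oppr0 !addr0.
Qed.

(** Words of odd length have equal end letters, so the two Koszul terms involve different letters.
    Below the top they are therefore separately zero, which is the first family. They meet only in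
    exponent [q.+1], together with the [q]-th power terms, whence the second. The third family is
    the equation at the empty word. *)
Lemma delta_alg_odd : odd n ->
  (forall c m, delta_alg phi c m = 0) <->
  [/\ forall c m k i, (k < q)%N -> cf (~~ c) k i (phi c m) = 0,
      forall c m i, cf c q i.+1 (phi (~~ c) m) - cf (~~ c) q i (phi c m)
        - cf (~~ c) 1 i.+1 (phi (~~ c) m.+2) + cf c 1 i (phi c m.+2) = 0 &
      forall i, \sum_(a < q.+1) (cf false 1 (i + a) (phi false 1) : K) -
                \sum_(a < q.+1) (cf true 1 (i + a) (phi true 1) : K) = 0].
Proof.
move=> n_odd.
have cne c : ~~ c != c by case: c.
have cne' c : c != ~~ c by case: c.
have dE c m : odd m -> delta_alg phi c m.+1 =
    z c * phi (~~ c) m + phi c m * z (~~ c) +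
    (z (~~ c) ^+ q * phi (~~ c) m.+2 + phi c m.+2 * z c ^+ q).
  by move=> m_odd; rewrite /delta_alg /last_letter exprS -signr_odd /= m_odd /= mulrN1 opprK !scale1r.
have topE c m i : odd m -> cf c q.+1 i (delta_alg phi c m.+1) =
    cf c q i.+1 (phi (~~ c) m) - cf (~~ c) q i (phi c m)
        - cf (~~ c) 1 i.+1 (phi (~~ c) m.+2) + cf c 1 i (phi c m.+2).
  move=> m_odd; rewrite dE // !linearD /= cf_zl // [cf c _ _ (_ * z (~~ c))]cf_top' cf_zr //.
  by rewrite [cf c _ _ (z (~~ c) ^+ q * _)]cf_top' cf_zlq1 cf_zrq1 !addrA.
(* The [a]-th term of the divided difference carries the coefficient of exponent 1 from vertex
   [i + a] to exponent [q.+1] at vertex [i]. The minus sign in front of the second sum is that of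
   $y^{q+1}=-x^{q+1}$. *)
have top0 i : cf false q.+1 i (delta_alg phi false 0) =
    \sum_(a < q.+1) (cf false 1 (i + a) (phi false 1) : K) -
    \sum_(a < q.+1) (cf true 1 (i + a) (phi true 1) : K).
  have H b : cf b q.+1 i (\sum_(a < q.+1) z b ^+ a * phi b 1%N * z b ^+ (q - a)) =
      \sum_(a < q.+1) (cf b 1 (i + a) (phi b 1) : K).
    rewrite linear_sum; apply: eq_bigr => a _ /=.
    have aq : (a <= q)%N by rewrite -ltnS.
    have -> : cf b q.+1 i = cf b (1 + a + (q - a)) i by congr (cf b _ i); lia.
    by rewrite cf_zrX ?cf_zlX //; lia.
  by rewrite /= big_bool linearD /= addrC H cf_top' /= H.
split=> [d0|[O1 O2 O3] c m].
  split=> [c m k i kq|c m i|i]; last by rewrite -top0 d0 linear0.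
    case m_odd: (odd m); last by rewrite phi_odd ?linear0 // n_odd m_odd.
    have := congr1 (cf (~~ c) k.+1 i) (d0 c m.+1).
    rewrite dE // linear0 !linearD /= cf_zl_ne // cf_zr ?(ltnW kq) //.
    rewrite [cf _ _ _ (_ * z c ^+ q)]cf_zrX_ne // addr0 add0r.
    move: kq; rewrite leq_eqVlt => /orP[/eqP->|kq].
      by rewrite cf_zlq (@phi_deg _ m.+2) ?addr0.
    by rewrite cf_zlX_lt ?addr0 // ltnW.
  case m_odd: (odd m); first by rewrite -topE // d0 linear0.
  by rewrite !(@phi_odd _ m) ?(@phi_odd _ m.+2) ?linear0 ?subr0 ?addr0 //= n_odd m_odd.
case: m => [|m].
  have -> : delta_alg phi c 0 = delta_alg phi false 0 by [].
  apply: cf_eq0 => c' k i; rewrite leq_eqVlt => /orP[/eqP->|kq].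
    by case: c'; rewrite ?[cf true _ _ _]cf_top' ?top0 ?O3 ?oppr0.
  rewrite ltnS in kq.
  rewrite /= linear_sum big1 // => b _; rewrite linear_sum big1 // => a _.
  have aq : (a <= q)%N by rewrite -ltnS.
  have [->|cc] := eqVneq c' b; last first.
    have [qa|qa] := posnP (q - a); last by rewrite cf_zrX_ne.
    by rewrite -mulrA cf_zlX_ne //; move: q_gt0 qa aq; lia.
  have [kqa|kqa] := ltnP k (q - a); first by rewrite cf_zrX_lt.
  rewrite -(subnK kqa) cf_zrX ?subnK ?leqW //.
  have [kqa'|kqa'] := ltnP (k - (q - a)) a.
    by rewrite cf_zlX_lt // (leq_trans _ kq) // leq_subr.
  rewrite -(subnK kqa') cf_zlX ?subnK ?(leq_trans (leq_subr _ _)) ?leqW //.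
  have -> : (k - (q - a) - a = 0)%N by move: kq aq; lia.
  by rewrite phi_deg ?n_odd.
case m_odd: (odd m); last first.
  by rewrite /= !(@phi_odd _ m) ?(@phi_odd _ m.+2) ?(mulr0, mul0r, scaler0, addr0) //= n_odd m_odd.
apply: cf_eq0 => c' k i; rewrite leq_eqVlt => /orP[/eqP->|]; last first.
  rewrite ltnS => kq; rewrite dE // !linearD /=.
  case: k kq => [|k] kq.
    by rewrite cf_zl0 cf_zr0 cf_zlX0 // cf_zrX0 // !addr0.
  have [->|cc] := eqVneq c' c.
    rewrite cf_zl ?(ltnW kq) // -[X in cf X k]negbK O1 // cf_zr_ne // cf_zlX_ne // !add0r.
    move: kq; rewrite leq_eqVlt => /orP[/eqP->|kq]; first by rewrite cf_zrq phi_deg ?n_odd.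
    by rewrite cf_zrX_lt // ltnW.
  have -> : c' = ~~ c by case: c c' cc => [] [].
  rewrite cf_zl_ne // cf_zr ?(ltnW kq) // O1 // [cf _ _ _ (_ * z c ^+ q)]cf_zrX_ne // !addr0 !add0r.
  move: kq; rewrite leq_eqVlt => /orP[/eqP->|kq]; first by rewrite cf_zlq phi_deg ?n_odd.
  by rewrite cf_zlX_lt // ltnW.
have [->|cc] := eqVneq c' c; first by rewrite topE // O2.
have -> : c' = ~~ c by case: c c' cc => [] [].
by rewrite cf_top topE // O2 oppr0.
Qed.

End DegreeN.

End Coefficients.

(** * Cohomology dimensions from ranks of a finite-dimensional complex *)

Section FiniteComplex.
Variables (K : fieldType) (E : algType K) (M N : lmodType E) (P : proj_resolution M).
Variable V : nat -> vectType K.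
Variable G : forall n, V n -> {linear P n -> N}.
Hypothesis G_linear : forall n c u v x, G (c *: u + v) x = c%:A *: G u x + @G n v x.
Hypothesis G_inj : forall n (u : V n), (forall x, G u x = 0) -> u = 0.
Hypothesis G_surj : forall n (h : {linear P n -> N}), exists u : V n, G u =1 h.
Let G0 n x : G (0 : V n) x = 0.
Proof.
have := @G_linear n 1 0 0 x; rewrite scaler0 addr0 scale1r scale1r => /eqP.
by rewrite -subr_eq0 opprD addrA subrr sub0r oppr_eq0 => /eqP.
Qed.

Let GD n (u v : V n) x : G (u + v) x = G u x + G v x.
Proof. by rewrite -[u in LHS]scale1r G_linear !scale1r. Qed.

Let GZ n c (u : V n) x : G (c *: u) x = c%:A *: G u x.
Proof. by rewrite -[c *: u]addr0 G_linear G0 addr0. Qed.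

Let GB n (u v : V n) x : G (u - v) x = G u x - G v x.
Proof. by rewrite GD -[- v]scaleN1r GZ !scaleN1r. Qed.

Let G_sum n d (c : 'I_d -> K) (w : 'I_d -> V n) x :
  G (\sum_i c i *: w i) x = \sum_i (c i)%:A *: G (w i) x.
Proof.
elim/big_rec2: _ => [|i y u _ <-]; first exact: G0.
exact: G_linear.
Qed.

Definition hom_diff n (u : V n) : V n.+1 := sval (cid (G_surj (G u \o res_diff P n))).

Lemma hom_diffE n (u : V n) x : G (hom_diff u) x = G u (res_diff P n x).
Proof. exact: (svalP (cid (G_surj (G u \o res_diff P n)))). Qed.

Fact hom_diff_linear n : linear (@hom_diff n).
Proof.
move=> c u v; apply/eqP; rewrite -subr_eq0; apply/eqP/G_inj => x.
by rewrite GB !(hom_diffE, G_linear) subrr.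
Qed.

HB.instance Definition _ n :=
  GRing.isLinear.Build K (V n) (V n.+1) _ (@hom_diff n) (@hom_diff_linear n).

Definition hom_diff_fun n : 'Hom(V n, V n.+1) := linfun (@hom_diff n).
Local Notation D := hom_diff_fun.

Let G_diff n (u : V n) x : G (D n u) x = G u (res_diff P n x).
Proof. by rewrite lfunE hom_diffE. Qed.

Lemma hom_diff_eq0 n (u : V n) : D n u = 0 <-> forall x, G u (res_diff P n x) = 0.
Proof.
split=> [u0 x|u0]; first by rewrite -G_diff u0 G0.
by apply: G_inj => x; rewrite G_diff.
Qed.

Definition boundaries n : {vspace V n} := if n is n'.+1 then limg (D n') else 0%VS.

Let boundariesP n (u : V n) : u \in boundaries n <-> coboundary (fun x => G u x).
Proof.
case: n u => [|n] u /=; split.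
- by rewrite memv0 => /eqP->.
- by move=> u0; rewrite memv0; apply/eqP/G_inj.
- by case/memv_imgP => w _ ->; exists (G w) => x; rewrite G_diff.
case=> g gP; have [w wg] := G_surj g.
suff -> : u = D n w by exact: memv_img (memvf w).
apply/eqP; rewrite -subr_eq0; apply/eqP/G_inj => x.
by rewrite GB G_diff gP wg subrr.
Qed.

Let cocycleP n (u : V n) : cocycle (fun x => G u x) <-> u \in lker (D n).
Proof.
rewrite memv_ker; split=> [u0|/eqP u0 x].
  by apply/eqP/G_inj => x; rewrite G_diff u0.
by rewrite -G_diff u0 G0.
Qed.

(** By rank-nullity the hypothesis says that the boundaries have codimension [d] in the kernel. A
    basis of a complement of the boundaries represents the classes, and its zero intersection with
    the boundaries gives unique coordinates. *)
Lemma cohomology_dim_complex n d :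
  \dim {:V n} = (\dim (limg (D n)) + \dim (boundaries n) + d)%N -> cohomology_dim P N n d.
Proof.
move=> dimV; have dimE : \dim (lker (D n)) = (\dim (boundaries n) + d)%N.
  have := limg_ker_dim (D n) fullv; rewrite capfv dimV -addnA addnC => /eqP.
  by rewrite eqn_add2l => /eqP.
have BZ : (boundaries n <= lker (D n))%VS.
  apply/subvP => u /boundariesP uB; apply/cocycleP => x.
  case: n u {dimV dimE} uB x => [|n] u /= uB x; first exact: uB.
  by case: uB => g ->; rewrite res_diff_comp0 linear0.
set H := (lker (D n) :\: boundaries n)%VS.
have HZ : (H <= lker (D n))%VS := diffvSl _ _.
have HB : (H :&: boundaries n)%VS = 0%VS := capv_diff _ _.
have Zsum : (H + boundaries n)%VS = lker (D n).
  by rewrite addv_diff; apply/addv_idPl.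
have dH : \dim H = d.
  have := dimv_disjoint_sum HB; rewrite Zsum dimE addnC => /eqP.
  by rewrite eqn_add2r => /eqP.
move: (vbasis H) (vbasisP H); rewrite dH => w wH.
exists (fun i => G w`_i); split.
  move=> i; apply/cocycleP; apply: (subvP HZ).
  by apply: (basis_mem wH); rewrite mem_nth ?size_tuple.
move=> f fZ; have [u uf] := G_surj f.
have uZ : u \in lker (D n) by apply/cocycleP => x; rewrite uf.
have repr (c : 'rV[K]_d) x : f x - \sum_i (c 0 i)%:A *: G w`_i x =
    G (u - \sum_i c 0 i *: w`_i) x.
  by rewrite GB uf G_sum.
have cobP (c : 'rV[K]_d) :
    coboundary (fun x => f x - \sum_i (c 0 i)%:A *: G w`_i x) <->
    u - \sum_i c 0 i *: w`_i \in boundaries n.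
  rewrite boundariesP; split; by apply: coboundary_ext => x; rewrite repr.
have : u \in (H + boundaries n)%VS by rewrite Zsum.
case/memv_addP => [h hH [b bB uE]].
pose c0 : 'rV[K]_d := \row_(i < d) coord w i h.
exists c0; split; rewrite /c0.
  apply/cobP; under eq_bigr do rewrite mxE.
  by rewrite -(coord_basis wH hH) uE [h + b]addrC addrK.
move=> c /cobP cB; apply/rowP => i; rewrite mxE.
have hE : \sum_i c 0 i *: w`_i = h.
  apply/eqP; rewrite eq_sym -subr_eq0 -memv0 -HB memv_cap; apply/andP; split.
    apply: memvB => //; apply: memv_suml => j _; apply: memvZ.
    by apply: (basis_mem wH); rewrite mem_nth ?size_tuple.
  have -> : h - \sum_i c 0 i *: w`_i = (u - \sum_i c 0 i *: w`_i) - b.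
    by rewrite uE [h + b - _]addrAC addrK.
  exact: memvB.
by rewrite -hE coord_sum_free //; exact: basis_free wH.
Qed.

End FiniteComplex.

(** A rank depends only on the kernel, so a differential may be replaced by any independent system
    of equations for its cocycles. *)
Lemma rank_from_functionals (K : fieldType) (U W X : vectType K)
    (f : 'Hom(U, W)) (g : 'Hom(U, X)) :
  (forall u, f u = 0 <-> g u = 0) -> (forall x, exists u, g u = x) ->
  \dim (limg f) = \dim {:X}.
Proof.
move=> fg gS.
have kerE : lker f = lker g.
  apply/vspaceP => u; rewrite !memv_ker; by apply/eqP/eqP => u0; [have [H _] := fg u | have [_ H] := fg u]; apply: H.
have -> : {:X}%VS = limg g.
  by apply/esym/vspaceP => x; rewrite memvf; have [u <-] := gS x; rewrite memv_img ?memvf.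
apply/eqP; rewrite -(eqn_add2l (\dim (fullv :&: lker f))).
by rewrite limg_ker_dim kerE limg_ker_dim.
Qed.

(** * Coordinates on the Hom complex *)

Section Cochains.
Variables (K : fieldType) (A : algType K) (q : nat) (B : covering_basis A q).
Variables (E : algType K) (tens : A -> A -> E).
Hypothesis tensM : forall a b a' b', tens a b * tens a' b' = tens (a' * a) (b * b').
Hypothesis tens_linl : forall b, linear (tens^~ b).
Hypothesis tens_linr : forall a, linear (tens a).
Hypothesis tens11 : tens 1 1 = 1.
Hypothesis tens_ind : forall U : E -> Prop,
  (forall u v, U u -> U v -> U (u + v)) -> (forall a b, U (tens a b)) -> forall u, U u.
Hypothesis tens_lift : forall (V : lmodType K) (f : A -> A -> V),
  (forall b, linear (f^~ b)) -> (forall a, linear (f a)) ->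
  exists F : {linear E -> V}, forall a b, F (tens a b) = f a b.
Variables (X : lmodType E) (iota : {additive A -> X}).
Hypothesis iota_inj : injective iota.
Hypothesis iota_surj : forall x, exists a, iota a = x.
Hypothesis iota_act : forall a b m, tens a b *: iota m = iota (b * m * a).

Local Notation z := (cb_z B).
Local Notation e := (cb_e B).
Local Notation cf := (cb_cf B).
Local Notation L := (envL B tens).
Local Notation R := (envR B tens).
Local Notation eps := (env_eps B tens).

Let q_gt0 : (0 < q)%N. Proof. by have := cb_q B; lia. Qed.

Let aug a : tens a 1 *: iota 1 = 0 -> a = 0.
Proof. by rewrite iota_act !mul1r -(raddf0 iota) => /iota_inj. Qed.

Let x0_LR a : tens 1 a *: iota 1 = tens a 1 *: iota 1.
Proof. by rewrite !iota_act !mulr1 mul1r. Qed.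

Let x0_gen y : exists a, tens 1 a *: iota 1 = y.
Proof. by have [a <-] := iota_surj y; exists a; rewrite iota_act !mulr1. Qed.

Definition bimodule_resolution : proj_resolution X :=
  tensor_resolution B tensM tens_linl tens_linr tens11 tens_ind tens_lift aug x0_LR x0_gen.
Local Notation P := bimodule_resolution.

Let eps_idem := env_eps_idem B tensM tens_linr.

Let iotaZ c a : iota (c *: a) = c%:A *: iota a.
Proof.
have -> : c%:A = tens 1 (c *: 1).
  by have := tens_linr 1 c 1 0; rewrite tens11 (_ : tens 1 0 = 0) ?addr0 //; exact: (tens0r tens_linr).
by rewrite iota_act -scalerAl mul1r mulr1.
Qed.

Let iota_sgn k a : (-1) ^+ k *: iota a = iota ((-1) ^+ k *: a).
Proof. by rewrite -signr_odd -[in RHS]signr_odd; case: odd; rewrite ?scale1r // !scaleN1r raddfN. Qed.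

Let LXiota c k a : L c ^+ k *: iota a = iota (z c ^+ k * a).
Proof. by rewrite envLX // iota_act mulr1. Qed.

Let RXiota c k a : R c ^+ k *: iota a = iota (a * z c ^+ k).
Proof. by rewrite envRX // iota_act mul1r. Qed.

Let Liota c a : L c *: iota a = iota (z c * a). Proof. exact: (LXiota c 1). Qed.
Let Riota c a : R c *: iota a = iota (a * z c). Proof. exact: (RXiota c 1). Qed.

Lemma delta_iota (phi : bool -> nat -> A) c m :
  delta L R q (fun c m => iota (phi c m)) c m = iota (delta_alg B phi c m).
Proof.
case: m => [|m] /=; last first.
  by rewrite !(Liota, Riota, LXiota, RXiota, iota_sgn) !raddfD.
rewrite raddf_sum; apply: eq_bigr => b _; rewrite raddf_sum; apply: eq_bigr => a _.
by rewrite -scalerA RXiota LXiota mulrA.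
Qed.

Lemma eps_iota n a : eps n *: iota a = iota (\sum_(j < 4) e j * a * e (j + n)).
Proof.
by rewrite /env_eps scaler_suml raddf_sum; apply: eq_bigr => j _; rewrite iota_act.
Qed.

(** A cochain assigns to each generator an element of the sum of the $e_iAe_{i+n}$, and these spaces
    are spanned by the monomials whose length is [n] modulo 4. *)
Definition degree_basis n := {k : 'I_(q.+1.*2) | mono_length q k == n %[mod 4]}.
Definition cochain n := {ffun 'I_n.+1 * 'I_4 * degree_basis n -> K^o}.

Definition cochain_coef n (u : cochain n) (r : 'I_n.+1) (i : 'I_4) (k : 'I_(q.+1.*2)) : K :=
  if insub k is Some b then u (r, i, b) else 0.

Definition cochain_val n (u : cochain n) (r : 'I_n.+1) : A :=
  \sum_(i < 4) \sum_(k < q.+1.*2) cochain_coef u r i k *: mono B i k.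

Lemma cochain_val_linear n r : linear (@cochain_val n ^~ r).
Proof.
move=> c u v; rewrite /cochain_val scaler_sumr -big_split; apply: eq_bigr => i _ /=.
rewrite scaler_sumr -big_split; apply: eq_bigr => k _ /=.
rewrite scalerA -scalerDl; congr (_ *: _); rewrite /cochain_coef.
by case: insub => [b|]; rewrite ?ffunE ?mulr0 ?addr0.
Qed.

Lemma cf_cochain_val n (u : cochain n) r (i : 'I_4) (k : 'I_(q.+1.*2)) :
  cf (mono_letter q k) (mono_length q k) i (cochain_val u r) = cochain_coef u r i k.
Proof.
rewrite /cochain_val linear_sum (bigD1 i) //= [X in _ + X]big1 ?addr0 => [|j ji].
  rewrite linear_sum (bigD1 k) //= big1 ?addr0 => [|l lk].
    by rewrite linearZ /= cf_mono // !eqxx; exact: mulr1.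
  by rewrite linearZ /= cf_mono // -val_eqE /= in lk *; rewrite eq_sym (negPf lk); exact: mulr0.
rewrite linear_sum big1 // => l _; rewrite linearZ /= cf_mono //.
rewrite !(modn_small (ltn_ord _)) eq_sym [_ == j :> nat]eq_sym.
by rewrite (_ : (j == i :> nat) = false) ?andbF; [exact: mulr0 | exact: negPf].
Qed.

Lemma cochain_val_homogeneous n (u : cochain n) r :
  \sum_(j < 4) e j * cochain_val u r * e (j + n) = cochain_val u r.
Proof.
set a := cochain_val u r.
rewrite [RHS](cb_expand B) [LHS](cb_expand B); apply: eq_bigr => i _; apply: eq_bigr => k _.
rewrite cf_homogeneous ?(mono_length_le B) //; case: ifP => // kn.
rewrite /a cf_cochain_val /cochain_coef; case: insubP => // b kb.
by rewrite kb in kn.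
Qed.

Lemma cochain_val_onto n (f : 'I_n.+1 -> A) :
  (forall r, \sum_(j < 4) e j * f r * e (j + n) = f r) ->
  exists u : cochain n, forall r, cochain_val u r = f r.
Proof.
move=> fh; exists [ffun rib : 'I_n.+1 * 'I_4 * degree_basis n =>
  cf (mono_letter q (val rib.2)) (mono_length q (val rib.2)) rib.1.2 (f rib.1.1) : K^o] => r.
rewrite [RHS](cb_expand B); apply: eq_bigr => i _; apply: eq_bigr => k _; congr (_ *: _).
rewrite /cochain_coef; case: insubP => [b _ <-|kn]; first by rewrite ffunE.
by rewrite -[in RHS]fh cf_homogeneous ?(mono_length_le B) // (negPf kn).
Qed.

Lemma cochain_val_inj n (u : cochain n) : (forall r, cochain_val u r = 0) -> u = 0.
Proof.
move=> u0; apply/ffunP => -[[r i] b]; rewrite ffunE.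
have := cf_cochain_val u r i (val b); rewrite u0 linear0 /cochain_coef.
by case: insubP => [b' _ /val_inj->//|]; rewrite (valP b).
Qed.

Definition cochain_hom n (u : cochain n) : {linear P n -> X} :=
  idem_hom (fun r => iota (cochain_val u r)).

Lemma cochain_hom_linear n c (u v : cochain n) x :
  cochain_hom (c *: u + v) x = c%:A *: cochain_hom u x + cochain_hom v x.
Proof.
rewrite /cochain_hom /= /idem_hom scaler_sumr -big_split; apply: eq_bigr => r _ /=.
rewrite cochain_val_linear raddfD iotaZ scalerDr !scalerA; congr (_ *: _ + _).
by rewrite -scalerAr -scalerAl mulr1 mul1r.
Qed.

Lemma cochain_hom_basis n (u : cochain n) r :
  cochain_hom u (idem_basis (eps_idem n) r) = iota (cochain_val u r).
Proof. by rewrite /cochain_hom /= idem_hom_basis eps_iota cochain_val_homogeneous. Qed.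

Lemma cochain_hom_inj n (u : cochain n) : (forall x, cochain_hom u x = 0) -> u = 0.
Proof.
move=> u0; apply: cochain_val_inj => r; apply: iota_inj; rewrite raddf0.
by rewrite -cochain_hom_basis u0.
Qed.

Lemma cochain_hom_surj n (h : {linear P n -> X}) : exists u : cochain n, cochain_hom u =1 h.
Proof.
have fP r : exists a, iota a = h (idem_basis (eps_idem n) r) by exact: iota_surj.
pose f r := sval (cid (fP r)).
have fE r : iota (f r) = h (idem_basis (eps_idem n) r) := svalP (cid (fP r)).
have [|u uf] := @cochain_val_onto n f.
  move=> r; apply: iota_inj; rewrite -eps_iota fE -linearZ /=.
  by congr (h _); exact: idem_basis_idem.
exists u => x; rewrite (idem_lin_expand (eps_idem n) (h : {linear idem_free _ _ -> X})).
by rewrite /cochain_hom /= /idem_hom; apply: eq_bigr => r _; rewrite uf fE.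
Qed.

Definition cochain_family n (u : cochain n) : bool -> nat -> A := index_family (cochain_val u).

Lemma cochain_hom_gen n (u : cochain n) c m :
  cochain_hom u (res_gen eps_idem n c m) = iota (cochain_family u c m).
Proof.
rewrite /res_gen /cochain_family !index_family_morph /index_family.
by case: ifP => // _; exact: cochain_hom_basis.
Qed.

Lemma cochain_cocycle n (u : cochain n) :
  (forall x, cochain_hom u (res_diff P n x) = 0) <->
  (forall c m, delta_alg B (cochain_family u) c m = 0).
Proof.
have genE c m : cochain_hom u (res_diff P n (res_gen eps_idem n.+1 c m)) =
    iota (delta_alg B (cochain_family u) c m).
  rewrite -delta_iota -(eq_delta _ _ _ _ _ (cochain_hom_gen u)).
  rewrite -delta_linear; congr (cochain_hom u _).
  exact: (res_d_gen eps_idem (env_epsL B tensM) (env_epsR B tensM) (env_eps_per B tens)).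
split=> [d0 c m|d0 x]; first by apply: iota_inj; rewrite raddf0 -genE d0.
pose g : {linear res_term eps n.+1 -> X} := cochain_hom u \o res_diff P n.
rewrite -[LHS]/(g x) (idem_lin_expand (eps_idem n.+1)) big1 // => r _.
have := genE (gen_letter n.+1 r) (gen_length n.+1 r).
by rewrite /res_gen index_family_gen d0 raddf0 /g /= => ->; rewrite scaler0.
Qed.

End Cochains.

(** * Ranks of the cochain differential by residue class of the degree *)

Lemma sum_period (K : fieldType) T (eta : nat -> K) i : (forall j, eta (j + 4)%N = eta j) ->
  \sum_(a < (4 * T + 1).+1) eta (i + a)%N =
  (eta 0%N + eta 1%N + eta 2%N + eta 3%N) *+ T + eta i + eta i.+1.
Proof.
move=> per; have sum4 j :
    eta j + eta j.+1 + eta j.+2 + eta j.+3 = eta 0%N + eta 1%N + eta 2%N + eta 3%N.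
  elim: j => // j <-; have := per j; rewrite addn4 => ->; ring.
have per4 t j : eta (j + 4 * t)%N = eta j.
  elim: t => [|t IHt]; first by rewrite muln0 addn0.
  by rewrite mulnSr addnA per.
elim: T => [|t IHt].
  by rewrite muln0 add0n !big_ord_recr big_ord0 /= mulr0n addn0 addn1.
have -> : ((4 * t.+1 + 1).+1 = (4 * t + 1).+1.+4)%N by lia.
rewrite 4!big_ord_recr /= IHt mulrSr.
have -> : (i + (4 * t + 1).+1 = (i + 2) + 4 * t)%N by lia.
have -> : (i + (4 * t + 1).+2 = (i + 3) + 4 * t)%N by lia.
have -> : (i + (4 * t + 1).+3 = i + 4 * t.+1)%N by lia.
have -> : (i + (4 * t + 1).+4 = i.+1 + 4 * t.+1)%N by lia.
rewrite !per4 -(sum4 i) addn2 addn3; ring.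
Qed.

(** A sum of [4 * T + 2] consecutive terms consists of [T] full periods and two further terms.
    Differences of neighbouring equations give [eta i = eta i.+2]; the equation that is left has
    [2 * T + 1] copies of [eta 0 + eta 1]. *)
Lemma trace_eq0 (K : fieldType) T (eta : nat -> K) : (forall j, eta (j + 4)%N = eta j) ->
  (forall i, \sum_(a < (4 * T + 1).+1) eta (i + a)%N = 0) <->
  [/\ eta 0%N = eta 2%N, eta 1%N = eta 3%N & (2 * T + 1)%:R * (eta 0%N + eta 1%N) = 0].
Proof.
move=> per; have S i := sum_period T i per.
have mE (x : K) k : x *+ k = k%:R * x by rewrite mulr_natl.
have tE : (2 * T + 1)%:R = 2 * T%:R + 1 :> K by rewrite natrD natrM.
split=> [S0|[e02 e13 e01] i].
  have S0' i : (eta 0%N + eta 1%N + eta 2%N + eta 3%N) *+ T + eta i + eta i.+1 = 0.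
    by rewrite -S.
  have e02 : eta 0%N = eta 2%N.
    by apply/eqP; rewrite -subr_eq0 -(subrr 0) -{1}(S0' 0%N) -(S0' 1%N); apply/eqP; ring.
  have e13 : eta 1%N = eta 3%N.
    by apply/eqP; rewrite -subr_eq0 -(subrr 0) -{1}(S0' 1%N) -(S0' 2%N); apply/eqP; ring.
  split=> //; rewrite -(S0' 0%N) tE -e02 -e13 mE; ring.
have sE : eta i + eta i.+1 = eta 0%N + eta 1%N.
  elim: i => // i <-; suff -> : eta i.+2 = eta i by rewrite addrC.
  have {e01} : forall k, (eta k.+2 = eta k) /\ (eta k.+3 = eta k.+1).
    elim=> [|k [IH1 IH2]]; first by rewrite e02 e13.
    by split=> //; rewrite IH1 -[in RHS](per k) addn4.
  by move=> /(_ i)[].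
by rewrite S -addrA sE -e02 -e13 mE -[RHS]e01 tE; ring.
Qed.

Section Ranks.
Variables (K : fieldType) (A : algType K) (q : nat) (B : covering_basis A q).
Local Notation cf := (cb_cf B).

Section Family.
Variables (n : nat).
Implicit Type u : cochain K q n.
Local Notation fam := (cochain_family B).

Lemma cochain_family_linear c m : linear (fun u => fam u c m).
Proof.
move=> x u v; rewrite /cochain_family /index_family; case: ifP => _; last by rewrite scaler0 addr0.
exact: cochain_val_linear.
Qed.

Lemma cochain_family0 u : fam u true 0 = fam u false 0.
Proof. exact: index_family0. Qed.

Lemma cochain_family_parity u c m : odd (n + m) -> fam u c m = 0.
Proof. by move=> nm; apply: index_family_out; rewrite nm andbF. Qed.

Lemma cochain_family_long u c m : (n < m)%N -> fam u c m = 0.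
Proof. by move=> nm; apply: index_family_out; rewrite leqNgt nm. Qed.

Lemma cochain_family_degree u c m c' k i : (k <= q.+1)%N -> k != n %[mod 4] ->
  cf c' k i (fam u c m) = 0.
Proof.
move=> kq kn; rewrite /cochain_family /index_family; case: ifP => _; last exact: linear0.
by rewrite -cochain_val_homogeneous cf_homogeneous // (negPf kn).
Qed.

Definition coefficient u c m c' k i : K := cf c' k i (fam u c m).

Lemma coefficient_linear c m c' k i : linear (fun u => coefficient u c m c' k i : K^o).
Proof. by move=> x u v; rewrite /coefficient cochain_family_linear linearP. Qed.

Lemma coefficient_mod u c m c' k i j : (k <= q.+1)%N -> i = j %[mod 4] ->
  coefficient u c m c' k i = coefficient u c m c' k j.
Proof. by move=> kq ij; rewrite /coefficient (cf_mod B c' kq ij). Qed.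

(** Coefficients can be prescribed freely once the two double namings are removed: the empty word is
    entered with [c = false] and idempotents with [c' = false]. Exponent [q.+1], shared by both
    letters, is excluded by [k <= q]. *)
Lemma cochain_build (F : bool -> nat -> bool -> nat -> nat -> K) :
  exists u, forall c m c' k i, (m <= n)%N -> ~~ odd (n + m) -> (0 < m)%N || ~~ c ->
    (k <= q)%N -> k = n %[mod 4] -> (0 < k)%N || ~~ c' ->
    coefficient u c m c' k i = F c m c' k (i %% 4)%N.
Proof.
pose v : cochain K q n := [ffun rib : 'I_n.+1 * 'I_4 * degree_basis q n =>
  F (gen_letter n rib.1.1) (gen_length n rib.1.1) (mono_letter q (val rib.2))
    (mono_length q (val rib.2)) rib.1.2 : K^o].
exists v => c m c' k i mn nm mc kq kn kc; rewrite /coefficient /cochain_family /index_family.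
have mV : (m <= n)%N && ~~ odd (n + m) by rewrite mn.
rewrite mV; set r : 'I_n.+1 := inord _.
have rE : r = gen_index n c m :> nat by rewrite inordK // ltnS gen_index_bound.
pose l := if c' && (0 < k)%N then (q.+1 + k)%N else k.
have lq : (l < q.+1.*2)%N by rewrite /l; case: ifP; lia.
have le : mono_letter q l = c' /\ mono_length q l = k.
  rewrite /l /mono_letter /mono_length; case: c' kc {l lq} => /= kc.
    by rewrite orbF in kc; rewrite kc; have -> : (q.+1 < q.+1 + k)%N by [lia]; rewrite addKn.
  by rewrite ltnNge leqW.
case: le => le1 le2.
have i4 : (i %% 4 < 4)%N by rewrite ltn_mod.
have := cf_cochain_val B v r (Ordinal i4) (Ordinal lq).
rewrite /= le1 le2 (cf_mod B c' (leqW kq) (modn_mod i 4)) => ->.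
rewrite /cochain_coef; case: insubP => [b _ bE|]; last by rewrite /= le2 kn eqxx.
rewrite ffunE /= bE /= le1 le2 rE gen_lengthK //.
congr (F _ _ _ _ _); case: m mc mn nm mV {r rE} => [|m] mc mn nm mV; last by rewrite gen_letterK.
by rewrite /= in mc; case: c mc => // _; rewrite /gen_letter /gen_index subn0; lia.
Qed.

End Family.

Lemma dim_functionals (I : finType) : \dim {: {ffun I -> K^o}} = #|I|.
Proof. by rewrite dimvf /dim /= muln1. Qed.

(** The rank is the number of linear forms that cut out the cocycles, provided that their values can
    be prescribed arbitrarily, that is, provided that they are independent. *)
Lemma rank_of_system n (W : vectType K) (f : 'Hom(cochain K q n, W)) (J : finType)
    (l : J -> cochain K q n -> K^o) :
  (forall j, linear (l j)) ->
  (forall u, f u = 0 <-> forall c m, delta_alg B (cochain_family B u) c m = 0) ->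
  (forall u, (forall c m, delta_alg B (cochain_family B u) c m = 0) <-> forall j, l j u = 0) ->
  (forall t : J -> K, exists u, forall j, l j u = t j) ->
  \dim (limg f) = #|J|.
Proof.
move=> l_lin fP lP lS; pose g u : {ffun J -> K^o} := [ffun j => l j u].
have g_lin : linear g by move=> x u v; apply/ffunP => j; rewrite !ffunE l_lin.
pose G : {linear cochain K q n -> {ffun J -> K^o}} := HB.pack g
  (GRing.isLinear.Build K (cochain K q n) {ffun J -> K^o} _ g g_lin).
rewrite -dim_functionals; apply: (@rank_from_functionals _ _ _ _ f (linfun G)) => [u|x].
  rewrite fP lP lfunE /=; split=> [u0|/ffunP u0 j].
    by apply/ffunP => j; rewrite !ffunE u0.
  by have := u0 j; rewrite !ffunE.
have [u uP] := lS x; exists u; rewrite lfunE /=.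
by apply/ffunP => j; rewrite ffunE uP.
Qed.

Variable T : nat.
Hypothesis qT : q = (4 * T + 1)%N.
Local Notation coef := coefficient.

Section Reduction.
Variables (n : nat) (u : cochain K q n).
Local Notation h := n.+1./2.

Let coef_out c m c' k i : ~~ ((m <= n)%N && ~~ odd (n + m)) -> coef u c m c' k i = 0.
Proof.
move=> mV; rewrite /coefficient /cochain_family index_family_out //; exact: linear0.
Qed.

Let coef_deg c m c' k i : (k <= q.+1)%N -> k != n %[mod 4] -> coef u c m c' k i = 0.
Proof. exact: cochain_family_degree. Qed.

Lemma coefficient_c0 c c' k i : coef u c 0 c' k i = coef u false 0 c' k i.
Proof. by case: c; rewrite // /coefficient cochain_family0. Qed.

Lemma coefficient_k0 c m c' i : coef u c m c' 0 i = coef u c m false 0 i.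
Proof. by case: c'; rewrite // /coefficient cf0. Qed.

Let modi (P : nat -> Prop) : (forall i, (i < 4)%N -> P i) -> (forall i, P (i %% 4)%N -> P i) ->
  forall i, P i.
Proof. by move=> H H' i; apply/H'/H; rewrite ltn_mod. Qed.

(** The lengths [n - j.*2] with [j < h] are the positive ones. At the empty word both letters give
    the same function on vertices, so the equations say that it is constant on a 4-cycle, and three
    of the four suffice. *)
Lemma cocycle_even : ~~ odd n ->
  (forall c m, delta_alg B (cochain_family B u) c m = 0) <->
  (forall j c k i, (j < h)%N -> (k < q)%N -> k = n %[mod 4] -> (i < 4)%N ->
     coef u (~~ c) (n - j.*2) c k i.+1 = coef u c (n - j.*2) c k i) /\
  (forall c k i, (k < q)%N -> k = n %[mod 4] -> (i < 3)%N ->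
     coef u false 0 c k i.+1 = coef u false 0 c k i).
Proof.
move=> n_even.
rewrite (delta_alg_even (@cochain_family_parity n u)
  (cochain_family_degree u) n_even).
split=> [H|[H1 H2] c m k i kq].
  split=> [j c k i _ kq _ _|c k i kq _ _]; first exact: H.
  by have := H c 0%N k i kq; rewrite -!/(coef _ _ _ _ _ _) !(coefficient_c0 _ c k).
rewrite -!/(coef _ _ _ _ _ _).
have [mV|mV] := boolP ((m <= n)%N && ~~ odd (n + m)); last by rewrite !coef_out.
have [/eqP kn|kn] := boolP (k == n %[mod 4]); last by rewrite !coef_deg // ltnW // ltnS ltnW.
have kq1 : (k <= q.+1)%N by lia.
have per i' c' : coef u c' m c k (i' %% 4)%N.+1 = coef u c' m c k i'.+1.
  by apply: coefficient_mod => //; lia.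
have per' i' c' : coef u c' m c k (i' %% 4)%N = coef u c' m c k i'.
  by apply: coefficient_mod; rewrite ?modn_mod.
move: i; apply: modi => i; last by rewrite per per'.
move=> i4; have [m0|m0] := posnP m; last first.
  have -> : m = (n - ((n - m)./2).*2)%N by lia.
  by apply: H1 => //; lia.
rewrite m0 !(coefficient_c0 _ c k); have [i3|i3] := ltnP i 3; first exact: H2.
have -> : i = 3%N by lia.
rewrite (H2 c k 2) // (H2 c k 1) // (H2 c k 0) //.
by apply: coefficient_mod.
Qed.

Lemma cocycle_odd : odd n ->
  (forall c m, delta_alg B (cochain_family B u) c m = 0) <->
  [/\ forall j c k i, (j < h)%N -> (k < q)%N -> k = n %[mod 4] -> (i < 4)%N ->
        coef u c (n - j.*2) (~~ c) k i = 0,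
      forall j c i, (j < h)%N -> (i < 4)%N ->
        let m := (n - j.*2)%N in
        coef u (~~ c) m c q i.+1 - coef u c m (~~ c) q i
        - coef u (~~ c) m.+2 (~~ c) 1 i.+1 + coef u c m.+2 c 1 i = 0 &
      forall i, \sum_(a < q.+1) coef u false 1 false 1 (i + a) -
                \sum_(a < q.+1) coef u true 1 true 1 (i + a) = 0].
Proof.
move=> n_odd.
rewrite (delta_alg_odd (@cochain_family_parity n u)
  (cochain_family_degree u) n_odd).
split=> [[H1 H2 H3]|[H1 H2 H3]].
  by split=> [j c k i _ kq _ _|j c i _ _ m|//]; [exact: H1 | exact: H2].
have mE m : (m <= n)%N && ~~ odd (n + m) -> exists2 j, (j < h)%N & m = (n - j.*2)%N.
  by move=> mV; exists (n - m)./2; lia.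
split=> // [c m k i kq|c m i]; rewrite -!/(coef _ _ _ _ _ _).
  have [mV|mV] := boolP ((m <= n)%N && ~~ odd (n + m)); last by rewrite !coef_out.
  have [/eqP kn|kn] := boolP (k == n %[mod 4]); last by rewrite !coef_deg // ltnW // ltnS ltnW.
  have [j jh ->] := mE m mV.
  by rewrite -(coefficient_mod u _ _ _ _ (modn_mod i 4)) ?H1 ?ltn_mod //; lia.
have [mV|mV] := boolP ((m <= n)%N && ~~ odd (n + m)); last first.
  have mV2 : ~~ ((m.+2 <= n)%N && ~~ odd (n + m.+2)) by apply: contra mV; lia.
  by rewrite !(@coef_out _ m) // !(@coef_out _ m.+2) // !subr0 addr0.
have [j jh ->] := mE m mV.
have := H2 j c (i %% 4)%N jh; rewrite ltn_mod => /(_ isT) /=.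
have per i' c1 m' c2 k' : (k' <= q.+1)%N -> coef u c1 m' c2 k' (i' %% 4)%N.+1 = coef u c1 m' c2 k' i'.+1.
  by move=> ?; apply: coefficient_mod => //; lia.
have per' i' c1 m' c2 k' : (k' <= q.+1)%N -> coef u c1 m' c2 k' (i' %% 4)%N = coef u c1 m' c2 k' i'.
  by move=> ?; apply: coefficient_mod; rewrite ?modn_mod.
by rewrite !per ?per' //; lia.
Qed.

End Reduction.

Let pair_length n j : (j < n.+1./2)%N ->
  [/\ (0 < n - j.*2)%N, ~~ odd (n + (n - j.*2)) & (n - (n - j.*2))./2 = j].
Proof. by move=> jh; split; lia. Qed.

Let ext a (t : 'I_a -> K) (j : nat) : K := if insub j is Some j' then t j' else 0.

Let extE a t (j : 'I_a) : ext t j = t j. Proof. by rewrite /ext valK. Qed.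

Let ext3 a b c (t : 'I_a -> 'I_b -> 'I_c -> K) (j k i : nat) : K :=
  ext (fun j' => ext (fun k' => ext (t j' k') i) k) j.

Let ext3E a b c t (j : 'I_a) (k : 'I_b) (i : 'I_c) : ext3 t j k i = t j k i.
Proof. by rewrite /ext3 !extE. Qed.

Let ext2 a b (t : 'I_a -> 'I_b -> K) (j k : nat) : K := ext (fun j' => ext (t j') k) j.

Let ext2E a b t (j : 'I_a) (k : 'I_b) : ext2 t j k = t j k.
Proof. by rewrite /ext2 !extE. Qed.

Let linear_sub (U : lmodType K) (f g : U -> K^o) : linear f -> linear g ->
  linear (fun u => f u - g u).
Proof. by move=> fl gl x u v; rewrite fl gl scalerBr opprD addrACA. Qed.

(** As [q] and 1 are both 1 modulo 4, the second and third families of [cocycle_odd] are void here.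
    What remains is the vanishing of separate coordinates, with exponents [4 * k + 3], [k < T]. *)
Lemma rank_mod3 n (W : vectType K) (f : 'Hom(cochain K q n, W)) :
  (n %% 4 = 3)%N ->
  (forall u, f u = 0 <-> forall c m, delta_alg B (cochain_family B u) c m = 0) ->
  \dim (limg f) = (4 * T * n.+1)%N.
Proof.
move=> n3 fP; have n_odd : odd n by lia.
pose l (j : 'I_(n.+1./2) * bool * 'I_T * 'I_4) (u : cochain K q n) : K^o :=
  coef u j.1.1.2 (n - j.1.1.1.*2) (~~ j.1.1.2) (4 * j.1.2 + 3) j.2.
have := @rank_of_system n _ f _ l.
rewrite !card_prod !card_ord card_bool => -> //.
- have hE : (n.+1 = n.+1./2 * 2)%N by lia.
  by rewrite [in RHS]hE; lia.
- by move=> j; exact: coefficient_linear.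
- move=> u; rewrite (cocycle_odd u n_odd); split=> [[H1 _ _] [[[j c] k] i]|H].
    by rewrite /l /=; apply: H1 => //; have := ltn_ord k; lia.
  have deg c m c' k i : (k <= q.+1)%N -> (k %% 4 != 3)%N -> coef u c m c' k i = 0.
    by move=> kq kn; apply: cochain_family_degree; rewrite // n3.
  split=> [j c k i jh kq kn i4|j c i _ _ /=|i].
  - have kT : (k %/ 4 < T)%N by lia.
    have := H (Ordinal jh, c, Ordinal kT, Ordinal i4); rewrite /l /=.
    by have -> : (4 * (k %/ 4) + 3 = k)%N by lia.
  - by rewrite !deg ?subr0 ?addr0 //; lia.
  by rewrite !big1 ?subr0 // => a _; rewrite deg.
move=> t.
have [u uP] := @cochain_build n (fun c m _ k i =>
  ext3 (fun j k i => t (j, c, k, i)) (n - m)./2 (k %/ 4) i).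
exists u => -[[[j c] k] i]; have kT := ltn_ord k.
have [m0 mn mj] := pair_length (ltn_ord j).
rewrite /l /= uP ?mn ?m0 ?leq_subr //; try lia; rewrite modn_small // mj.
have -> : ((4 * k + 3) %/ 4 = k)%N by lia.
exact: (ext3E (fun j k i => t (j, c, k, i))).
Qed.

(* Two periodic functions a, b on Z/4 with b (i + 1) = a i and a (i + 1) = b i:
   of these 8 equations 6 are independent. *)
Let pair_periodic (a b : nat -> K) : a 4 = a 0%N -> b 4 = b 0%N ->
  (forall i, (i < 4)%N -> b i.+1 = a i) -> (forall i, (i < 2)%N -> a i.+1 = b i) ->
  forall i, (i < 4)%N -> a i.+1 = b i.
Proof.
move=> a4 b4 ba ab [|[|[|[|//]]]] _; try exact: ab.
  by rewrite -ba // b4 -ab // -ba.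
by rewrite a4 -ba // -ab // -ba.
Qed.

(** An explicit solution of the six independent equations with arbitrary right-hand sides [t] and
    [t'], normalized by $a_0=a_3=0$ and then solved along the cycle. *)
Let sol_a (t t' : nat -> K) i := nth 0 [:: 0; t' 0%N + t 3%N; t' 1%N + t 0%N; 0] i.
Let sol_b (t t' : nat -> K) i :=
  nth 0 [:: t 3%N; t 0%N; t 1%N + sol_a t t' 1; t 2%N + sol_a t t' 2] i.

Let sol_ba t t' i : (i < 4)%N -> sol_b t t' (i.+1 %% 4)%N - sol_a t t' i = t i.
Proof. by case: i => [|[|[|[|//]]]] _; rewrite /= ?subr0 ?addrK. Qed.

Let sol_ab t t' i : (i < 2)%N -> sol_a t t' i.+1 - sol_b t t' i = t' i.
Proof. by case: i => [|[|//]] _; rewrite /= addrK. Qed.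

Lemma rank_mod2 n (W : vectType K) (f : 'Hom(cochain K q n, W)) :
  (n %% 4 = 2)%N ->
  (forall u, f u = 0 <-> forall c m, delta_alg B (cochain_family B u) c m = 0) ->
  \dim (limg f) = (4 * T * n + 6 * T)%N.
Proof.
move=> n2 fP; have n_even : ~~ odd n by lia.
pose J := (('I_(n.+1./2) * bool * 'I_T * 'I_4) + (bool * 'I_T * 'I_3))%type.
pose l (x : J) (u : cochain K q n) : K^o := match x with
  | inl (j, c, k, i) => coef u (~~ c) (n - j.*2) c (4 * k + 2) i.+1 -
                        coef u c (n - j.*2) c (4 * k + 2) i
  | inr (c, k, i) => coef u false 0 c (4 * k + 2) i.+1 - coef u false 0 c (4 * k + 2) i
  end.
have := @rank_of_system n _ f _ l.
rewrite card_sum !card_prod !card_ord card_bool => -> //.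
- have hE : (n = n.+1./2 * 2)%N by lia.
  by rewrite [in RHS]hE; lia.
- by move=> [[[[j c] k] i]|[[c k] i]]; apply: linear_sub; exact: coefficient_linear.
- move=> u; rewrite (cocycle_even u n_even); split=> [[H1 H2] x|H].
    case: x => [[[[j c] k] i]|[[c k] i]]; have kT := ltn_ord k; apply/eqP; rewrite subr_eq0.
      by apply/eqP/H1 => //; lia.
    by apply/eqP/H2 => //; lia.
  have kE k : (k < q)%N -> k = n %[mod 4] -> {k' : 'I_T | k = (4 * k' + 2)%N}.
    move=> kq kn; have kT : (k %/ 4 < T)%N by lia.
    by exists (Ordinal kT) => /=; lia.
  split=> [j c k i jh kq kn i4|c k i kq kn i3]; have [k' ->] := kE k kq kn; apply/eqP;
    rewrite -subr_eq0; apply/eqP.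
    exact: (H (inl (Ordinal jh, c, k', Ordinal i4))).
  exact: (H (inr (c, k', Ordinal i3))).
move=> t.
(* On nonempty words only coefficients of the word's own first letter are used, so each equation has
   a single nonzero term. At the empty word prescribed differences are integrated by partial
   sums. *)
have [u uP] := @cochain_build n (fun c m c' k i =>
  if m == 0%N then \sum_(i' < i) ext2 (fun k i => t (inr (c', k, i))) (k %/ 4) i'
  else if c' == c then - ext3 (fun j k i => t (inl (j, c, k, i))) (n - m)./2 (k %/ 4) i else 0).
exists u => -[[[[j c] k] i]|[[c k] i]]; have kT := ltn_ord k;
  have kE : ((4 * k + 2) %/ 4 = k)%N by lia.
  have [m0 mn mj] := pair_length (ltn_ord j).
  rewrite /l !uP ?mn ?m0 ?leq_subr //; try lia.
  rewrite kE mj eqn0Ngt m0 /= eqxx (_ : (c == ~~ c) = false); last by case: (c).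
  rewrite sub0r opprK (modn_small (ltn_ord i)).
  exact: (ext3E (fun j k i => t (inl (j, c, k, i)))).
rewrite /l !uP ?addn0 //; try lia.
have i4 : (i.+1 < 4)%N by have := ltn_ord i; lia.
rewrite kE /= (modn_small i4) (modn_small (ltnW i4)) big_ord_recr /= addrAC subrr add0r.
exact: (ext2E (fun k i => t (inr (c, k, i)))).
Qed.

(** Positive exponents behave as in the class of 2. At exponent 0 the letters share their
    coefficients, so each positive length contributes an 8-equation cycle of rank 6 and the empty
    word adds 3, giving the terms [3 * n + 3]. *)
Lemma rank_mod0 n (W : vectType K) (f : 'Hom(cochain K q n, W)) :
  (n %% 4 = 0)%N ->
  (forall u, f u = 0 <-> forall c m, delta_alg B (cochain_family B u) c m = 0) ->
  \dim (limg f) = (4 * T * n + 6 * T + 3 * n + 3)%N.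
Proof.
move=> n0 fP; have n_even : ~~ odd n by lia.
pose J1 := (('I_(n.+1./2) * bool * 'I_T * 'I_4) + (bool * 'I_T * 'I_3))%type.
pose J := (J1 + ('I_(n.+1./2) * 'I_4 + 'I_(n.+1./2) * 'I_2 + 'I_3))%type.
pose l (x : J) (u : cochain K q n) : K^o := match x with
  | inl (inl (j, c, k, i)) => coef u (~~ c) (n - j.*2) c (4 * k + 4) i.+1 -
                        coef u c (n - j.*2) c (4 * k + 4) i
  | inl (inr (c, k, i)) => coef u false 0 c (4 * k + 4) i.+1 - coef u false 0 c (4 * k + 4) i
  | inr (inl (inl (j, i))) => coef u true (n - j.*2) false 0 i.+1 -
                              coef u false (n - j.*2) false 0 i
  | inr (inl (inr (j, i))) => coef u false (n - j.*2) false 0 i.+1 -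
                              coef u true (n - j.*2) false 0 i
  | inr (inr i) => coef u false 0 false 0 i.+1 - coef u false 0 false 0 i
  end.
have := @rank_of_system n _ f _ l.
rewrite !card_sum !card_prod !card_ord card_bool => -> //.
- have hE : (n = n.+1./2 * 2)%N by lia.
  by rewrite [in RHS]hE; lia.
- by move=> [[[[[j c] k] i]|[[c k] i]]|[[[j i]|[j i]]|i]]; apply: linear_sub;
    exact: coefficient_linear.
- move=> u; rewrite (cocycle_even u n_even); split=> [[H1 H2] x|H].
    case: x => [[[[[j c] k] i]|[[c k] i]]|[[[j i]|[j i]]|i]]; apply/eqP; rewrite subr_eq0; apply/eqP.
    + by have kT := ltn_ord k; apply: H1 => //; lia.
    + by have kT := ltn_ord k; apply: H2 => //; lia.
    + by apply: (H1 _ false) => //; lia.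
    + rewrite -(coefficient_k0 u _ _ true) -(coefficient_k0 u true _ true).
      by apply: (H1 _ true) => //; [lia | have := ltn_ord i; lia].
    + by apply: H2 => //; lia.
  have kE k : (k < q)%N -> k = n %[mod 4] -> (k = 0)%N \/ exists k' : 'I_T, k = (4 * k' + 4)%N.
    move=> kq kn; have [->|k0] := posnP k; [by left | right].
    have kT : (k %/ 4 - 1 < T)%N by lia.
    by exists (Ordinal kT) => /=; lia.
  split=> [j c k i jh kq kn i4|c k i kq kn i3]; have [->|[k' ->]] := kE k kq kn.
  + have eq1 i' : (i' < 4)%N ->
        coef u true (n - j.*2) false 0 i'.+1 = coef u false (n - j.*2) false 0 i'.
      by move=> i'4; apply/eqP; rewrite -subr_eq0; apply/eqP;
         exact: (H (inr (inl (inl (Ordinal jh, Ordinal i'4))))).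
    have eq2 i' : (i' < 2)%N ->
        coef u false (n - j.*2) false 0 i'.+1 = coef u true (n - j.*2) false 0 i'.
      by move=> i'2; apply/eqP; rewrite -subr_eq0; apply/eqP;
         exact: (H (inr (inl (inr (Ordinal jh, Ordinal i'2))))).
    rewrite !(coefficient_k0 u _ _ c); case: c => /=; last exact: eq1.
    by apply: (pair_periodic (a := coef u false (n - j.*2) false 0)
      (b := coef u true (n - j.*2) false 0)) => //; exact: coefficient_mod.
  + by apply/eqP; rewrite -subr_eq0; apply/eqP;
      exact: (H (inl (inl (Ordinal jh, c, k', Ordinal i4)))).
  + by rewrite !(coefficient_k0 u _ _ c); apply/eqP; rewrite -subr_eq0; apply/eqP;
      exact: (H (inr (inr (Ordinal i3)))).
  + by apply/eqP; rewrite -subr_eq0; apply/eqP;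
      exact: (H (inl (inr (c, k', Ordinal i3)))).
move=> t.
pose t1 m := ext2 (fun j i => t (inr (inl (inl (j, i))))) (n - m)./2.
pose t2 m := ext2 (fun j i => t (inr (inl (inr (j, i))))) (n - m)./2.
have [u uP] := @cochain_build n (fun c m c' k i =>
  if k == 0%N then
    if m == 0%N then \sum_(i' < i) ext (fun i => t (inr (inr i))) i'
    else if c then sol_b (t1 m) (t2 m) i else sol_a (t1 m) (t2 m) i
  else if m == 0%N then
    \sum_(i' < i) ext2 (fun k i => t (inl (inr (c', k, i)))) (k %/ 4 - 1) i'
  else if c' == c then
    - ext3 (fun j k i => t (inl (inl (j, c, k, i)))) (n - m)./2 (k %/ 4 - 1) i else 0).
exists u => -[[[[[j c] k] i]|[[c k] i]]|[[[j i]|[j i]]|i]].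
- have kT := ltn_ord k; have kE : ((4 * k + 4) %/ 4 - 1 = k)%N by lia.
  have [m0 mn mj] := pair_length (ltn_ord j).
  rewrite /l !uP ?mn ?m0 ?leq_subr //; try lia.
  rewrite kE mj [(n - _ == 0)%N]eqn0Ngt m0 addn4 /= eqxx (_ : (c == ~~ c) = false); last by case: (c).
  rewrite sub0r opprK (modn_small (ltn_ord i)).
  exact: (ext3E (fun j k i => t (inl (inl (j, c, k, i))))).
- have kT := ltn_ord k; have kE : ((4 * k + 4) %/ 4 - 1 = k)%N by lia.
  rewrite /l !uP ?addn0 //; try lia.
  have i4 : (i.+1 < 4)%N by have := ltn_ord i; lia.
  rewrite kE addn4 /= (modn_small i4) (modn_small (ltnW i4)) big_ord_recr /= addrAC subrr add0r.
  exact: (ext2E (fun k i => t (inl (inr (c, k, i))))).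
- have [m0 mn mj] := pair_length (ltn_ord j).
  rewrite /l !uP ?mn ?m0 ?leq_subr //; try lia.
  rewrite [(n - _ == 0)%N]eqn0Ngt m0 /= [in X in _ - X]modn_small // sol_ba // /t1 mj.
  exact: (ext2E (fun j i => t (inr (inl (inl (j, i)))))).
- have [m0 mn mj] := pair_length (ltn_ord j); have i2 := ltn_ord i.
  rewrite /l !uP ?mn ?m0 ?leq_subr //; try lia.
  rewrite [(n - _ == 0)%N]eqn0Ngt m0 /= !modn_small //; try lia.
  rewrite sol_ab // /t2 mj.
  exact: (ext2E (fun j i => t (inr (inl (inr (j, i)))))).
- rewrite /l !uP ?addn0 //; try lia.
  have i4 : (i.+1 < 4)%N by have := ltn_ord i; lia.
  rewrite /= (modn_small i4) (modn_small (ltnW i4)) big_ord_recr /= addrAC subrr add0r.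
  exact: (extE (fun i => t (inr (inr i)))).
Qed.

Let linear_add (U : lmodType K) (f g : U -> K^o) : linear f -> linear g ->
  linear (fun u => f u + g u).
Proof. by move=> fl gl x u v; rewrite fl gl scalerDr addrACA. Qed.

(** In the combinations [a] and [b] of exponents [q] and 1 the second family of [cocycle_odd]
    becomes the cycle of [pair_periodic], of rank 6 for each word length. Only the trace equations
    at the empty word depend on the field. *)
Lemma rank_mod1 n (W : vectType K) (f : 'Hom(cochain K q n, W)) :
  (n %% 4 = 1)%N ->
  (forall u, f u = 0 <-> forall c m, delta_alg B (cochain_family B u) c m = 0) ->
  \dim (limg f) =
    (4 * T * n.+1 + 3 * n.+1 + if ((2 * T + 1)%N%:R == 0 :> K)%R then 2 else 3)%N.
Proof.
move=> n1 fP; have n_odd : odd n by lia.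
(* The trace equations always contribute two equalities; the third condition, [eta 0 + eta 1 = 0],
   is present exactly when [2 * T + 1] is invertible in [K]. *)
set rho := if _ then _ else _.
pose J := (('I_(n.+1./2) * bool * 'I_T * 'I_4) +
           ('I_(n.+1./2) * 'I_4 + 'I_(n.+1./2) * 'I_2 + 'I_rho))%type.
pose eta (u : cochain K q n) i : K^o := coef u false 1 false 1 i - coef u true 1 true 1 i.
pose a (u : cochain K q n) m i : K^o :=
  coef u false m true q i - coef u false m.+2 false 1 i.
pose b (u : cochain K q n) m i : K^o :=
  coef u true m false q i - coef u true m.+2 true 1 i.
pose l (x : J) (u : cochain K q n) : K^o := match x with
  | inl (j, c, k, i) => coef u c (n - j.*2) (~~ c) (4 * k + 1) i
  | inr (inl (inl (j, i))) => b u (n - j.*2)%N i.+1 - a u (n - j.*2)%N i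
  | inr (inl (inr (j, i))) => a u (n - j.*2)%N i.+1 - b u (n - j.*2)%N i
  | inr (inr x) => match val x with
      | 0 => eta u 0%N - eta u 2%N
      | 1 => eta u 1%N - eta u 3%N
      | _ => eta u 0%N + eta u 1%N end
  end.
have a_lin m i : linear (fun u => a u m i) by apply: linear_sub; exact: coefficient_linear.
have b_lin m i : linear (fun u => b u m i) by apply: linear_sub; exact: coefficient_linear.
have eta_lin i : linear (fun u => eta u i) by apply: linear_sub; exact: coefficient_linear.
have eta_per u i : eta u (i + 4)%N = eta u i.
  by congr (_ - _); apply: coefficient_mod; rewrite ?modnDr.
have := @rank_of_system n _ f _ l.
rewrite !card_sum !card_prod !card_ord card_bool => -> //.
- have hE : (n.+1 = n.+1./2 * 2)%N by lia.
  by rewrite [in RHS]hE; lia.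
- move=> [[[[j c] k] i]|[[[j i]|[j i]]|x]] /=; first exact: coefficient_linear.
  + exact: linear_sub.
  + exact: linear_sub.
  + by rewrite /l; case: (val x) => [|[|y]]; [exact: linear_sub | exact: linear_sub |
      exact: linear_add].
- move=> u; rewrite (cocycle_odd u n_odd).
  have traceE : (forall i, \sum_(a < q.+1) coef u false 1 false 1 (i + a) -
                \sum_(a < q.+1) coef u true 1 true 1 (i + a) = 0) <->
      [/\ eta u 0%N = eta u 2%N, eta u 1%N = eta u 3%N &
          (2 * T + 1)%:R * (eta u 0%N + eta u 1%N : K) = 0].
    rewrite -(trace_eq0 T (eta_per u)) -qT; split=> H i;
      by have := H i; rewrite /eta -sumrB.
  split=> [[H1 H2 /traceE[e02 e13 e01]] x|H].
    case: x => [[[[j c] k] i]|[[[j i]|[j i]]|x]].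
    + by have kT := ltn_ord k; apply: H1 => //; lia.
    + have := H2 j false i (ltn_ord j) (ltn_ord i); rewrite /l /a /b /= => <-; ring.
    + have i4 : (i < 4)%N by have := ltn_ord i; lia.
      have := H2 j true i (ltn_ord j) i4; rewrite /l /a /b /= => <-; ring.
    rewrite /l; case xE : (val x) => [|[|y]]; rewrite ?e02 ?e13 ?subrr //.
    have := ltn_ord x; rewrite -[nat_of_ord x]/(val x) xE /rho.
    case: eqP e01 => [//|/eqP tN0] /eqP; rewrite mulf_eq0 (negPf tN0) /= => /eqP e01 _.
    by rewrite -e02 -e13.
  split=> [j c k i jh kq kn i4|j c i jh i4|].
  + have kT : (k %/ 4 < T)%N by lia.
    have := H (inl (Ordinal jh, c, Ordinal kT, Ordinal i4)); rewrite /l /=.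
    by have -> : (4 * (k %/ 4) + 1 = k)%N by lia.
  + set m := (n - j.*2)%N => m'.
    have eq1 i' : (i' < 4)%N -> b u m i'.+1 = a u m i'.
      by move=> i'4; apply/eqP; rewrite -subr_eq0; apply/eqP;
         exact: (H (inr (inl (inl (Ordinal jh, Ordinal i'4))))).
    have eq2 i' : (i' < 2)%N -> a u m i'.+1 = b u m i'.
      by move=> i'2; apply/eqP; rewrite -subr_eq0; apply/eqP;
         exact: (H (inr (inl (inr (Ordinal jh, Ordinal i'2))))).
    have eq3 : a u m i.+1 = b u m i.
      apply: (pair_periodic _ _ eq1 eq2) => //; congr (_ - _);
        by apply: coefficient_mod; rewrite ?leqnSn //; lia.
    case: c => /=.
      by move/eqP: eq3; rewrite -subr_eq0 => /eqP <-; rewrite /a /b /m' /m; ring.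
    have /eqP := eq1 i i4.
    by rewrite -subr_eq0 => /eqP <-; rewrite /a /b /m' /m; ring.
  apply/traceE; have r2 : (1 < rho)%N by rewrite /rho; case: ifP.
  have e02 : eta u 0%N = eta u 2%N.
    by apply/eqP; rewrite -subr_eq0; apply/eqP; exact: (H (inr (inr (Ordinal (ltnW r2))))).
  have e13 : eta u 1%N = eta u 3%N.
    by apply/eqP; rewrite -subr_eq0; apply/eqP; exact: (H (inr (inr (Ordinal r2)))).
  split=> //; have [->|tN0] := eqVneq ((2 * T + 1)%:R : K) 0; first exact: mul0r.
  have r3 : (2 < rho)%N by rewrite /rho (negPf tN0).
  by have := H (inr (inr (Ordinal r3))); rewrite /l /= => ->; exact: mulr0.
move=> t.
pose t1 m := ext2 (fun j i => t (inr (inl (inl (j, i))))) (n - m)./2.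
pose t2 m := ext2 (fun j i => t (inr (inl (inr (j, i))))) (n - m)./2.
pose x i := ext (fun i => t (inr (inr i))) i.
(* Solves [eta 0 - eta 2 = x 0], [eta 1 - eta 3 = x 1], [eta 0 + eta 1 = x 2] with [eta 1 = 0]. When
   [rho = 2], [x 2] is the default 0. *)
pose et i := nth 0 [:: x 2%N; 0; x 2%N - x 0%N; - x 1%N] i.
have [u uP] := @cochain_build n (fun c m c' k i =>
  if c' == ~~ c then
    if k == q then if c then sol_b (t1 m) (t2 m) i else sol_a (t1 m) (t2 m) i
    else ext3 (fun j k i => t (inl (j, c, k, i))) (n - m)./2 (k %/ 4) i
  else if (m == 1%N) && ~~ c then et i else 0).
have cne c : (c == ~~ c) = false by case: c.
(* Coefficients of exponent 1 in the word's own letter are used at length 1 only. In [a] and [b]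
   they occur at length [m.+2], so there only the exponent-[q] terms remain and the two subsystems
   do not interact. *)
have short c m i : (1 < m)%N -> ~~ odd (n + m) -> coef u c m c 1 i = 0.
  move=> m1 mn; have [mn'|nm] := leqP m n; last first.
    by rewrite /coefficient cochain_family_long // linear0.
  by rewrite uP ?cne ?(ltnW m1) // ?gtn_eqF //; lia.
exists u => -[[[[j c] k] i]|[[[j i]|[j i]]|y]].
- have kT := ltn_ord k; have kE : ((4 * k + 1) %/ 4 = k)%N by lia.
  have [m0 mn mj] := pair_length (ltn_ord j).
  rewrite /l uP ?mn ?m0 ?leq_subr //; try lia.
  rewrite eqxx kE mj (modn_small (ltn_ord i)) ifF; last by lia.
  exact: (ext3E (fun j k i => t (inl (j, c, k, i)))).
- have [m0 mn mj] := pair_length (ltn_ord j).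
  rewrite /l /a /b !short ?subr0; try lia.
  rewrite !uP ?mn ?m0 ?leq_subr //; try lia.
  rewrite !eqxx /= (modn_small (ltn_ord i)) sol_ba // /t1 mj.
  exact: (ext2E (fun j i => t (inr (inl (inl (j, i)))))).
- have [m0 mn mj] := pair_length (ltn_ord j); have i2 := ltn_ord i.
  rewrite /l /a /b !short ?subr0; try lia.
  rewrite !uP ?mn ?m0 ?leq_subr //; try lia.
  rewrite !eqxx /= !modn_small //; try lia.
  rewrite sol_ab // /t2 mj.
  exact: (ext2E (fun j i => t (inr (inl (inr (j, i)))))).
have etaE i : (i < 4)%N -> eta u i = et i.
  move=> i4; rewrite /eta !uP ?addn1 //=; try lia.
  by rewrite subr0 modn_small.
have xE : t (inr (inr y)) = x (val y) by rewrite /x extE.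
rewrite xE /l; case yE : (val y) => [|[|w]]; rewrite !etaE //.
- by rewrite /et /= opprB addrCA subrr addr0.
- by rewrite /et /= opprK add0r.
have -> : w = 0%N by have := ltn_ord y; rewrite -[nat_of_ord y]/(val y) yE /rho; case: ifP; lia.
by rewrite /et /= addr0.
Qed.

End Ranks.

(** * Counting coefficients and assembling the dimensions *)

Lemma sum_residue s N : (s < 4)%N ->
  (\sum_(0 <= k < N) (k %% 4 == s) = (N + 3 - s) %/ 4)%N.
Proof.
move=> s4; elim: N => [|N IHN]; first by rewrite big_geq //; lia.
rewrite big_nat_recr //= IHN; case: eqP; lia.
Qed.

Lemma card_degree_basis q T n : q = (4 * T + 1)%N ->
  #|{: degree_basis q n}| = (2 * T + nth 0 [:: 1; 2; 1; 0] (n %% 4))%N.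
Proof.
move=> qT; rewrite card_sig -sum1_card big_mkcond /=.
pose F k := nat_of_bool (mono_length q k == n %[mod 4]).
have -> : (\sum_(i : 'I_(q.+1.*2)) (if i \in [pred k : 'I_(q.+1.*2) |
    mono_length q k == n %[mod 4]] then 1 else 0) = \sum_(0 <= k < q.+1.*2) F k)%N.
  by rewrite big_mkord; apply: eq_bigr => k _; rewrite inE /F; case: eqP.
rewrite (big_cat_nat _ (n := q.+2)) //=; last by lia.
have n4 : (n %% 4 < 4)%N by rewrite ltn_mod.
have -> : (\sum_(0 <= k < q.+2) F k = (q.+2 + 3 - n %% 4) %/ 4)%N.
  rewrite -(sum_residue _ n4) !big_nat; apply: eq_bigr => k /andP[_ kq].
  by rewrite /F /mono_length ltnNge -ltnS kq.
(* The second half of the indices gives the lengths 1 to [q]; adding the missing length 0 makes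
   [sum_residue] applicable. *)
have E2 : (\sum_(q.+2 <= k < q.+1.*2) F k + (0 == n %% 4)%N = (q.+1 + 3 - n %% 4) %/ 4)%N.
  rewrite -(sum_residue _ n4) big_nat_recl // mod0n addnC; congr (_ + _)%N.
  rewrite -{1}[q.+2]add0n big_addn; have -> : (q.+1.*2 - q.+2 = q)%N by lia.
  apply: eq_bigr => k _; rewrite /F /mono_length.
  have -> : (q.+1 < k + q.+2)%N by lia.
  by have -> : (k + q.+2 - q.+1 = k.+1)%N by lia.
move: (n %% 4)%N n4 E2 => s; move: (\sum_(_ <= _ < _) _)%N => S.
by case: s => [|[|[|[|//]]]] _ /=; rewrite qT; lia.
Qed.

Section Dimensions.
Variables (K : fieldType) (A : algType K) (T : nat).
Local Notation q := (4 * T + 1)%N.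
Variable B : covering_basis A q.
Variables (E : algType K) (tens : A -> A -> E).
Hypothesis tensM : forall a b a' b', tens a b * tens a' b' = tens (a' * a) (b * b').
Hypothesis tens_linl : forall b, linear (tens^~ b).
Hypothesis tens_linr : forall a, linear (tens a).
Hypothesis tens11 : tens 1 1 = 1.
Hypothesis tens_ind : forall U : E -> Prop,
  (forall u v, U u -> U v -> U (u + v)) -> (forall a b, U (tens a b)) -> forall u, U u.
Hypothesis tens_lift : forall (V : lmodType K) (f : A -> A -> V),
  (forall b, linear (f^~ b)) -> (forall a, linear (f a)) ->
  exists F : {linear E -> V}, forall a b, F (tens a b) = f a b.
Variables (X : lmodType E) (iota : {additive A -> X}).
Hypothesis iota_inj : injective iota.
Hypothesis iota_surj : forall x, exists a, iota a = x.
Hypothesis iota_act : forall a b m, tens a b *: iota m = iota (b * m * a).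

Let P : proj_resolution X := bimodule_resolution B tensM tens_linl tens_linr tens11
  tens_ind tens_lift iota_inj iota_surj iota_act.

Definition trace_rank : nat := if (2 * T + 1)%:R == 0 :> K then 2%N else 3%N.

(** [trace_rank] enters twice: for [n] equal to 1 modulo 4 through the outgoing differential, for 2
    modulo 4 through the incoming one. *)
Definition self_ext_dim n : nat :=
  (match n %% 4 with
   | 0 => 2 * T + n + 1
   | 1 => 2 * T + 2 * n + 5 - trace_rank
   | 2 => 2 * T + n + 4 - trace_rank
   | _ => 2 * T
  end)%N.

Let G n (u : cochain K q n) : {linear P n -> X} :=
  cochain_hom B tensM tens_linl tens_linr tens11 tens_ind tens_lift iota_inj iota_surj
    iota_act u.

Let G_lin n c u v x : @G n (c *: u + v) x = c%:A *: G u x + G v x.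
Proof. exact: cochain_hom_linear. Qed.

Let G_inj n u : (forall x, @G n u x = 0) -> u = 0.
Proof. exact: cochain_hom_inj. Qed.

Let G_surj n (h : {linear P n -> X}) : exists u, @G n u =1 h.
Proof. exact: cochain_hom_surj. Qed.

Let D n := hom_diff_fun (V := fun n => cochain K q n) G_surj n.

Let D_ker n u : D n u = 0 <-> forall c m, delta_alg B (cochain_family B u) c m = 0.
Proof.
apply: iff_trans (hom_diff_eq0 G_lin G_inj G_surj u) _.
exact: cochain_cocycle.
Qed.

Definition delta_rank n : nat :=
  (match n %% 4 with
   | 0 => 4 * T * n + 6 * T + 3 * n + 3
   | 1 => 4 * T * n.+1 + 3 * n.+1 + trace_rank
   | 2 => 4 * T * n + 6 * T
   | _ => 4 * T * n.+1
  end)%N.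

Let rank_D n : \dim (limg (D n)) = delta_rank n.
Proof.
have [E4|[E4|[E4|E4]]] : (n %% 4 = 0 \/ n %% 4 = 1 \/ n %% 4 = 2 \/ n %% 4 = 3)%N by lia.
- by rewrite (rank_mod0 (erefl q) E4 (@D_ker n)) /delta_rank E4.
- by rewrite (rank_mod1 (erefl q) E4 (@D_ker n)) /delta_rank E4.
- by rewrite (rank_mod2 (erefl q) E4 (@D_ker n)) /delta_rank E4.
- by rewrite (rank_mod3 (erefl q) E4 (@D_ker n)) /delta_rank E4.
Qed.

Lemma self_cohomology n : cohomology_dim P X n (self_ext_dim n).
Proof.
apply: (cohomology_dim_complex G_lin G_inj (G_surj := G_surj)).
rewrite rank_D.
have -> : \dim {: cochain K q n} = (n.+1 * 4 * (2 * T + nth 0 [:: 1; 2; 1; 0] (n %% 4)))%N.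
  by rewrite dim_functionals !card_prod !card_ord (card_degree_basis n (erefl q)).
have r3 : (1 < trace_rank <= 3)%N by rewrite /trace_rank; case: ifP.
have -> : \dim (boundaries G_surj n) = if n is n'.+1 then delta_rank n' else 0%N.
  by case: n => [|n] /=; [exact: dimv0 | exact: rank_D].
rewrite /self_ext_dim.
(* Degree 0 has no incoming differential; the value agrees with the general one for the class of 0,
   where the incoming rank is [4 * T * n]. *)
case: n => [|n]; first by rewrite /delta_rank /=; lia.
have := divn_eq n 4; set w := (n %/ 4)%N; have := ltn_mod n 4.
case E4: (n %% 4)%N => [|[|[|[|//]]]] _ nE; rewrite nE /delta_rank.
- have -> : ((w * 4 + 0).+1 %% 4 = 1)%N by lia.
  have -> : ((w * 4 + 0) %% 4 = 0)%N by lia.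
  by rewrite /=; nia.
- have -> : ((w * 4 + 1).+1 %% 4 = 2)%N by lia.
  have -> : ((w * 4 + 1) %% 4 = 1)%N by lia.
  by rewrite /=; nia.
- have -> : ((w * 4 + 2).+1 %% 4 = 3)%N by lia.
  have -> : ((w * 4 + 2) %% 4 = 2)%N by lia.
  by rewrite /=; nia.
- have -> : ((w * 4 + 3).+1 %% 4 = 0)%N by lia.
  have -> : ((w * 4 + 3) %% 4 = 3)%N by lia.
  by rewrite /=; nia.
Qed.

End Dimensions.

Lemma exprSrA (S : nzRingType) (a b : S) k : a * b ^+ k.+1 = a * b ^+ k * b.
Proof. by rewrite exprSr mulrA. Qed.

(** * Paths of the quiver as words, and a monomial basis of the algebra *)

Section GammaPaths.
Variable K : fieldType.
Local Notation KG := (pathalg K Gamma).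

(** As $a_i$ and $b_i$ have the same source and target, a path is the same as a start vertex
    together with an arbitrary word in two letters. *)
Fixpoint word_arrows (v : 'I_4) (s : seq bool) : seq (bool * 'I_4) :=
  if s is c :: s' then (c, v) :: word_arrows (ordS v) s' else [::].

Fact word_arrows_path v s : is_quiver_path (Q := Gamma) (v, word_arrows v s).
Proof.
rewrite /is_quiver_path /=; elim: s v => //= c s IHs v.
by rewrite eqxx; exact: IHs.
Qed.

Definition word_path v s : path_of Gamma :=
  exist (is_quiver_path (Q := Gamma)) (v, word_arrows v s) (word_arrows_path v s).

Definition path_word (p : path_of Gamma) : seq bool := map fst (parrows p).

Lemma word_pathK v s : path_word (word_path v s) = s.
Proof.
rewrite /path_word /parrows /=; elim: s v => //= c s IHs v; by rewrite IHs.
Qed.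

Lemma word_path_start v s : pstart (word_path v s) = v. Proof. by []. Qed.

Lemma path_wordK (p : path_of Gamma) : word_path (pstart p) (path_word p) = p.
Proof.
apply: path_inj => //; rewrite /path_word; case: p => -[v s] vs; rewrite /pstart /parrows /=.
move: vs; rewrite /is_quiver_path /=; elim: s v => //= -[c w] s IHs v /andP[/eqP /= -> sP].
by rewrite IHs.
Qed.

Definition word_end (v : 'I_4) (s : seq bool) : 'I_4 := iter (size s) (@ordS 4) v.

Lemma word_path_end v s : pend (word_path v s) = word_end v s.
Proof.
rewrite /pend /pstart /parrows /= /word_end.
elim: s v => //= c s IHs v; rewrite IHs.
by rewrite -iterSr.
Qed.

Lemma word_arrows_cat v s t :
  word_arrows v (s ++ t) = word_arrows v s ++ word_arrows (word_end v s) t.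
Proof. by rewrite /word_end; elim: s v => //= c s IHs v; rewrite IHs -iterSr. Qed.

Definition word_vec v s : KG := path_vec K (word_path v s).

Lemma word_vecM v s w t :
  word_vec v s * word_vec w t = if word_end v s == w then word_vec v (s ++ t) else 0.
Proof.
apply: (etrans (catalg_mulUU K (C := path_cat Gamma) (word_path v s) (word_path w t))).
rewrite /=; case: pcompP => [r|]; rewrite word_path_end word_path_start => e; last first.
  by rewrite (negPf e).
move=> sr _ ar; rewrite e eqxx; congr path_vec; apply: path_inj => //.
by rewrite ar /parrows /= word_arrows_cat e.
Qed.

Definition letter_vec (c : bool) : KG := if c then yG K else xG K.

Lemma letter_vecE c : letter_vec c = \sum_v word_vec v [:: c].
Proof.
by case: c; apply: eq_bigr => i _; congr path_vec; apply: path_inj.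
Qed.

Lemma word_vec_letter v s c : word_vec v s * letter_vec c = word_vec v (rcons s c).
Proof.
rewrite letter_vecE mulr_sumr (bigD1 (word_end v s)) //= big1 ?addr0.
  by rewrite word_vecM eqxx cats1.
by move=> i ie; rewrite word_vecM eq_sym (negPf ie).
Qed.

Lemma word_vec_letterX v s c k :
  word_vec v s * letter_vec c ^+ k = word_vec v (s ++ nseq k c).
Proof.
elim: k => [|k IHk]; first by rewrite mulr1 cats0.
have nE : nseq k.+1 c = nseq k c ++ [:: c] by rewrite -addn1 nseqD.
have xE : word_vec v s * letter_vec c ^+ k.+1 = word_vec v s * letter_vec c ^+ k * letter_vec c.
  exact: exprSrA.
have wE : rcons (s ++ nseq k c) c = s ++ nseq k.+1 c by rewrite nE catA cats1.
rewrite xE IHk -wE.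
exact: word_vec_letter.
Qed.

Lemma letter_word_vec v c : letter_vec c * word_vec (ordS v) [::] = word_vec v [:: c].
Proof.
rewrite letter_vecE mulr_suml (bigD1 v) //= big1 ?addr0.
  by rewrite word_vecM eqxx.
move=> i iv; rewrite word_vecM /word_end /= (inj_eq (@ordS_inj 4)) (negPf iv) //.
Qed.

Lemma vertex_letter_vec v c :
  word_vec v [::] * letter_vec c = letter_vec c * word_vec (ordS v) [::].
Proof. by rewrite word_vec_letter letter_word_vec. Qed.

Lemma sum_word_vec : \sum_v word_vec v [::] = 1.
Proof.
transitivity (\sum_(p <- ids (path_cat Gamma)) path_vec K p); last by [].
rewrite /= big_map big_enum; apply: eq_bigr => v _; congr path_vec.
exact: path_inj.
Qed.

Definition word_functional (f : 'I_4 -> seq bool -> K) : {linear KG -> K^o} :=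
  lin_ext (fun p : path_of Gamma => f (pstart p) (path_word p) : K^o).

Lemma word_functionalE f v s : word_functional f (word_vec v s) = f v s.
Proof.
apply: (etrans (lin_extU _ (word_path v s))).
by rewrite word_path_start word_pathK.
Qed.

Lemma word_functionalM f v s w t :
  word_functional f (word_vec v s * word_vec w t) = (word_end v s == w)%:R * f v (s ++ t).
Proof.
have e := congr1 (word_functional f) (word_vecM v s w t); apply: (etrans e).
case: (_ == w); last by rewrite mul0r; exact: (linear0 (word_functional f)).
by rewrite mul1r; exact: word_functionalE.
Qed.

Lemma word_functional_letterX f v s c k w t :
  word_functional f (word_vec v s * letter_vec c ^+ k * word_vec w t) =
  (iter (size s + k) (@ordS 4) v == w)%:R * f v (s ++ nseq k c ++ t).
Proof.
rewrite word_vec_letterX word_functionalM -catA.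
by rewrite /word_end size_cat size_nseq.
Qed.

(** Both powers have the same length and hence the same end vertex, so the composability factor is
    common and only the sum of the two values matters. *)
Lemma word_functional_powers f v s n w t :
  (forall u u', f v (u ++ nseq n false ++ u') + f v (u ++ nseq n true ++ u') = 0) ->
  word_functional f
    (word_vec v s * (letter_vec false ^+ n + letter_vec true ^+ n) * word_vec w t) = 0.
Proof.
move=> f0; rewrite mulrDr mulrDl.
apply: (etrans (linearD (word_functional f) _ _)).
have E c := word_functional_letterX f v s c n w t.
apply: (etrans (congr2 (fun a b : K => a + b) (E false) (E true))).
by rewrite -mulrDr f0 mulr0.
Qed.

Lemma word_functional_letters f v s c d w t :
  (forall u u', f v (u ++ [:: c; d] ++ u') = 0) ->
  word_functional f (word_vec v s * (letter_vec c * letter_vec d) * word_vec w t) = 0.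
Proof.
move=> f0; rewrite mulrA !word_vec_letter word_functionalM.
by rewrite -!cats1 -!catA f0 mulr0.
Qed.

End GammaPaths.

(* The monomials e i * z c ^+ k span as soon as the words in the letters do. *)
Section MonomialWords.
Variables (A : nzRingType) (z : bool -> A) (q : nat).
Hypothesis zz : forall c, z c * z (~~ c) = 0.
Hypothesis zN : forall c, z (~~ c) ^+ q.+1 = - z c ^+ q.+1.

Definition word_prod (s : seq bool) : A := foldr (fun c a => z c * a) 1 s.

(** Prepending the other letter to a positive power gives zero. Prepending the same letter raises
    the exponent, except at the top, where rewriting in the other letter again gives zero. *)
Lemma word_prod_monomial s :
  word_prod s = 0 \/ exists c k, (k <= q.+1)%N /\ word_prod s = z c ^+ k.
Proof.
elim: s => [|d s IHs]; first by right; exists true, 0%N.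
rewrite -[word_prod _]/(z d * word_prod s); case: IHs => [->|[c [k [kq ->]]]].
  by left; rewrite mulr0.
have [->|dc] := eqVneq d c.
  move: kq; rewrite leq_eqVlt => /orP[/eqP->|kq]; last by right; exists c, k.+1; rewrite exprS.
  left; have -> : z c ^+ q.+1 = - z (~~ c) ^+ q.+1 by rewrite zN opprK.
  by rewrite exprS mulrN mulrA zz mul0r oppr0.
have -> : c = ~~ d by case: c d dc {kq} => [] [].
case: k kq => [|k] kq; first by right; exists d, 1%N; rewrite mulr1 expr1.
by left; rewrite exprS mulrA zz mul0r.
Qed.

Lemma word_prod_rcons s c : word_prod (rcons s c) = word_prod s * z c.
Proof. by elim: s => [|d s IHs] /=; rewrite ?mulr1 ?mul1r // IHs mulrA. Qed.

End MonomialWords.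

Lemma catalg_span_ind (K : fieldType) (C : fobCat) (V : lmodType K)
    (f : {linear catalg K C -> V}) (U : V -> Prop) :
  U 0 -> (forall a b, U a -> U b -> U (a + b)) -> (forall c a, U a -> U (c *: a)) ->
  (forall b : C, U (f (<< b >> : {malg K[mor C]}))) -> forall z, U (f z).
Proof.
move=> U0 UD UZ Uf z; rewrite (monalgE z) linear_sum; elim/big_ind: _ => // b _.
have -> : << z@_b *g b >> = z@_b *: << b >> :> {malg K[mor C]}.
  by apply/malgP => k; rewrite mcoeffZ !mcoeffU mulrnAr mulr1.
by rewrite linearZ_LR; exact: UZ.
Qed.

Lemma nseq_eqE (b d : bool) l k :
  (nseq l d == nseq k b) = (l == k) && ((l == 0%N) || (b == d)).
Proof.
apply/eqP/andP => [e|[/eqP-> /orP[/eqP->//|/eqP->//]]].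
have lk : l = k by rewrite -(size_nseq l d) e size_nseq.
split; first exact/eqP; rewrite -lk in e.
by case: l e {lk} => //= l [->].
Qed.

Lemma addr0_eqN (V : zmodType) (a b : V) : a + b = 0 -> a = - b.
Proof. by move/eqP; rewrite addr_eq0 => /eqP. Qed.

Section CoveringBasis.
Variables (K : fieldType) (T : nat).
Local Notation KG := (pathalg K Gamma).
Local Notation A := (A_T K T).
Local Notation q := (4 * T + 1)%N.
Local Notation proj := (quotpi (Relations (@IT_proper K T))).

Let vtx (i : nat) : 'I_4 := inord (i %% 4).

Let vtxE i j : (vtx i == vtx j) = (i == j %[mod 4]).
Proof. by rewrite -val_eqE /= !inordK ?ltn_mod. Qed.

Let vtx_val (i : 'I_4) : vtx i = i.
Proof. by rewrite /vtx modn_small // inord_val. Qed.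

Let vtx_mod i j : i = j %[mod 4] -> vtx i = vtx j.
Proof. by move=> ij; rewrite /vtx ij. Qed.

Let ordS_vtx i : ordS (vtx i) = vtx i.+1.
Proof. by apply: val_inj; rewrite /= !inordK ?ltn_mod // -addn1 modnDml addn1. Qed.

Definition AT_letter (c : bool) : A := proj (letter_vec K c).
Definition AT_vertex (i : nat) : A := proj (word_vec K (vtx i) [::]).

Let proj0 g : IT_gen T g -> proj g = 0.
Proof.
move=> Xg; rewrite -(raddf0 proj); apply/quotpi_eq; rewrite subr0.
by move=> J _; apply.
Qed.

Let AT_e_sum : \sum_(i < 4) AT_vertex i = 1.
Proof.
apply: (etrans (esym (raddf_sum proj _ _ _))); apply: (etrans _ (rmorph1 proj)).
congr proj; rewrite -sum_word_vec; apply: eq_bigr => i _.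
exact: (congr1 (fun v => word_vec K v [::]) (vtx_val i)).
Qed.

Let AT_e_per i : AT_vertex (i + 4) = AT_vertex i.
Proof. by rewrite /AT_vertex (@vtx_mod (i + 4) i) // modnDr. Qed.

Let AT_e_mul i j : AT_vertex i * AT_vertex j = if i == j %[mod 4] then AT_vertex i else 0.
Proof.
apply: (etrans (esym (rmorphM proj _ _))).
apply: (etrans (congr1 proj (word_vecM K (vtx i) [::] (vtx j) [::]))).
by rewrite -[word_end _ _]/(vtx i) vtxE; case: eqP => // _; exact: raddf0.
Qed.

Let AT_ez i c : AT_vertex i * AT_letter c = AT_letter c * AT_vertex i.+1.
Proof.
apply: (etrans (esym (rmorphM proj _ _))); apply: (etrans _ (rmorphM proj _ _)).
apply: (congr1 proj); apply: (etrans (vertex_letter_vec K (vtx i) c)).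
by rewrite (ordS_vtx i).
Qed.

Let AT_zz c : AT_letter c * AT_letter (~~ c) = 0.
Proof.
apply: (etrans (esym (rmorphM proj _ _))); apply: proj0.
by case: c; [apply: Or33 | apply: Or31].
Qed.

Let AT_zN c : AT_letter (~~ c) ^+ q.+1 = - AT_letter c ^+ q.+1.
Proof.
have qE : q.+1 = (4 * T + 2)%N by rewrite addn1 addn2.
have XE b : proj (letter_vec K b ^+ q.+1) = AT_letter b ^+ q.+1 := rmorphXn proj _ _.
have relN : IT_gen T (letter_vec K false ^+ q.+1 + letter_vec K true ^+ q.+1).
  by apply: Or32; exact: (congr1 (fun n => letter_vec K false ^+ n + letter_vec K true ^+ n) qE).
have key : AT_letter false ^+ q.+1 + AT_letter true ^+ q.+1 = 0.
  apply: (etrans (esym (congr2 +%R (XE false) (XE true)))).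
  exact: (etrans (esym (raddfD proj _ _)) (proj0 relN)).
case: c; first exact: addr0_eqN.
exact/addr0_eqN/(etrans (addrC _ _) key).
Qed.

Let proj_word v s : proj (word_vec K v s) = proj (word_vec K v [::]) * word_prod AT_letter s.
Proof.
elim/last_ind: s => [|s c IHs]; first exact/esym/mulr1.
rewrite word_prod_rcons mulrA -IHs.
apply: (etrans (congr1 proj (esym (word_vec_letter _ _ _ _)))).
exact: (rmorphM proj).
Qed.

Let AT_span (U : A -> Prop) :
  (forall a b, U a -> U b -> U (a + b)) -> (forall c a, U a -> U (c *: a)) ->
  (forall i c k, (k <= q.+1)%N -> U (AT_vertex i * AT_letter c ^+ k)) -> forall a, U a.
Proof.
move=> UD UZ Um; have U0 : U 0 by have := UZ 0 _ (Um 0%N true 0%N isT); rewrite scale0r.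
elim/quotpi_ind => w.
pose f : {linear catalg K (path_cat Gamma) -> A} := proj.
apply: (catalg_span_ind (f := f) U0 UD UZ _ w) => p; rewrite /f.
suff Uw : U (proj (word_vec K (pstart p) (path_word p))).
  by rewrite -[in X in U X](path_wordK p); exact: Uw.
rewrite proj_word.
suff Uv : U (AT_vertex (pstart p) * word_prod AT_letter (path_word p)).
  by rewrite /AT_vertex vtx_val in Uv; exact: Uv.
have [->|[c [k [kq ->]]]] := word_prod_monomial AT_zz AT_zN (path_word p).
  by rewrite mulr0.
exact: Um.
Qed.

(* [theta c k i] reads off the coefficient of e_i z_c^k, with y^N = - x^N. *)
Let theta_fun (c : bool) (k i : nat) (v : 'I_4) (s : seq bool) : K :=
  ((k <= q.+1)%N && (v == vtx i))%:R *
  ((s == nseq k c)%:R - ((k == q.+1) && (s == nseq k (~~ c)))%:R).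

Let theta c k i := word_functional (theta_fun c k i).

Let theta_mixed c k i d v u u' : theta_fun c k i v (u ++ [:: d; ~~ d] ++ u') = 0.
Proof.
have mixed b n : (u ++ [:: d; ~~ d] ++ u' == nseq n b) = false.
  apply/negP => /eqP e; have : all (pred1 b) (u ++ [:: d; ~~ d] ++ u') by rewrite e all_pred1_nseq.
  by rewrite all_cat /=; case: (b) (d) => [] []; rewrite !(andbF, andFb).
by rewrite /theta_fun !mixed andbF subr0 mulr0.
Qed.

(** For [k] at most [q.+1] the words can match only if [u] and [u'] are empty and [k = q.+1], and
    then the two values cancel. For larger [k], where matches with nonempty [u] would occur, the
    first factor of [theta_fun] is zero. *)
Let theta_power c k i v u u' :
  theta_fun c k i v (u ++ nseq q.+1 false ++ u') +
  theta_fun c k i v (u ++ nseq q.+1 true ++ u') = 0.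
Proof.
rewrite /theta_fun -mulrDr.
have [kq|] := leqP k q.+1; last by rewrite mul0r.
have szE b d : u ++ nseq q.+1 d ++ u' == nseq k b ->
    [/\ u = [::], u' = [::], k = q.+1 & b = d].
  move=> /eqP e; have := congr1 size e; rewrite !size_cat !size_nseq => se.
  have [u0 u'0 kE] : [/\ size u = 0, size u' = 0 & k = q.+1]%N.
    by move: se kq; move: (size u) (size u') (q.+1) => a b' n; split; lia.
  move/size0nil: u0 => u0; move/size0nil: u'0 => u'0.
  by split=> //; move: e; rewrite u0 u'0 cats0 kE => -[].
have E b d : (u ++ nseq q.+1 d ++ u' == nseq k b) =
    [&& u == [::], u' == [::], k == q.+1 & b == d].
  apply/idP/and4P => [/szE [-> -> -> ->] //|[/eqP-> /eqP-> /eqP-> /eqP->]].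
  by rewrite cats0.
rewrite !E; case: (u == _); case: (u' == _); case: (k == _); case: c => /=;
  by rewrite ?subr0 ?subrr ?addr0 ?sub0r ?addNr ?subrr ?mulr0.
Qed.

(** This lets the coefficient functionals descend to the quotient, and thereby shows that the
    spanning monomials satisfy no relations beyond $y^N=-x^N$. *)
Let theta_rel c k i z : ideal_gen (IT_gen (K := K) T) z -> theta c k i z = 0.
Proof.
apply: ideal_gen_vanish => g gX; apply: catalg_sandwich0 => p r.
suff H v s w t : theta c k i (word_vec K v s * g * word_vec K w t) = 0.
  rewrite -[in X in X * _](path_wordK p) -[in X in _ * X](path_wordK r); exact: H.
case: gX => ->.
- exact: (word_functional_letters (c := false) (d := true) _ _ _ (theta_mixed _ _ _ false _)).
- have qE : (4 * T + 2 = q.+1)%N by rewrite addn1 addn2.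
  rewrite qE; exact: (word_functional_powers _ _ _ (theta_power _ _ _ _)).
- exact: (word_functional_letters (c := true) (d := false) _ _ _ (theta_mixed _ _ _ true _)).
Qed.

Let AT_coef_fun c k i (a : A) : K^o := theta c k i (quotrepr a).

Let AT_coef_fun_pi c k i z : AT_coef_fun c k i (proj z) = theta c k i z.
Proof.
have : ideal_gen (IT_gen (K := K) T) (quotrepr (proj z) - z).
  by apply/(quotpi_eq (Relations (@IT_proper K T))); exact: quotreprK.
move/(theta_rel c k i) => e; apply/eqP; rewrite -subr_eq0; apply/eqP.
exact: (etrans (esym (linearB (theta c k i) _ _)) e).
Qed.

Fact AT_coef_linear c k i : linear (AT_coef_fun c k i).
Proof.
move=> l; elim/quotpi_ind => x; elim/quotpi_ind => y.
have e : l *: proj x + proj y = proj (l *: x + y) := esym (linearP proj l x y).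
apply: (etrans (congr1 (AT_coef_fun c k i) e)).
apply: (etrans (AT_coef_fun_pi _ _ _ _)); apply: (etrans (linearP (theta c k i) l x y)).
exact: (esym (congr2 (fun a b : K^o => l *: a + b) (AT_coef_fun_pi c k i x) (AT_coef_fun_pi c k i y))).
Qed.

HB.instance Definition _ c k i :=
  GRing.isLinear.Build K A K^o _ (AT_coef_fun c k i) (AT_coef_linear c k i).

Definition AT_coef c k i : {linear A -> K^o} := AT_coef_fun c k i.

Let AT_coefE c k i j d l :
  AT_coef c k i (AT_vertex j * AT_letter d ^+ l) = theta_fun c k i (vtx j) (nseq l d).
Proof.
have e : AT_vertex j * AT_letter d ^+ l = proj (word_vec K (vtx j) (nseq l d)).
  apply: (etrans (congr1 (fun a => AT_vertex j * a) (esym (rmorphXn proj l _)))).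
  apply: (etrans (esym (rmorphM proj _ _))); apply: (congr1 proj).
  exact: word_vec_letterX.
apply: (etrans (congr1 (AT_coef c k i) e)); apply: (etrans (AT_coef_fun_pi _ _ _ _)).
exact: word_functionalE.
Qed.

Let AT_coef_same c k i j l : (k <= q.+1)%N -> (l <= q.+1)%N ->
  AT_coef c k i (AT_vertex j * AT_letter c ^+ l) = ((l == k) && (i == j %[mod 4]))%:R.
Proof.
move=> kq lq; rewrite AT_coefE /theta_fun kq vtxE !nseq_eqE eqxx orbT andbT eq_sym.
have -> : (k == q.+1) && ((l == k) && ((l == 0%N) || (~~ c == c))) = false.
  by case: c; case: eqP => // ->; case: eqP => // ->.
by rewrite subr0 -natrM mulnb andbC.
Qed.

Let AT_coef_other c k i j l : (k <= q.+1)%N -> (l <= q)%N -> (0 < k + l)%N ->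
  AT_coef c k i (AT_vertex j * AT_letter (~~ c) ^+ l) = 0.
Proof.
move=> kq lq kl; rewrite AT_coefE /theta_fun !nseq_eqE.
have -> : (l == k) && ((l == 0%N) || (c == ~~ c)) = false.
  by apply/negP => /andP[/eqP lk]; case: c; case: eqP => //; lia.
have -> : (k == q.+1) && ((l == k) && ((l == 0%N) || (~~ c == ~~ c))) = false.
  by apply/negP => /and3P[/eqP kE /eqP lE _]; lia.
by rewrite subr0 mulr0.
Qed.

Let q_mod4 : (q %% 4 = 1)%N. Proof. by rewrite mulnC modnMDl. Qed.

Definition AT_basis : covering_basis A q :=
  CoveringBasis AT_e_sum AT_e_per AT_e_mul AT_ez AT_zz AT_zN AT_span
    AT_coef_same AT_coef_other q_mod4.

End CoveringBasis.

(** * Specialization to the enveloping algebra and Hochschild cohomology *)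

Section HHDimension.
Variables (K : fieldType) (A : algType K) (T : nat).
Variable B : covering_basis A (4 * T + 1).

Let lift_ex (V : lmodType K) (f : A -> A -> V) :
  (forall b, linear (f^~ b)) -> (forall a, linear (f a)) ->
  exists F : {linear env A -> V}, forall a b, F (tens a b) = f a b.
Proof.
move=> fl fr.
pose L := GRing.isLinear.Build K (env A) V _ (env_lift f) (env_lift_linear fl fr).
pose F : {linear env A -> V} := HB.pack (env_lift f) L.
by exists F; exact: (env_lift_tens fl fr).
Qed.

Let iota (a : A) : bimod A := a.

Let iota_zmod : zmod_morphism iota. Proof. by []. Qed.
HB.instance Definition _ := GRing.isZmodMorphism.Build A (bimod A) iota iota_zmod.

Let iota_inj : injective iota. Proof. by []. Qed.
Let iota_surj x : exists a, iota a = x. Proof. by exists x. Qed.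
Let iota_act a b m : tens a b *: (iota m : (bimod A : lmodType (env A))) = iota (b * m * a).
Proof. exact: env_act_tens. Qed.

Lemma HH_dim_covering n : HH_dim A n (self_ext_dim K T n).
Proof.
have H := @self_cohomology K A T B (env A) (@tens K A) (@tensM K A) (@tens_linl K A)
  (@tens_linr K A) (@tens11 K A) (@env_ind K A) lift_ex (bimod A) iota iota_inj iota_surj iota_act n.
split.
  exact: (inhabits (bimodule_resolution B (@tensM K A) (@tens_linl K A)
  (@tens_linr K A) (@tens11 K A) (@env_ind K A) lift_ex iota_inj iota_surj iota_act)).
by move=> P; exact: (cohomology_dim_indep P H).
Qed.

End HHDimension.

Local Close Scope ring_scope.

Lemma char_dvdE (K : fieldType) n : (0 < n)%N -> char_dvd K n <-> (n%:R == 0 :> K)%R.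
Proof.
move=> n0; split=> [[p pK pn]|nK]; first by rewrite -(dvdn_pcharf pK).
by have [p pK] := natf0_pchar n0 nK; exists p; rewrite ?(dvdn_pcharf pK).
Qed.

Theorem theorem3p10 (K : closedFieldType) (T m r : nat) (hr : (r <= 3)%N) :
  (r = 0%N -> HH_dim (A_T K T) (4 * m + r) (2 * T + 4 * m + 1)) /\
  (char_dvd K (2 * T + 1) -> r = 1%N ->
     HH_dim (A_T K T) (4 * m + r) (2 * T + 8 * m + 5)) /\
  (~ char_dvd K (2 * T + 1) -> r = 1%N ->
     HH_dim (A_T K T) (4 * m + r) (2 * T + 4 * (2 * m + 1))) /\
  (char_dvd K (2 * T + 1) -> r = 2%N ->
     HH_dim (A_T K T) (4 * m + r) (2 * T + 4 * (m + 1))) /\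
  (~ char_dvd K (2 * T + 1) -> r = 2%N ->
     HH_dim (A_T K T) (4 * m + r) (2 * T + 4 * m + 3)) /\
  (r = 3%N -> HH_dim (A_T K T) (4 * m + r) (2 * T)).
Proof.
have HH d : self_ext_dim K T (4 * m + r) = d -> HH_dim (A_T K T) (4 * m + r) d.
  by move<-; exact: (HH_dim_covering (AT_basis K T)).
have T0 : (0 < 2 * T + 1)%N by lia.
have charT := char_dvdE K T0.
have res : (4 * m + r) %% 4 = r by rewrite mulnC modnMDl modn_small.
have rank_dvd : char_dvd K (2 * T + 1) -> trace_rank K T = 2.
  by move/charT => e; rewrite /trace_rank e.
have rank_ndvd : ~ char_dvd K (2 * T + 1) -> trace_rank K T = 3.
  by move=> ndvd; rewrite /trace_rank; case: ifP => // /charT.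
split; last split; last split; last split; last split;
  [move=> rE | move=> /rank_dvd rk rE | move=> /rank_ndvd rk rE |
   move=> /rank_dvd rk rE | move=> /rank_ndvd rk rE | move=> rE];
  apply: HH; rewrite /self_ext_dim res rE ?rk /=; lia.
Qed.
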